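(* Let $1<p<+\infty$ and let $\mathbb{M}^m_\sigma$ be a $p$-stochastically complete and $p$-Feller model manifold whose warping function satisfies $$\inf_{(0,+\infty)}\frac{\sigma'}{\sigma}>-\infty.$$ Let $\Omega\Subset\mathbb{M}^m_\sigma$ be a domain and let $u\in C^1(\mathbb{M}^m_\sigma\setminus\bar\Omega)$ be a nonnegative and bounded function satisfying $$\Delta_p u\geq\Lambda(u)\quad\text{weakly on }\mathbb{M}^m_\sigma\setminus\bar\Omega,$$ where $\Lambda:[0,+\infty)\to[0,+\infty)$ is a non-decreasing function such that (i) $\Lambda(0)=0$, (ii) $\Lambda(t)>0$ for all $t>0$, (iii) $\liminf_{t\to0+}\Lambda(t)/t^\xi>0$, for some $0\leq\xi<p-1$. Then $u$ has compact support.
   Context: Model manifold: given a smooth function $\sigma:[0,+\infty)\to[0,+\infty)$ with $\sigma(t)>0$ for all $t>0$, $\sigma^{(2k)}(0)=0$ for all $k=0,1,2,\dots$ and $\sigma'(0)=1$, the model manifold $\mathbb{M}^m_\sigma$ is $\mathbb{R}^m$ endowed with the smooth complete Riemannian metric which in polar coordinates is $g=dr\otimes dr+\sigma^2(r)\,g_{\mathbb{S}^{m-1}}$. $\Delta_p u=\mathrm{div}(|\nabla u|^{p-2}\nabla u)$ in the distributional sense; $\Delta_p u\geq F$ weakly on an open set $D$ means $-\int_D g(|\nabla u|^{p-2}\nabla u,\nabla\varphi)\geq\int_D F\varphi$ for every $0\leq\varphi\in C^\infty_c(D)$. $\Omega\Subset M$ means that $\bar\Omega$ is compact in $M$. ''$u$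 has compact support'' means that $u$ vanishes outside some compact subset of $\mathbb{M}^m_\sigma$. $p$-stochastically complete: for some (equivalently, any) $\lambda>0$, the only function $u\in C^0(M)\cap W^{1,p}_{\mathrm{loc}}(M)$ with $0\leq u\leq\sup_M u<+\infty$ and $\Delta_p u\geq\lambda u^{p-1}$ weakly on $M$ is $u\equiv0$. $p$-Feller: for any smooth domain $\Omega\Subset M$ and any constant $\lambda>0$, the minimal solution $h\in C^1(M\setminus\Omega)$ of $\Delta_p h=\lambda h^{p-1}$ (weakly) on $M\setminus\bar\Omega$, $h=1$ on $\partial\Omega$, $h\geq0$ on $M\setminus\Omega$, satisfies $h(x)\to0$ as $x\to\infty$ (i.e. as $x$ leaves every compact set); minimal means that $h\leq w$ for every other solution $w$ of the same problem (such a minimal solution always exists). *)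

(* Defs.v *)
From HB Require Import structures.
From mathcomp Require Import all_boot all_order all_algebra.
From mathcomp Require Import all_classical all_reals all_analysis.

Set Implicit Arguments.
Unset Strict Implicit.
Unset Printing Implicit Defensive.

Import Order.TTheory GRing.Theory Num.Theory.
Import numFieldNormedType.Exports.

Local Open Scope classical_set_scope.
Local Open Scope ring_scope.

(* The sigma-algebra on R^n generated by the n coordinates; since R is second
   countable, it is the Borel sigma-algebra of 'rV[R]_n. *)
Definition rV_display : measure_display. Proof. exact: default_measure_display. Qed.

Section measurable_rV.
Context (R : realType) (n : nat).

Let coors (i : 'I_n) (v : 'rV[R]_n) : measurableTypeR R := v ord0 i.

Let rV_set0 : g_sigma_preimage coors set0.
Proof. exact: sigma_algebra0. Qed.

Let rV_setC A : g_sigma_preimage coors A -> g_sigma_preimage coors (~` A).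
Proof. exact: sigma_algebraC. Qed.

Let rV_bigcup (F : (set 'rV[R]_n)^nat) :
  (forall i, g_sigma_preimage coors (F i)) ->
  g_sigma_preimage coors (\bigcup_i F i).
Proof. exact: sigma_algebra_bigcup. Qed.

HB.instance Definition _ := @isMeasurable.Build rV_display
  'rV[R]_n (g_sigma_preimage coors) rV_set0 rV_setC rV_bigcup.

Lemma measurable_coord (i : 'I_n) :
  measurable_fun [set: 'rV[R]_n]
    ((fun v => v ord0 i) : 'rV[R]_n -> measurableTypeR R).
Proof.
move=> _ Y mY; rewrite setTI; apply: sub_sigma_algebra => /=.
rewrite -bigcup_seq/=; exists i => /=; first by rewrite mem_index_enum.
by exists Y => //; rewrite setTI.
Qed.

Lemma measurable_fun_rV d (T : measurableType d) (f : T -> 'rV[R]_n) :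
  (forall i, measurable_fun [set: T]
    ((fun x => f x ord0 i) : T -> measurableTypeR R)) ->
  measurable_fun [set: T] f.
Proof.
move=> mf.
apply: (measurability
  (\big[setU/set0]_(i < n) preimage_set_system setT (coors i) measurable)) => //.
move=> _ [A + <-]; rewrite -bigcup_seq => -[i _ /=] [B mB <-].
by rewrite !setTI; have := mf i measurableT B mB; rewrite setTI.
Qed.

End measurable_rV.

Section lebesgue_rV.
Context (R : realType).

Definition cons_rV n (p : 'rV[R]_n * measurableTypeR R) : 'rV[R]_n.+1 :=
  row_mx (const_mx p.2 : 'rV[R]_1) p.1.

Lemma cons_rV0 n (p : 'rV[R]_n * measurableTypeR R) :
  cons_rV p ord0 ord0 = p.2.
Proof.
have -> : ord0 = lshift n ord0 :> 'I_(1 + n) by exact: val_inj.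
by rewrite /cons_rV (@row_mxEl _ 1 1 n) mxE.
Qed.

Lemma cons_rVS n (p : 'rV[R]_n * measurableTypeR R) i :
  cons_rV p ord0 (lift ord0 i) = p.1 ord0 i.
Proof.
have -> : lift ord0 i = rshift 1 i :> 'I_(1 + n) by exact: val_inj.
by rewrite /cons_rV (@row_mxEr _ 1 1 n).
Qed.

Lemma measurable_cons_rV n : measurable_fun setT (@cons_rV n).
Proof.
apply: measurable_fun_rV => i; case: (unliftP ord0 i) => [j ->|->].
  under eq_fun do rewrite cons_rVS.
  exact: measurableT_comp (@measurable_coord R n j) measurable_fst.
by under eq_fun do rewrite cons_rV0; exact: measurable_snd.
Qed.

Definition lebesgue_succ n (mu : {measure set 'rV[R]_n -> \bar R}) :=
  pushforward (mu \x @lebesgue_measure R)%E (@cons_rV n).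

Section lebesgue_succ_measure.
Context n (mu : {measure set 'rV[R]_n -> \bar R}).
Let m := measure_function_pushforward__canonical__measure_function_Measure
  (mu \x @lebesgue_measure R)%E (@measurable_cons_rV n).
Let succ0 : lebesgue_succ mu set0 = 0%E. Proof. exact: (measure0 m). Qed.
Let succ_ge0 A : (0 <= lebesgue_succ mu A)%E.
Proof. exact: (measure_ge0 m). Qed.
Let succ_sigma_additive : semi_sigma_additive (lebesgue_succ mu).
Proof. exact: (@measure_semi_sigma_additive _ _ _ m). Qed.
HB.instance Definition _ := isMeasure.Build _ _ _ (lebesgue_succ mu)
  succ0 succ_ge0 succ_sigma_additive.
End lebesgue_succ_measure.

Fixpoint lebesgue_rV n : {measure set 'rV[R]_n -> \bar R} :=
  if n is n'.+1 then lebesgue_succ (lebesgue_rV n') else \d_(0 : 'rV[R]_0).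

Lemma lebesgue_rV_box n (A : 'I_n -> set (measurableTypeR R)) :
  (forall i, measurable (A i)) ->
  lebesgue_rV n [set v | forall i, A i (v ord0 i)] =
  (\prod_(i < n) lebesgue_measure (A i))%E.
Proof.
elim: n A => [|n IH] A mA.
  rewrite big_ord0 /= diracE mem_set//; first by move=> [].
rewrite big_ord_recl /= /lebesgue_succ /pushforward.
have -> : @cons_rV n @^-1` [set v | forall i, A i (v ord0 i)] =
  [set v : 'rV[R]_n | forall i : 'I_n, A (lift ord0 i) (v ord0 i)] `*` A ord0.
  apply/seteqP; split => -[v x] /= H.
    split=> [i|]; first by have := H (lift ord0 i); rewrite cons_rVS.
    by have := H ord0; rewrite cons_rV0.
  move=> i; case: (unliftP ord0 i) => [j ->|->]; rewrite ?cons_rVS ?cons_rV0.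
    exact: H.1.
  exact: H.2.
rewrite product_measure1E//=; first by rewrite muleC; congr (_ * _)%E; exact: IH.
rewrite [X in measurable X](_ : _ =
  \bigcap_(i in [set: 'I_n]) ((fun v : 'rV[R]_n => v ord0 i) @^-1` A (lift ord0 i))).
  apply: fin_bigcap_measurable => // i _.
  by have := @measurable_coord R n i measurableT _ (mA (lift ord0 i)); rewrite setTI.
by apply/seteqP; split => v /= H i; [move=> _; exact: H|exact: (H i)].
Qed.
End lebesgue_rV.

Section calculus.
Context (R : realType) (m : nat).
Implicit Types (D : set 'rV[R]_m) (f u : 'rV[R]_m -> R) (w : 'rV[R]_m -> 'rV[R]_m).

(* A function on D is represented by a total function whose values outside D
   are irrelevant. *)

Definition partial (i : 'I_m) f : 'rV[R]_m -> R :=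
  fun x => 'D_(delta_mx ord0 i) f x.

Definition dfun f : 'rV[R]_m -> 'rV[R]_m := fun x => \row_i partial i f x.

(* Meant for open D. *)
Fixpoint Cn (k : nat) D f : Prop :=
  (forall x, D x -> {for x, continuous f}) /\
  (if k is k'.+1 then
     forall i, (forall x, D x -> derivable f x (delta_mx ord0 i)) /\
               Cn k' D (partial i f)
   else True).

Definition smooth_on D f := forall k, Cn k D f.

(* C^1 up to the boundary of the closed set F, with interior D. *)
Definition C1_closure D F f :=
  [/\ Cn 1 D f, {within F, continuous f} &
    exists2 w, {within F, continuous w} & forall x, D x -> w x = dfun f x].

Definition test_function D f :=
  [/\ smooth_on setT f, compact (closure [set x | f x != 0]) &
    closure [set x | f x != 0] `<=` D].

Definition precompact_domain D :=
  [/\ D !=set0, open D, connected D & compact (closure D)].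

(* Near each boundary point, D is the sublevel set {rho < 0} of a smooth
   function rho without critical points. *)
Definition smooth_boundary D := forall x, (closure D `\` D) x ->
  exists U (rho : 'rV[R]_m -> R), [/\ open U, U x, smooth_on U rho,
    (forall y, U y -> dfun rho y != 0) &
    D `&` U = [set y | U y /\ rho y < 0]].

(* w is the weak differential of u, in the global chart of R^m. *)
Definition weak_diff u w := forall (i : 'I_m) (phi : 'rV[R]_m -> R),
  test_function setT phi ->
  (\int[lebesgue_rV R m]_x (u x * partial i phi x)%:E =
   - \int[lebesgue_rV R m]_x (w x ord0 i * phi x)%:E)%E.

End calculus.

Section model_manifold.
Context (R : realType).

(* The derivatives at 0 are one-sided; smoothness up to 0 means that sigma
   agrees on [0, +oo[ with a smooth function tau on R. *)
Definition warping_function (sigma : R -> R) :=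
  [/\ 0 <= sigma 0, forall t, 0 < t -> 0 < sigma t &
    exists tau : R -> R,
    [/\ forall k t, derivable (derive1n k tau) t 1,
        forall t, 0 <= t -> sigma t = tau t,
        forall k, derive1n k.*2 tau 0 = 0 &
        derive1 tau 0 = 1]].

Context (m : nat) (sigma : R -> R).
Implicit Types (x : 'rV[R]_m) (D : set 'rV[R]_m) (u f phi : 'rV[R]_m -> R)
  (w : 'rV[R]_m -> 'rV[R]_m).

Definition polar_radius x : R := Num.sqrt (\sum_i x ord0 i ^+ 2).

(* Gram matrix of g = dr^2 + sigma(r)^2 g_S in Cartesian coordinates: at x <> 0,
   dr^2 has matrix P = x^T x / r^2 and r^2 g_S has matrix I - P. As sigma is odd
   with sigma'(0) = 1, the smooth extension to x = 0 is I. *)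
Definition metric x : 'M[R]_m :=
  if x == 0 then 1%:M else
  let r := polar_radius x in
  let P := (r ^+ 2)^-1 *: (x^T *m x) in
  P + (sigma r / r) ^+ 2 *: (1%:M - P).

Definition inner x (X Y : 'rV[R]_m) : R := (X *m metric x *m Y^T) ord0 ord0.

Definition riem_norm x (X : 'rV[R]_m) : R := Num.sqrt (inner x X X).

(* the vector dual to the covector xi *)
Definition sharp x (xi : 'rV[R]_m) : 'rV[R]_m := xi *m invmx (metric x).

Definition vol_density x : R := Num.sqrt (\det (metric x)).

Definition int_vol D f : \bar R :=
  (\int[lebesgue_rV R m]_(x in D) (f x * vol_density x)%:E)%E.

Definition W1p_loc (p : R) u w :=
  [/\ measurable_fun setT (u : 'rV[R]_m -> measurableTypeR R),
      measurable_fun setT w, weak_diff u w &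
      forall K, compact K ->
        (int_vol K (fun x => (`|u x| `^ p)%R) < +oo)%E /\
        (int_vol K (fun x => (riem_norm x (sharp x (w x)) `^ p)%R) < +oo)%E].

(* The pairing of div(|grad u|^(p-2) grad u) with phi over D, where w is the
   (possibly weak) differential of u. *)
Definition plap_pairing (p : R) D w phi : \bar R :=
  (- int_vol D (fun x =>
      let X := sharp x (w x) in
      (inner x (riem_norm x X `^ (p - 2) *: X) (sharp x (dfun phi x)))%R))%E.

Definition plap_ge p D w f := forall phi,
  test_function D phi -> (forall x, 0 <= phi x) ->
  (int_vol D (fun x => (f x * phi x)%R) <= plap_pairing p D w phi)%E.

Definition plap_eq p D w f := forall phi, test_function D phi ->
  plap_pairing p D w phi = int_vol D (fun x => f x * phi x).

Definition p_stochastically_complete (p : R) :=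
  exists2 lambda : R, 0 < lambda &
  forall u w, continuous u -> W1p_loc p u w ->
    (forall x, 0 <= u x) -> has_ubound (range u) ->
    plap_ge p setT w (fun x => lambda * u x `^ (p - 1)) ->
    forall x, u x = 0.

Definition exterior_solution (p lambda : R) D f :=
  [/\ C1_closure (~` closure D) (~` D) f,
      plap_eq p (~` closure D) (dfun f) (fun x => lambda * f x `^ (p - 1)),
      forall x, (closure D `\` D) x -> f x = 1 &
      forall x, ~ D x -> 0 <= f x].

Definition minimal_exterior_solution p lambda D f :=
  exterior_solution p lambda D f /\
  forall f', exterior_solution p lambda D f' -> forall x, ~ D x -> f x <= f' x.

Definition p_feller (p : R) := forall D (lambda : R) f,
  precompact_domain D -> smooth_boundary D -> 0 < lambda ->
  minimal_exterior_solution p lambda D f ->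
  forall e, 0 < e -> exists2 K, compact K &
    forall x, ~ D x -> ~ K x -> `|f x| < e.

End model_manifold.

(* Main.v *)
Require Import Defs.
From HB Require Import structures.
From mathcomp Require Import all_boot all_order all_algebra.
From mathcomp Require Import all_classical all_reals all_analysis.
From mathcomp Require Import ring lra measurable_realfun.

Import Order.TTheory GRing.Theory Num.Theory.
Import numFieldNormedType.Exports.

Local Open Scope classical_set_scope.
Local Open Scope ring_scope.

Set Implicit Arguments.
Unset Strict Implicit.
Unset Printing Implicit Defensive.

(** Write S = sigma ^ (m - 1).  The p-Laplacian of a radial function Phi has density
    (S |Phi'|^(p-2) Phi')' / S, so that barriers are found by solving ordinary
    differential equations.  Stochastic completeness forces a radial function v with
    (S |v'|^(p-2) v')' = S min(1, (r - T)_+), vanishing for r <= T, to be unbounded: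
    otherwise ((v - c)_+)^(1 + 2/(p-1)) with c close to sup v would be a bounded
    subsolution.  The bound sigma' >= - a sigma makes A ((T - r)_+)^q, with
    q = p / (p - 1 - zeta), a strict supersolution with dead core r >= T, provided that
    T is large.  Hence eps + A ((T - r)_+)^q + kap^(1/(p-1)) v is a strict supersolution
    which exceeds u near r = r0 and near infinity, so it dominates u; letting eps and kap
    tend to 0 gives u = 0 for r > T.

    For the comparison, the inequality satisfied by u is tested against the square of
    (u - Phi)_+, which is only C^1.  It is the C^1 limit of nonnegative smooth test
    functions, namely Bernstein polynomials times a smooth cutoff; the identity for Phi
    holds because the flux of Phi is C^1, by the divergence theorem. *)

(** * Row vectors and Lebesgue measure *)

(** The p-Laplacian is nonlinear, yet the barrier is a sum: the slope of [A ((T - r)_+)^q] lives on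
    r < T and that of [v] on r > T, so the two fluxes simply add. The flux is homogeneous of degree
    p - 1, whence the factor kap^(1/(p-1)). The constant eps keeps the barrier positive beyond T,
    where Lambda(eps) > kap absorbs the source of [v]. At infinity it is the unboundedness of [v]
    that lifts the barrier above the bound of u; near the inner sphere u has no boundary values, so
    the barrier is made larger than the bound of u on a whole shell r0 < r < r1. The square of (u -
    Phi)_+ has gradient 2 (u - Phi)_+ (du - dPhi), which is continuous and a nonnegative multiple of
    du - dPhi; this is all that monotonicity of the flux needs. The inequality for u is only weak,
    hence the approximation in C^1. The radial identities come from the divergence theorem in
    Cartesian coordinates, applied to Y(r) r^(-m) x, so no integration in polar coordinates occurs.
    The singularity at the pole is harmless because either the flux or the test function vanishes
    near it. *)

Section rV_norm.
Context (R : realType) (n : nat).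
Implicit Types (x : 'rV[R]_n) (e : R).

Lemma rV_coord_le x i : `|x ord0 i| <= `|x|.
Proof.
rewrite [leRHS]/Num.norm /= mx_normrE.
by apply: (le_bigmax _ (fun ij : 'I_1 * 'I_n => `|x ij.1 ij.2|) (ord0, i)).
Qed.

Lemma rV_norm_le x e : 0 <= e -> (forall i, `|x ord0 i| <= e) -> `|x| <= e.
Proof.
move=> e0 H; rewrite [leLHS]/Num.norm /= mx_normrE.
by apply/bigmax_leP; split => // -[a b] _ /=; rewrite (ord1 a).
Qed.

Lemma rV_norm_lt x e : 0 < e -> (forall i, `|x ord0 i| < e) -> `|x| < e.
Proof.
move=> e0 H; rewrite [ltLHS]/Num.norm /= mx_normrE.
by apply/bigmax_ltP; split => // -[a b] _ /=; rewrite (ord1 a).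
Qed.

Lemma closed_ball_compact (L : R) : compact [set x : 'rV[R]_n | `|x| <= L].
Proof.
apply: bounded_closed_compact.
  by exists L; split; [exact: num_real|move=> M LM x /= /le_trans; apply; exact: ltW].
rewrite (_ : [set x : 'rV[R]_n | _] = Num.norm @^-1` [set y : R | y <= L])//.
by apply: closed_comp; [move=> x _; exact: norm_continuous|exact: closed_le].
Qed.

End rV_norm.

Section borel.
Context (R : realType) (n : nat).
Implicit Types (U D K : set 'rV[R]_n).

Lemma rV_box_measurable (A : 'I_n -> set (measurableTypeR R)) :
  (forall i, measurable (A i)) ->
  measurable [set v : 'rV[R]_n | forall i, A i (v ord0 i)].
Proof.
move=> mA.
rewrite [X in measurable X](_ : _ =
  \bigcap_(i in [set: 'I_n]) ((fun v : 'rV[R]_n => v ord0 i) @^-1` A i)).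
  apply: fin_bigcap_measurable => // i _.
  by have := @measurable_coord R n i measurableT _ (mA i); rewrite setTI.
by apply/seteqP; split => v /= H i; [move=> _; exact: H|exact: (H i)].
Qed.

(** An open set is the union of the cubes with rational centre and half-side 1 / (k + 1) that it
    contains, and there are only countably many of them. *)
Lemma open_measurable_rV U : open U -> measurable U.
Proof.
move=> oU.
pose box (c : 'rV[rat]_n * nat) :=
  [set v : 'rV[R]_n | forall i,
    (`](ratr (c.1 ord0 i) - c.2.+1%:R^-1), (ratr (c.1 ord0 i) + c.2.+1%:R^-1)[%classic
       : set R) (v ord0 i)].
pose F c := if `[< box c `<=` U >] then box c else set0.
have -> : U = \bigcup_c F c.
  apply/seteqP; split => [x Ux|x [c _]]; last first.
    by rewrite /F; case: asboolP => // H bx; exact: H.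
  have /nbhs_ballP[e /= e0 xeU] : nbhs x U by exact: open_nbhs_nbhs.
  have [k ke] : exists k : nat, k.+1%:R^-1 < e / 2.
    have e20 : 0 < e / 2 by rewrite divr_gt0.
    have [k _ H] := near_infty_natSinv_lt (PosNum e20).
    by exists k; exact: (H k (leqnn k)).
  have [q Hq] : exists q : 'rV[rat]_n, forall i,
      ratr (q ord0 i) \in `](x ord0 i - k.+1%:R^-1), (x ord0 i + k.+1%:R^-1)[.
    have H i : exists q, (ratr q : R) \in
        `](x ord0 i - k.+1%:R^-1), (x ord0 i + k.+1%:R^-1)[.
      by apply: rat_in_itvoo; rewrite ltrD2l gtrN// invr_gt0.
    by have [f Hf] := choice H; exists (\row_i f i) => i; rewrite mxE.
  exists (q, k) => //; rewrite /F; case: asboolP => [_ i /=|].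
    have := Hq i; rewrite !in_itv /=.
    by move: (ratr _ : R) k.+1%:R^-1 => y z /andP[? ?]; apply/andP; split; lra.
  case=> y By; apply: xeU; rewrite mx_norm_ball /ball_ /=.
  apply: rV_norm_lt => // i; rewrite !mxE ltr_norml.
  have := By i; have := Hq i; rewrite /= !in_itv /=; move: ke.
  move: (ratr _ : R) k.+1%:R^-1 => a z ? /andP[? ?] /andP[? ?].
  by apply/andP; split; lra.
apply: (@countable_bigcupT_measurable _ _ _ F) => [|c]; first exact: countableP.
rewrite /F; case: asboolP => _ //.
apply: (rV_box_measurable (A := fun i => `](ratr (c.1 ord0 i) - c.2.+1%:R^-1),
  (ratr (c.1 ord0 i) + c.2.+1%:R^-1)[%classic)) => i.
exact: measurable_itv.
Qed.

Lemma closed_measurable_rV D : closed D -> measurable D.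
Proof.
by move=> cD; rewrite -[D]setCK; apply: measurableC; apply: open_measurable_rV;
  rewrite openC.
Qed.

Lemma compact_measurable_rV K : compact K -> measurable K.
Proof.
move=> cK; apply: closed_measurable_rV; apply: compact_closed => //.
Qed.

Lemma continuous_measurable_rV D (f : 'rV[R]_n -> R) : open D ->
  (forall x, D x -> {for x, continuous f}) ->
  measurable_fun D (f : 'rV[R]_n -> measurableTypeR R).
Proof.
move=> oD cf; apply: (measurability _ (RGenOpens.measurableE R)).
move=> _ [_ [a [b ->]] <-]; apply: open_measurable_rV.
have /(continuous_inP _ oD) : {in D, continuous f} by move=> x /set_mem/cf.
by apply; exact: interval_open.
Qed.

End borel.

Section integrable_support.
Context d (T : measurableType d) (R : realType).
Variable mu : {measure set T -> \bar R}.

Lemma bounded_support_integrable (D B : set T) (f : T -> R) (C : R) :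
  measurable D -> measurable B -> (mu B < +oo)%E -> measurable_fun D f ->
  (forall x, D x -> `|f x| <= C) -> (forall x, D x -> ~ B x -> f x = 0) ->
  mu.-integrable D (EFin \o f).
Proof.
move=> mD mB Boo mf fC f0; apply/integrableP; split.
  exact/measurable_EFinP.
apply: (@le_lt_trans _ _ (\int[mu]_(x in D) (`|C| * \1_B x)%:E)%E).
  apply: ge0_le_integral => //.
  - by apply/measurable_EFinP; apply: measurableT_comp.
  - apply/measurable_EFinP; apply: measurable_funM => //.
  - move=> x Dx; rewrite /= lee_fin indicE.
    case: (asboolP (B x)) => Bx.
      by rewrite mem_set// mulr1 (le_trans (fC _ Dx))// ler_norm.
    by rewrite memNset// mulr0 f0// normr0.
under eq_integral do rewrite EFinM.
rewrite ge0_integralZl_EFin//; last first.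
  by apply/measurable_EFinP; apply: measurable_funTS.
rewrite integral_indic// lte_mul_pinfty// ?lee_fin//.
by apply: le_lt_trans Boo; rewrite le_measure// ?inE//; exact: measurableI.
Qed.

End integrable_support.

Section lebesgue_rV_theory.
Context (R : realType) (n : nat).
Local Notation mu := (lebesgue_rV R n).

Lemma lebesgue_rV_cube (c : 'rV[R]_n) (e : R) : 0 <= e ->
  mu [set v | forall i, (`[c ord0 i - e, c ord0 i + e]%classic
    : set (measurableTypeR R)) (v ord0 i)] = ((e *+ 2) ^+ n)%:E.
Proof.
move=> e0; rewrite (lebesgue_rV_box (A := fun i => `[c ord0 i - e, c ord0 i + e]%classic)); last first.
  by move=> i; exact: measurable_itv.
have H i : lebesgue_measure (`[c ord0 i - e, c ord0 i + e]%classic : set R) = (e *+ 2)%:E.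
  rewrite lebesgue_measure_itv /= lte_fin; case: ltP => [_|H].
    by rewrite -EFinB; congr (_%:E); rewrite opprD opprK addrACA subrr add0r mulr2n.
  by congr (_%:E); lra.
rewrite (eq_bigr (fun=> (e *+ 2)%:E)) => [|i _]; last exact: H.
by rewrite prodEFin prodr_const card_ord.
Qed.

Lemma ball_measurable (L : R) : measurable [set x : 'rV[R]_n | `|x| <= L].
Proof. by apply: compact_measurable_rV; exact: closed_ball_compact. Qed.

Lemma lebesgue_rV_ball (L : R) : (mu [set x | (`|x| <= L)%R] < +oo)%E.
Proof.
apply: (@le_lt_trans _ _ (((`|L| *+ 2) ^+ n)%:E)); last exact: ltry.
rewrite -(lebesgue_rV_cube 0)//; apply: le_measure; rewrite ?inE.
- exact: ball_measurable.
- apply: (rV_box_measurable (A := fun i => `[(0 : 'rV[R]_n) ord0 i - `|L|, (0 : 'rV[R]_n) ord0 i + `|L|]%classic)) => i.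
  exact: measurable_itv.
- move=> x /= xL i; rewrite in_itv /= mxE !add0r -ler_norml.
  by rewrite (le_trans (rV_coord_le _ _))// (le_trans xL)// ler_norm.
Qed.

(** This turns an almost everywhere statement into a contradiction at the end of the comparison
    argument. *)
Lemma lebesgue_rV_open_gt0 (U : set 'rV[R]_n) : open U -> U !=set0 -> (0 < mu U)%E.
Proof.
move=> oU [x Ux].
have /nbhs_ballP[e /= e0 xeU] : nbhs x U by exact: open_nbhs_nbhs.
have e20 : 0 < e / 2 by rewrite divr_gt0.
apply: (@lt_le_trans _ _ ((((e / 2) *+ 2) ^+ n)%:E)).
  by rewrite lte_fin exprn_gt0// pmulrn_lgt0.
rewrite -(lebesgue_rV_cube x) ?(ltW e20)//; apply: le_measure; rewrite ?inE.
- apply: (rV_box_measurable (A := fun i => `[x ord0 i - e / 2, x ord0 i + e / 2]%classic)) => i.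
  exact: measurable_itv.
- exact: open_measurable_rV.
- move=> y /= By; apply: xeU; rewrite mx_norm_ball /ball_ /=.
  apply: rV_norm_lt => // i; rewrite !mxE ltr_norml.
  have := By i; rewrite in_itv /= => /andP[? ?].
  by apply/andP; split; lra.
Qed.

Lemma lebesgue_rV_sigma_finite : sigma_finite [set: 'rV[R]_n] mu.
Proof.
exists (fun k => [set x | `|x| <= k%:R]).
  apply/seteqP; split => // x _; exists (Num.truncn `|x|).+1 => //=.
  exact/ltW/truncnS_gt.
by move=> k; split; [exact: ball_measurable|exact: lebesgue_rV_ball].
Qed.

Lemma integrable_rV (D : set 'rV[R]_n) (f : 'rV[R]_n -> R) (C L : R) :
  measurable D -> measurable_fun D (f : 'rV[R]_n -> measurableTypeR R) ->
  (forall x, D x -> `|f x| <= C) -> (forall x, D x -> L < `|x| -> f x = 0) ->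
  mu.-integrable D (EFin \o f).
Proof.
move=> mD mf fC f0; apply: (@bounded_support_integrable _ _ _ _ D [set x | `|x| <= L] f C) => //.
- exact: ball_measurable.
- exact: lebesgue_rV_ball.
- by move=> x Dx /= /negP; rewrite -ltNge; exact: f0.
Qed.

End lebesgue_rV_theory.

(** An alias, convertible with [lebesgue_rV], whose head constant carries the sigma-finite structure
    required by Fubini's theorem. *)
Definition lebesgue_rV_copy (R : realType) n : set 'rV[R]_n -> \bar R :=
  lebesgue_rV R n.
HB.instance Definition _ (R : realType) n :=
  Measure.on (@lebesgue_rV_copy R n).
HB.instance Definition _ (R : realType) n := Measure_isSigmaFinite.Build _ _ _
  (@lebesgue_rV_copy R n) (@lebesgue_rV_sigma_finite R n).

Lemma near_continuous (T U : topologicalType) (f g : T -> U) x :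
  {near x, f =1 g} -> {for x, continuous f} -> {for x, continuous g}.
Proof.
move=> n c; change (g @ x --> g x); rewrite -(nbhs_singleton n).
by apply: cvg_trans c; exact: near_eq_cvg.
Qed.

(** * Gradients and the divergence theorem *)

Section directional.
Context (R : realType) (V : normedModType R).
Implicit Types (f : V -> R) (x v : V).

(** Both difference quotients are the same function of the increment. The chain rule, the mean value
    theorem and the fundamental theorem of calculus thus become available along lines. *)
Lemma is_derive_line f x v (t d : R) :
  is_derive t 1 (fun s => f (x + s *: v)) d <-> is_derive (x + t *: v) v f d.
Proof.
have E : (fun h : R => h^-1 *: (((fun s => f (x + s *: v)) \o shift t) (h *: 1) - f (x + t *: v)))
    = (fun h : R => h^-1 *: ((f \o shift (x + t *: v)) (h *: v) - f (x + t *: v))).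
  apply/funext => h /=.
  suff -> : x + (h *: 1 + t) *: v = h *: v + (x + t *: v) by [].
  by rewrite [h *: 1]mulr1 scalerDl addrCA.
split => -[D1 D2]; constructor.
- by move: D1; rewrite /derivable E.
- by move: D2; rewrite /derive E.
- by move: D1; rewrite /derivable E.
- by move: D2; rewrite /derive E.
Qed.

Lemma is_derive_comp_dir (h : R -> R) f x v (dh df : R) :
  is_derive (f x) 1 h dh -> is_derive x v f df ->
  is_derive x v (h \o f) (dh * df).
Proof.
move=> Hh Hf; rewrite -[x]addr0 -(scale0r v); apply/is_derive_line.
apply: (is_derive1_comp (f := h) (g := fun s : R => f (x + s *: v))).
  by rewrite scale0r addr0.
by apply/is_derive_line; rewrite scale0r addr0.
Qed.

Lemma is_derive_unique f x v (a b : R) :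
  is_derive x v f a -> is_derive x v f b -> a = b.
Proof. by move=> [_ <-] [_ <-]. Qed.

End directional.

Section integral_derivative.
Context (R : realType).

Lemma integral_derive0 (g dg : R -> R) (L : R) :
  (forall t : R, is_derive t 1 g (dg t)) -> continuous dg ->
  (forall t : R, L <= `|t| -> g t = 0) ->
  (\int[@lebesgue_measure R]_t (dg t)%:E)%E = 0%E.
Proof.
move=> Dg cdg g0.
have dg0 t : L < `|t| -> dg t = 0.
  move=> Lt; apply: is_derive_unique (Dg t) _.
  have := is_derive_cst (0 : R) t (1 : R); apply: near_eq_is_derive.
  have : \forall s \near t, L < `|s|.
    have := @norm_continuous R R t; move/cvgr_gt; exact.
  by apply: filterS => s Ls; rewrite g0// ltW.
pose M : R := `|L| + 1.
have LM : L < M by rewrite (le_lt_trans (ler_norm _))// ltrDl.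
have M0 : 0 < M by rewrite ltr_wpDl.
have -> : (\int[@lebesgue_measure R]_t (dg t)%:E)%E =
    (\int[@lebesgue_measure R]_(t in `[(- M)%R, M]) (dg t)%:E)%E.
  rewrite [RHS]integral_mkcond; apply: eq_integral => t _; rewrite patchE.
  case: ifPn => //; rewrite notin_setE /= in_itv /= -ler_norml => /negP.
  by rewrite -ltNge => /(lt_trans LM)/dg0 ->.
rewrite (@continuous_FTC2 _ _ g); first last.
- by move=> t _; rewrite derive1E (@derive_val _ _ _ _ _ _ _ (Dg t)).
- have cg t : g x @[x --> t] --> g t.
    by apply: differentiable_continuous; apply/derivable1_diffP; case: (Dg t).
  split; first by move=> t _; case: (Dg t).
    exact: cvg_at_right_filter.
  exact: cvg_at_left_filter.
- exact: continuous_subspaceT.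
- lra.
by rewrite !g0 ?subee// ?normrN (le_trans (ltW LM)) ?ler_norm.
Qed.

End integral_derivative.

Section gradient.
Context (R : realType) (m : nat).
Implicit Types (D E : set 'rV[R]_m) (f : 'rV[R]_m -> R).
Local Notation e_ i := (delta_mx ord0 i : 'rV[R]_m).

(** The class C^1 with the partial derivatives named explicitly. Continuity and derivatives are
    taken in the whole space at each point of D, so that functions given by cases can be treated on
    each piece ([has_grad_eq]) and then glued ([has_gradU]). *)
Definition has_grad D f (g : 'I_m -> 'rV[R]_m -> R) := forall x, D x ->
  {for x, continuous f} /\
  forall i, is_derive x (e_ i) f (g i x) /\ {for x, continuous (g i)}.

Lemma has_grad_sub D E f g : E `<=` D -> has_grad D f g -> has_grad E f g.
Proof. by move=> ED H x /ED/H. Qed.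

Lemma has_gradU D E f g : has_grad D f g -> has_grad E f g ->
  has_grad (D `|` E) f g.
Proof. by move=> H1 H2 x [/H1|/H2]. Qed.

Lemma has_grad_eq D f1 f2 g1 g2 : open D -> (forall x, D x -> f1 x = f2 x) ->
  (forall x i, D x -> g1 i x = g2 i x) -> has_grad D f1 g1 -> has_grad D f2 g2.
Proof.
move=> oD Hf Hg H x Dx; have [c H'] := H x Dx.
have nD : \forall y \near x, D y by exact: open_nbhs_nbhs.
have nf : {near x, f1 =1 f2} by apply: filterS nD => y; exact: Hf.
split; first exact: near_continuous c.
move=> i; have [d cg] := H' i; split.
  by rewrite -Hg//; apply: near_eq_is_derive d.
by apply: near_continuous cg; apply: filterS nD => y; exact: Hg.
Qed.

Lemma has_grad_partial D f g x i : has_grad D f g -> D x -> partial i f x = g i x.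
Proof.
by move=> H Dx; have [_ /(_ i)[d _]] := H x Dx; rewrite /partial derive_val.
Qed.

Lemma Cn_has_grad D f : Cn 1 D f -> has_grad D f (fun i => partial i f).
Proof.
move=> [cf H] x Dx; split; first exact: cf.
by move=> i; have [d [c _]] := H i; split; [apply/derivableP; exact: d|exact: c].
Qed.

Lemma has_grad_cst D (c : R) : has_grad D (fun=> c) (fun _ _ => 0).
Proof.
move=> x _; split; first exact: cst_continuous.
by move=> i; split; [exact: is_derive_cst|exact: cst_continuous].
Qed.

Lemma has_grad_coord D i : has_grad D (fun x => x ord0 i) (fun j _ => (i == j)%:R).
Proof.
move=> x _; split; first exact: coord_continuous.
move=> j; split; last exact: cst_continuous.
rewrite -[x]addr0 -(scale0r (e_ j)); apply/is_derive_line.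
have -> : (fun s : R => (x + s *: e_ j) ord0 i) =
    cst (x ord0 i) + (i == j)%:R \*: (@id R).
  by apply/funext => s; rewrite !mxE eqxx /= mulrC.
have := is_deriveD (is_derive_cst (x ord0 i) (0 : R) 1)
  (is_deriveZ (i == j)%:R (is_derive_id (0 : R) 1)).
by rewrite add0r [_ *: 1]mulr1.
Qed.

Lemma has_gradD D f1 f2 g1 g2 : has_grad D f1 g1 -> has_grad D f2 g2 ->
  has_grad D (fun x => f1 x + f2 x) (fun i x => g1 i x + g2 i x).
Proof.
move=> H1 H2 x Dx; have [c1 {}H1] := H1 x Dx; have [c2 {}H2] := H2 x Dx.
split; first exact: continuousD.
move=> i; have [? ?] := H1 i; have [? ?] := H2 i.
by split; [exact: is_deriveD|exact: continuousD].
Qed.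

Lemma has_gradM D f1 f2 g1 g2 : has_grad D f1 g1 -> has_grad D f2 g2 ->
  has_grad D (fun x => f1 x * f2 x) (fun i x => g1 i x * f2 x + f1 x * g2 i x).
Proof.
move=> H1 H2 x Dx; have [c1 {}H1] := H1 x Dx; have [c2 {}H2] := H2 x Dx.
split; first exact: continuousM.
move=> i; have [? ?] := H1 i; have [? ?] := H2 i; split.
  apply: (is_derive_eq (f := f1 * f2)).
  by rewrite addrC /GRing.scale/= [f2 x * _]mulrC.
by apply: continuousD; exact: continuousM.
Qed.

Lemma has_grad_comp D f g (h dh : R -> R) : has_grad D f g ->
  (forall x, D x -> is_derive (f x) 1 h (dh (f x)) /\ {for f x, continuous dh}) ->
  has_grad D (fun x => h (f x)) (fun i x => dh (f x) * g i x).
Proof.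
move=> H Hh x Dx; have [c {}H] := H x Dx; have [d cd] := Hh x Dx.
have ch : {for f x, continuous h}.
  by apply: differentiable_continuous; apply/derivable1_diffP; case: d.
split; first exact: continuous_comp c ch.
move=> i; have [? ?] := H i; split.
  exact: is_derive_comp_dir.
by apply: continuousM => //; exact: continuous_comp c cd.
Qed.

End gradient.
Lemma eq_continuous (T U : topologicalType) (f g : T -> U) x :
  f =1 g -> {for x, continuous f} -> {for x, continuous g}.
Proof. by move=> /funext ->. Qed.

Section divergence.
Context (R : realType).

Lemma continuous_rV (T : topologicalType) n (h : T -> 'rV[R]_n) x :
  (forall i, {for x, continuous (fun t => h t ord0 i)}) -> {for x, continuous h}.
Proof.
move=> H; change (h @ x --> h x); apply/cvgrPdist_lt => e e0.
have N : \forall t \near x, forall i, `|h x ord0 i - h t ord0 i| < e.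
  by apply: filter_forall => i; have /cvgrPdist_lt/(_ e e0) := H i.
by apply: filterS N => t Ht; apply: rV_norm_lt => // i; rewrite !mxE.
Qed.

Lemma continuous_cons_rVl n (t : R) :
  continuous (fun v : 'rV[R]_n => cons_rV (v, t : measurableTypeR R)).
Proof.
move=> v; apply: continuous_rV => k; case: (unliftP ord0 k) => [k' ->|->].
  have : {for v, continuous (fun w : 'rV[R]_n => w ord0 k')} by exact: coord_continuous.
  by apply: eq_continuous => w; rewrite cons_rVS.
have : {for v, continuous (cst t : 'rV[R]_n -> R)} by exact: cst_continuous.
by apply: eq_continuous => w; rewrite cons_rV0.
Qed.

Lemma continuous_cons_rVr n (v : 'rV[R]_n) :
  continuous (fun t : R => cons_rV (v, t : measurableTypeR R)).
Proof.
move=> t; apply: continuous_rV => k; case: (unliftP ord0 k) => [k' ->|->].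
  have : {for t, continuous (cst (v ord0 k') : R -> R)} by exact: cst_continuous.
  by apply: eq_continuous => w; rewrite cons_rVS.
have : {for t, continuous (@id R)} by exact: cvg_id.
by apply: eq_continuous => w; rewrite cons_rV0.
Qed.

Lemma continuous_bounded_compact (T : topologicalType) (K : set T) (f : T -> R) :
  compact K -> {within K, continuous f} -> exists C : R, forall x, K x -> `|f x| <= C.
Proof.
move=> cK cf; have /compact_bounded[M [_ HM]] := continuous_compact cf cK.
by exists (M + 1) => x Kx; apply: (HM (M + 1)); [rewrite ltrDl|exists x].
Qed.

(** The conclusion needs L < |x| because only there does f vanish on a whole neighbourhood. *)
Lemma is_derive_far0 n (f g : 'rV[R]_n -> R) v (L : R) :
  (forall x, is_derive x v f (g x)) -> (forall x, L <= `|x| -> f x = 0) ->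
  forall x, L < `|x| -> g x = 0.
Proof.
move=> Df f0 x Lx; apply: is_derive_unique (Df x) _.
have := is_derive_cst (0 : R) x v; apply: near_eq_is_derive.
have : \forall s \near x, L < `|s|.
  have := @norm_continuous R _ x; move/cvgr_gt; exact.
by apply: filterS => s Ls; rewrite f0// ltW.
Qed.

Lemma continuous_support_bounded n (g : 'rV[R]_n -> R) (L : R) :
  continuous g -> (forall x, L < `|x| -> g x = 0) ->
  exists2 C : R, 0 <= C & forall x, `|g x| <= C.
Proof.
move=> cg g0.
have [C HC] := continuous_bounded_compact (@closed_ball_compact R n L)
  (continuous_subspaceT cg).
exists `|C| => // x; case: (leP `|x| L) => [xL|/g0 ->]; last by rewrite normr0.
by rewrite (le_trans (HC _ xL))// ler_norm.
Qed.

(** Induction on the dimension by Fubini. The order of integration is chosen so that the inner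
    integral contains the direction i: the remaining coordinates first if i is not the first
    coordinate (induction hypothesis), the first coordinate first otherwise ([integral_derive0]). *)
Lemma integral_partial0 n (i : 'I_n) (f g : 'rV[R]_n -> R) (L : R) :
  (forall x, is_derive x (delta_mx ord0 i) f (g x)) -> continuous g ->
  (forall x, L <= `|x| -> f x = 0) ->
  (\int[lebesgue_rV R n]_x (g x)%:E)%E = 0%E.
Proof.
elim: n i f g => [[]//|n IH] i f g Df cg f0.
have g0 := is_derive_far0 Df f0.
have [C C0 HC] := continuous_support_bounded cg g0.
have mg : measurable_fun setT (g : 'rV[R]_n.+1 -> measurableTypeR R).
  by apply: continuous_measurable_rV => [|x _]; [exact: openT|exact: cg].
pose m1 : {sigma_finite_measure set 'rV[R]_n -> \bar R} := @lebesgue_rV_copy R n.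
pose gc (p : 'rV[R]_n * measurableTypeR R) := (g (cons_rV p))%:E.
have consN (v : 'rV[R]_n) (t : R) : `|v| <= `|cons_rV (v, t : measurableTypeR R)|.
  apply: rV_norm_le => // j.
  by have := rV_coord_le (cons_rV (v, t : measurableTypeR R)) (lift ord0 j); rewrite cons_rVS.
have consN0 (v : 'rV[R]_n) (t : R) : `|t| <= `|cons_rV (v, t : measurableTypeR R)|.
  by have := rV_coord_le (cons_rV (v, t : measurableTypeR R)) ord0; rewrite cons_rV0.
have mgc : measurable_fun setT (gc : _ -> \bar R).
  by apply/measurable_EFinP; apply: (measurableT_comp mg); exact: measurable_cons_rV.
have intg : (m1 \x @lebesgue_measure R)%E.-integrable setT gc.
  pose B := [set v : 'rV[R]_n | `|v| <= L] `*` (`[- L, L]%classic : set (measurableTypeR R)).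
  have mB1 : measurable [set v : 'rV[R]_n | `|v| <= L] by exact: ball_measurable.
  apply: (@bounded_support_integrable _ _ _ _ setT B (fun p => g (cons_rV p)) C) => //.
  - exact: measurableX.
  - rewrite [X in (X < _)%E](_ : _ = (m1 \x @lebesgue_measure R)%E B)// /B product_measure1E//; apply: lte_mul_pinfty => //.
      by rewrite ge0_fin_numE//; exact: lebesgue_rV_ball.
    by apply: (@compact_finite_measure R `[- L, L]%classic); exact: segment_compact.
  - exact/measurable_EFinP.
  - move=> [v t] _ /= nB; apply: g0; rewrite ltNge; apply/negP => H.
    apply: nB; split => /=; first exact: le_trans (consN _ _) H.
    by rewrite in_itv /= -ler_norml; exact: le_trans (consN0 _ _) H.
have -> : (\int[lebesgue_rV R n.+1]_x (g x)%:E)%E =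
    (\int[m1 \x @lebesgue_measure R]_p gc p)%E.
  have -> : (\int[lebesgue_rV R n.+1]_x (g x)%:E)%E =
    (\int[pushforward (m1 \x @lebesgue_measure R)%E (@cons_rV R n)]_x (g x)%:E)%E by [].
  rewrite (integral_pushforward (@measurable_cons_rV R n))//.
  exact/measurable_EFinP.
case: (unliftP ord0 i) Df => [j ->|->] Df.
  rewrite -integral21_prod_meas1//= /fubini_G.
  apply: integral0_eq => t _ /=.
  apply: (IH j (fun v => f (cons_rV (v, t))) (fun v => g (cons_rV (v, t)))).
  - move=> v; rewrite -[v]addr0 -(scale0r (delta_mx ord0 j)); apply/is_derive_line.
    have E s : cons_rV (v + s *: delta_mx ord0 j, t) =
        cons_rV (v, t) + s *: delta_mx ord0 (lift ord0 j).
      apply/rowP => k; case: (unliftP ord0 k) => [k' ->|->].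
        rewrite cons_rVS [LHS]mxE [RHS]mxE cons_rVS /=; congr (_ + _).
        by rewrite !mxE (inj_eq (@lift_inj _ ord0)).
      rewrite cons_rV0 [RHS]mxE cons_rV0 /= -[LHS]addr0; congr (_ + _).
      by rewrite !mxE mulr0.
    under eq_fun do rewrite E.
    by rewrite E; apply/is_derive_line.
  - move=> v; apply: (@continuous_comp _ _ _ (fun v => cons_rV (v, t)) g); [exact: continuous_cons_rVl|exact: cg].
  - by move=> v Lv; apply: f0; exact: le_trans Lv (consN _ _).
rewrite -integral12_prod_meas1//= /fubini_F.
apply: integral0_eq => v _ /=.
apply: (integral_derive0 (g := fun t => f (cons_rV (v, t))) (dg := fun t => g (cons_rV (v, t))) (L := L)).
- move=> t.
  have E (s : R) : cons_rV (v, s : measurableTypeR R) =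
      cons_rV (v, 0 : measurableTypeR R) + s *: delta_mx ord0 ord0.
    apply/rowP => k; case: (unliftP ord0 k) => [k' ->|->].
      rewrite cons_rVS [RHS]mxE cons_rVS /= -[LHS]addr0; congr (_ + _).
      by rewrite !mxE mulr0.
    rewrite cons_rV0 [RHS]mxE cons_rV0 /= -[LHS]add0r; congr (_ + _).
    by rewrite !mxE mulr1.
  have := (is_derive_line f (cons_rV (v, 0 : measurableTypeR R)) (delta_mx ord0 ord0) t _).2 (Df _).
  rewrite -E; congr is_derive.
  by apply/funext => s; rewrite -E.
- move=> t; apply: (@continuous_comp _ _ _ (fun t => cons_rV (v, t)) g); [exact: continuous_cons_rVr|exact: cg].
- by move=> t Lt; apply: f0; exact: le_trans Lt (consN0 _ _).
Qed.

End divergence.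

(** * Smooth test functions *)

Section derive_squeeze.
Context (R : realType).

(** Meant for the junction point 0 of [flat] and [pospow], where no formula holds on both sides. *)
Lemma is_derive_squeeze (f : R -> R) (x d : R) (w : R -> R) :
  (forall h, `|f (x + h) - f x - d * h| <= `|h| * w h) ->
  w h @[h --> 0] --> 0 -> is_derive x 1 f d.
Proof.
move=> H w0.
have Q : h^-1 *: (f (h *: 1 + x) - f x) @[h --> 0^'] --> d.
  apply/cvgrPdist_le => e e0.
  have /cvgrPdist_le/(_ e e0)N0 := w0.
  have N : \forall h \near 0^', `|0 - w h| <= e by exact: cvg_within N0.
  near=> h.
  have h0 : h != 0 by near: h; exact: nbhs_dnbhs_neq.
  have : `|0 - w h| <= e by near: h; exact: N.
  rewrite sub0r normrN => wh.
  rewrite [h *: 1]mulr1 [_ *: _]mulrC addrC [h + x]addrC.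
  have := H h; set k := f _ - f x => Hk.
  have -> : - (k / h) + d = - ((k - d * h) / h) by field.
  rewrite normrN normrM normfV ler_pdivrMr ?normr_gt0//.
  apply: (le_trans Hk); rewrite mulrC ler_wpM2r//.
  exact: le_trans (ler_norm _) wh.
have Q' : h^-1 *: ((f \o shift x) (h *: 1) - f x) @[h --> 0^'] --> d by exact: Q.
constructor; first by apply/cvg_ex; exists d.
exact/cvg_lim.
Unshelve. all: by end_near. Qed.

End derive_squeeze.

Lemma is_derive_rw (R : realType) (V : normedModType R) (f : V -> R) x v (a b : R) :
  is_derive x v f a -> a = b -> is_derive x v f b.
Proof. by move=> ? <-. Qed.

Section flat.
Context (R : realType).

Lemma is_derive_exprn k (t : R) :
  is_derive t 1 (fun s : R => s ^+ k) (k%:R * t ^+ k.-1).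
Proof.
have -> : (fun s : R => s ^+ k) = id ^+ k by apply/funext => s; rewrite exprfctE.
by have := is_deriveX k (is_derive_id t (1 : R)); rewrite [_ *: _]mulr1.
Qed.

(** The classical function exp(-1/t), with the powers t^(-k) built in so that the family is closed
    under differentiation. *)
Definition flat (k : nat) (t : R) : R :=
  if 0 < t then t ^- k * expR (- t^-1) else 0.

Lemma flat_gt0 k t : 0 < t -> 0 < flat k t.
Proof. by move=> t0; rewrite /flat t0 mulr_gt0 ?expR_gt0// invr_gt0 exprn_gt0. Qed.

Lemma flat_ge0 k t : 0 <= flat k t.
Proof. by case: (ltP 0 t) => [/flat_gt0/ltW//|t0]; rewrite /flat ltNge t0. Qed.

Lemma flat_le0 k t : t <= 0 -> flat k t = 0.
Proof. by move=> t0; rewrite /flat ltNge t0. Qed.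

(** With N = k + 2, exp(1/t) = exp(1/(N t))^N >= (1/(N t))^N, hence t^(-k) exp(-1/t) <= N^N t^(N -
    k). A quadratic bound is what makes the derivative at 0 vanish. *)
Lemma flat_quadratic k t : flat k t <= k.+2%:R ^+ k.+2 * t ^+ 2.
Proof.
case: (ltP 0 t) => t0; last by rewrite flat_le0// mulr_ge0 ?sqr_ge0// exprn_ge0.
rewrite /flat t0 mulrC ler_pdivrMr ?exprn_gt0// -mulrA -exprD addnC addn2.
rewrite -exprMn expRN -[X in _ <= X]invrK lef_pV2 ?posrE ?expR_gt0//; last first.
  by rewrite invr_gt0 exprn_gt0// mulr_gt0.
have -> : expR t^-1 = expR ((k.+2%:R * t)^-1) ^+ k.+2.
  by rewrite -expRM_natl; congr expR; rewrite invfM mulrA mulfV ?mul1r// pnatr_eq0.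
rewrite -exprVn lerXn2r ?nnegrE ?expR_ge0 ?invr_ge0 ?mulr_ge0 ?(ltW t0)//.
by rewrite (le_trans _ (expR_ge1Dx _))// lerDr.
Qed.

Lemma is_derive_flat k (t : R) :
  is_derive t 1 (flat k) (- k%:R * flat k.+1 t + flat k.+2 t).
Proof.
case: (ltgtP 0 t) => [t0|t0|<-].
- rewrite /flat t0.
  have D1 : is_derive t 1 (fun s : R => s ^- k) (- k%:R * t ^- k.+1).
    have tk : t ^+ k != 0 by rewrite expf_neq0// gt_eqF.
    apply: (is_derive_rw (is_deriveV (f := fun s : R => s ^+ k) tk (is_derive_exprn k t))).
    rewrite /GRing.scale /=.
    case: k tk => [|k] tk; first by rewrite mul0r mulr0 oppr0 mul0r.
    rewrite /= [t ^+ k.+2]exprS [t ^+ k.+1]exprS; field.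
    by rewrite ?expf_neq0 ?andbT ?gt_eqF.
  have D2 : is_derive t 1 (fun s : R => expR (- s^-1)) (expR (- t^-1) * t ^- 2).
    have tn : id t != 0 :> R by rewrite gt_eqF.
    have Di : is_derive t 1 (fun s : R => - s^-1) (t ^- 2).
      apply: (is_derive_rw (is_deriveN (is_deriveV (f := id) tn (is_derive_id t (1 : R))))).
      by rewrite /GRing.scale /= mulr1 opprK.
    exact: (is_derive1_comp (f := expR) (is_derive_expR _) Di).
  have := is_deriveM D1 D2; move=> D.
  have : is_derive t 1 (fun s : R => s ^- k * expR (- s^-1))
      (- k%:R * (t ^- k.+1 * expR (- t^-1)) + t ^- k.+2 * expR (- t^-1)).
    apply: (is_derive_rw D); rewrite /GRing.scale /= !exprS expr0; field.
    by rewrite ?expf_neq0 ?andbT ?gt_eqF.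
  apply: near_eq_is_derive.
  near=> s; have -> // : 0 < s.
  by near: s; exact: lt_nbhsr.
- rewrite !flat_le0 ?(ltW t0)// mulr0 addr0.
  have := is_derive_cst (0 : R) t (1 : R); apply: near_eq_is_derive.
  near=> s; rewrite flat_le0//; apply: ltW; near: s; exact: lt_nbhsl.
- rewrite !flat_le0// mulr0 addr0.
  apply: (is_derive_squeeze (w := fun h => k.+2%:R ^+ k.+2 * `|h|)).
    move=> h; rewrite add0r (flat_le0 k (lexx 0)) subr0 mul0r subr0.
    rewrite ger0_norm ?flat_ge0// (le_trans (flat_quadratic k h))//.
    by rewrite [leRHS]mulrCA -expr2 real_normK// num_real.
  rewrite -[X in _ --> X](mulr0 (k.+2%:R ^+ k.+2)) -{2}(normr0 R).
  apply: cvgMr; apply: cvg_norm; exact: cvg_id.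
Unshelve. all: by end_near. Qed.

Lemma continuous_flat k : continuous (flat k).
Proof.
move=> t; apply: differentiable_continuous; apply/derivable1_diffP.
by case: (is_derive_flat k t).
Qed.

End flat.

Section smooth_expressions.
Context (R : realType) (m : nat).
Local Notation e_ i := (delta_mx ord0 i : 'rV[R]_m).

(* The set of these expressions is closed under formal partial derivatives, which makes
   all iterated partial derivatives available at once. *)
Inductive sexpr :=
  | SCst of R
  | SVar of 'I_m
  | SAdd of sexpr & sexpr
  | SMul of sexpr & sexpr
  | SFlat of nat & sexpr.

Fixpoint seval (e : sexpr) (x : 'rV[R]_m) : R :=
  match e with
  | SCst c => c
  | SVar i => x ord0 i
  | SAdd a b => seval a x + seval b x
  | SMul a b => seval a x * seval b x
  | SFlat k a => flat k (seval a x)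
  end.

Fixpoint sder (i : 'I_m) (e : sexpr) : sexpr :=
  match e with
  | SCst c => SCst 0
  | SVar j => SCst (j == i)%:R
  | SAdd a b => SAdd (sder i a) (sder i b)
  | SMul a b => SAdd (SMul (sder i a) b) (SMul a (sder i b))
  | SFlat k a => SMul (SAdd (SMul (SCst (- k%:R)) (SFlat k.+1 a)) (SFlat k.+2 a)) (sder i a)
  end.

Lemma seval_has_grad e : has_grad setT (seval e) (fun i => seval (sder i e)).
Proof.
elim: e => [c|i|a IHa b IHb|a IHa b IHb|k a IHa] /=.
- exact: has_grad_cst.
- exact: has_grad_coord.
- exact: has_gradD.
- exact: has_gradM.
- apply: (has_grad_comp (dh := fun s => - k%:R * flat k.+1 s + flat k.+2 s)) => //.
  move=> x _; split; first exact: is_derive_flat.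
  apply: continuousD; last exact: continuous_flat.
  apply: continuousM; first exact: cst_continuous.
  exact: continuous_flat.
Qed.

Lemma seval_partial e i : partial i (seval e) = seval (sder i e).
Proof. by apply/funext => x; apply: (has_grad_partial i (@seval_has_grad e)). Qed.

Lemma seval_smooth e : smooth_on setT (seval e).
Proof.
move=> k; elim: k e => [|k IH] e; split => //.
- by move=> x _; case: (@seval_has_grad e x I).
- by move=> x _; case: (@seval_has_grad e x I).
- move=> i; split; first by move=> x _; case: (@seval_has_grad e x I) => _ /(_ i)[[]].
  by rewrite seval_partial.
Qed.

Definition smooth_expr (f : 'rV[R]_m -> R) := exists e, f = seval e.

Lemma smooth_expr_cst c : smooth_expr (fun=> c).
Proof. by exists (SCst c). Qed.

Lemma smooth_expr_coord i : smooth_expr (fun x => x ord0 i).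
Proof. by exists (SVar i). Qed.

Lemma smooth_exprD f g : smooth_expr f -> smooth_expr g ->
  smooth_expr (fun x => f x + g x).
Proof. by move=> [a ->] [b ->]; exists (SAdd a b). Qed.

Lemma smooth_exprM f g : smooth_expr f -> smooth_expr g ->
  smooth_expr (fun x => f x * g x).
Proof. by move=> [a ->] [b ->]; exists (SMul a b). Qed.

Lemma smooth_expr_flat k f : smooth_expr f -> smooth_expr (fun x => flat k (f x)).
Proof. by move=> [a ->]; exists (SFlat k a). Qed.

Lemma smooth_expr_exp f k : smooth_expr f -> smooth_expr (fun x => f x ^+ k).
Proof.
move=> sf; elim: k => [|k IH].
  under eq_fun do rewrite expr0.
  exact: smooth_expr_cst.
under eq_fun do rewrite exprS.
exact: smooth_exprM.
Qed.

Lemma smooth_expr_sum I (r : seq I) (F : I -> 'rV[R]_m -> R) :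
  (forall i, smooth_expr (F i)) -> smooth_expr (fun x => \sum_(i <- r) F i x).
Proof.
move=> sF; elim: r => [|i r IH].
  under eq_fun do rewrite big_nil.
  exact: smooth_expr_cst.
under eq_fun do rewrite big_cons.
exact: smooth_exprD.
Qed.

Lemma smooth_expr_prod I (r : seq I) (F : I -> 'rV[R]_m -> R) :
  (forall i, smooth_expr (F i)) -> smooth_expr (fun x => \prod_(i <- r) F i x).
Proof.
move=> sF; elim: r => [|i r IH].
  under eq_fun do rewrite big_nil.
  exact: smooth_expr_cst.
under eq_fun do rewrite big_cons.
exact: smooth_exprM.
Qed.

Lemma smooth_expr_has_grad f : smooth_expr f ->
  has_grad setT f (fun i => partial i f).
Proof. by move=> [e ->] x _; case: (@seval_has_grad e x I) => c H; split => // i;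
  rewrite seval_partial. Qed.

Definition sqnorm (x : 'rV[R]_m) : R := \sum_i x ord0 i ^+ 2.

Lemma smooth_expr_sqnorm : smooth_expr sqnorm.
Proof.
apply: smooth_expr_sum => i; apply: smooth_expr_exp; exact: smooth_expr_coord.
Qed.

Lemma continuous_sqnorm : continuous sqnorm.
Proof. by move=> x; case: (smooth_expr_has_grad smooth_expr_sqnorm (I : setT x)). Qed.

Lemma has_grad_sqnorm D : has_grad D sqnorm (fun i x => 2 * x ord0 i).
Proof.
apply: (has_grad_sub (D := setT)) => //.
have [e He] := smooth_expr_sqnorm.
suff E i : partial i sqnorm = (fun x => 2 * x ord0 i).
  move=> x Dx; have [c H] := smooth_expr_has_grad smooth_expr_sqnorm Dx.
  by split => // i; have := H i; rewrite E.
apply/funext => x.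
have D1 j : has_grad setT (fun x : 'rV[R]_m => x ord0 j ^+ 2)
    (fun i x => (j == i)%:R * x ord0 j + x ord0 j * (j == i)%:R).
  under eq_fun do rewrite expr2.
  by apply: has_gradM; exact: has_grad_coord.
have DS (s : seq 'I_m) : has_grad setT (fun x : 'rV[R]_m => \sum_(j <- s) x ord0 j ^+ 2)
    (fun i x => \sum_(j <- s) ((j == i)%:R * x ord0 j + x ord0 j * (j == i)%:R)).
  elim: s => [|j s IH].
    by apply: (has_grad_eq openT _ _ (has_grad_cst (m := m) (D := setT) (0 : R))) => *;
      rewrite big_nil.
  by apply: (has_grad_eq openT _ _ (has_gradD (D1 j) IH)) => *; rewrite big_cons.
rewrite (has_grad_partial i (DS _) (I : setT x)) (bigD1 i)//= eqxx big1 => [|j ji].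
  by rewrite addr0 mul1r mulr1 mulr_natl mulr2n.
by rewrite (negbTE ji) mul0r mulr0 addr0.
Qed.

Lemma sqnorm_ge0 x : 0 <= sqnorm x.
Proof. by apply: sumr_ge0 => i _; exact: sqr_ge0. Qed.

Lemma norm_sqnorm x : `|x| ^+ 2 <= sqnorm x.
Proof.
case: (eqVneq `|x| 0) => [->|x0]; first by rewrite expr0n sqnorm_ge0.
have [[a i] /= E] := mx_norm_neq0 x0.
rewrite [`|x|]E (ord1 a) real_normK ?num_real// /sqnorm (bigD1 i)//= lerDl.
by apply: sumr_ge0 => j _; exact: sqr_ge0.
Qed.

Lemma smooth_test_function (D : set 'rV[R]_m) f (a b : R) : smooth_expr f ->
  (forall x, f x != 0 -> a <= sqnorm x <= b) -> (forall x, a <= sqnorm x <= b -> D x) ->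
  test_function D f.
Proof.
move=> [e ->] supp sD.
have cl : closed [set x | a <= sqnorm x <= b].
  rewrite (_ : [set x | _] = sqnorm @^-1` [set y | a <= y <= b])//.
  apply: closed_comp; first by move=> x _; exact: continuous_sqnorm.
  rewrite (_ : [set y | _] = `[a, b]%classic); first exact: interval_closed.
  by apply/seteqP; split => y /=; rewrite in_itv.
have sub : closure [set x | seval e x != 0] `<=` [set x | a <= sqnorm x <= b].
  by rewrite [X in _ `<=` X](closure_id _).1//; apply: closureS => x; exact: supp.
split; first exact: seval_smooth; last by move=> x /sub; exact: sD.
apply: (@subclosed_compact _ _ [set x | `|x| <= Num.sqrt `|b|]).
- exact: closed_closure.
- exact: closed_ball_compact.
- move=> x /sub /= /andP[_ xb].
  rewrite -[leLHS]ger0_norm// -sqrtr_sqr ler_sqrt// (le_trans (norm_sqnorm x))//.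
  by rewrite (le_trans xb)// ler_norm.
Qed.

End smooth_expressions.

(** * Approximation by Bernstein polynomials *)

Section bernstein1.
Context (R : realType).
Implicit Types (t : R) (n k r : nat).

Definition bern n k t : R := 'C(n, k)%:R * (t ^+ k * (1 - t) ^+ (n - k)).

Definition dbern n k t : R := 'C(n, k)%:R *
  (k%:R * t ^+ k.-1 * (1 - t) ^+ (n - k)
   - t ^+ k * ((n - k)%:R * (1 - t) ^+ (n - k).-1)).

(** The r-th central moment of the binomial distribution with parameters n and t. *)
Definition bmom n r t : R := \sum_(k < n.+1) bern n k t * (k%:R - n%:R * t) ^+ r.

Lemma is_derive_bern n k t : is_derive t 1 (bern n k) (dbern n k t).
Proof.
have D1 : is_derive t 1 (fun s : R => 1 - s) (-1).
  apply: (is_derive_rw (is_deriveB (is_derive_cst (1 : R) t 1) (is_derive_id t (1 : R)))).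
  by rewrite sub0r.
have D2 : is_derive t 1 (fun s : R => (1 - s) ^+ (n - k))
    ((n - k)%:R * (1 - t) ^+ (n - k).-1 * -1).
  exact: (is_derive1_comp (f := fun s : R => s ^+ (n - k)) (is_derive_exprn _ _) D1).
have D3 := is_deriveM (is_derive_exprn k t) D2.
have D4 := is_deriveM (is_derive_cst ('C(n, k)%:R : R) t (1 : R)) D3.
apply: (is_derive_rw D4); rewrite /GRing.scale /= mulr0 addr0 /dbern.
by congr (_ * _); ring.
Qed.

(** The logarithmic derivative of [bern n k], multiplied by t (1 - t) to stay polynomial. It
    converts differentiation into multiplication by k - n t, that is, into a shift of moments. *)
Lemma bern_ode n k t : (k <= n)%N ->
  t * (1 - t) * dbern n k t = (k%:R - n%:R * t) * bern n k t.
Proof.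
move=> kn; rewrite /dbern /bern.
have E1 : k%:R * t ^+ k.-1 * t = k%:R * t ^+ k :> R.
  by case: k {kn} => [|k]; rewrite ?mul0r// exprSr mulrA.
have E2 : (n - k)%:R * (1 - t) ^+ (n - k).-1 * (1 - t) = (n - k)%:R * (1 - t) ^+ (n - k) :> R.
  by case: (n - k)%N => [|j]; rewrite ?mul0r// [in RHS]exprSr mulrA.
transitivity ('C(n, k)%:R * ((k%:R * t ^+ k.-1 * t) * (1 - t) ^+ (n - k) * (1 - t)
   - t ^+ k * t * ((n - k)%:R * (1 - t) ^+ (n - k).-1 * (1 - t)))); first by ring.
by rewrite E1 E2 natrB//; ring.
Qed.

Lemma bmom0 n t : bmom n 0 t = 1.
Proof.
transitivity (((1 - t) + t) ^+ n); last by rewrite subrK expr1n.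
rewrite exprDn; apply: eq_bigr => k _.
by rewrite expr0 mulr1 /bern mulr_natl [t ^+ k * _]mulrC.
Qed.

(** Differentiate the sum that defines the r-th moment and multiply by t (1 - t): the derivative of
    the kernel yields the moment r + 1 by [bern_ode], that of (k - n t)^r yields - r n times the
    moment r - 1. Here P is a closed form of the r-th moment. *)
Lemma bmomS n r t (P : R -> R) (dP : R) : (forall s, bmom n r s = P s) ->
  is_derive t 1 P dP ->
  bmom n r.+1 t = t * (1 - t) * (dP + r%:R * n%:R * bmom n r.-1 t).
Proof.
move=> HP DP.
pose c k (s : R) := k%:R - n%:R * s.
have Dc k : is_derive t 1 (c k) (- n%:R).
  apply: (is_derive_rw (is_deriveB (is_derive_cst (k%:R : R) t 1)
    (is_deriveZ n%:R (is_derive_id t (1 : R))))).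
  by rewrite sub0r [_ *: 1]mulr1.
have D (k : 'I_n.+1) : is_derive t 1 (fun s : R => bern n k s * c k s ^+ r)
    (bern n k t * (r%:R * c k t ^+ r.-1 * - n%:R) + c k t ^+ r * dbern n k t).
  apply: is_deriveM; first exact: is_derive_bern.
  exact: (is_derive1_comp (f := fun s : R => s ^+ r) (is_derive_exprn _ _) (Dc k)).
have DS := is_derive_sum D.
have E : (\sum_(k < n.+1) (fun s : R => bern n k s * c k s ^+ r)) = P.
  by apply/funext => s; rewrite -HP fct_sumE.
rewrite E in DS; rewrite (is_derive_unique DP DS).
have -> : r%:R * n%:R * bmom n r.-1 t =
  \sum_(k < n.+1) r%:R * n%:R * (bern n k t * c k t ^+ r.-1) by rewrite mulr_sumr.
rewrite -big_split /= mulr_sumr; apply: eq_bigr => k _.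
transitivity (c k t ^+ r * (t * (1 - t) * dbern n k t)); last by ring.
rewrite bern_ode; last by rewrite -ltnS.
by rewrite exprS -/(c k t); ring.
Qed.

Lemma bmom1 n t : bmom n 1 t = 0.
Proof.
have H := @bmomS n 0 t (cst 1) 0 (bmom0 n) (is_derive_cst _ _ _).
by rewrite H mul0r mul0r addr0 mulr0.
Qed.

Lemma bmom2 n t : bmom n 2 t = n%:R * (t * (1 - t)).
Proof.
have H := @bmomS n 1 t (cst 0) 0 (bmom1 n) (is_derive_cst _ _ _).
by rewrite H bmom0; ring.
Qed.

Lemma bmom3 n t : bmom n 3 t = t * (1 - t) * (n%:R * (1 - 2 * t)).
Proof.
pose p : {poly R} := n%:R%:P * ('X * (1 - 'X)).
rewrite (@bmomS n 2 t (horner p) (p^`()).[t]).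
- by rewrite bmom1 mulr0 addr0 /p !poly.derivE !hornerE /=; ring.
- by move=> s; rewrite bmom2 /p !hornerE.
Qed.

Lemma bmom4 n t : bmom n 4 t =
  t * (1 - t) * (n%:R * (1 - 6 * t + 6 * t ^+ 2) + 3 * n%:R ^+ 2 * (t * (1 - t))).
Proof.
pose p : {poly R} := 'X * (1 - 'X) * (n%:R%:P * (1 - 2%:P * 'X)).
rewrite (@bmomS n 3 t (horner p) (p^`()).[t]).
- by rewrite bmom2 /p !poly.derivE !hornerE /=; ring.
- by move=> s; rewrite bmom3 /p !hornerE.
Qed.

Lemma bern_ge0 n k t : 0 <= t <= 1 -> 0 <= bern n k t.
Proof.
by move=> /andP[t0 t1]; rewrite !mulr_ge0// exprn_ge0// subr_ge0.
Qed.

Lemma bmom2_le n t : 0 <= t <= 1 -> bmom n 2 t <= n%:R.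
Proof.
move=> /andP[t0 t1]; rewrite bmom2 -[leRHS]mulr1 ler_wpM2l//; nra.
Qed.

Lemma bmom4_le n t : (0 < n)%N -> 0 <= t <= 1 -> bmom n 4 t <= 4 * n%:R ^+ 2.
Proof.
move=> n0 /andP[t0 t1]; rewrite bmom4.
have n1 : 1 <= n%:R :> R by rewrite ler1n.
set q := t * (1 - t).
have q0 : 0 <= q by rewrite mulr_ge0// subr_ge0.
have q1 : q <= 1 / 4 by rewrite /q; have := sqr_ge0 (t - 1/2); nra.
have -> : 1 - 6 * t + 6 * t ^+ 2 = 1 - 6 * q by rewrite /q; ring.
have : n%:R <= n%:R ^+ 2 :> R by rewrite expr2 ler_peMl.
move: (n%:R) n1 => N n1; set N2 := N ^+ 2 => NN.
have N20 : 0 <= N2 by exact: sqr_ge0.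
have qN : q * N <= N by nra.
have qqN : 0 <= N * (q * q) by rewrite !mulr_ge0//; lra.
have qq : q * q <= 1 by nra.
have qqN2 : N2 * (q * q) <= N2 by nra.
nra.
Qed.

End bernstein1.

Section bernstein.
Context (R : realType) (m n : nat) (L : R).
Hypotheses (n0 : (0 < n)%N) (L0 : 0 < L).
Implicit Types (k : {ffun 'I_m -> 'I_n.+1}) (x : 'rV[R]_m) (psi : 'rV[R]_m -> R).

(** Affine coordinates of the cube [-L, L]^m. In probabilistic terms, [bernstein psi x] is the
    expectation of [psi] at a random grid point [bnode k] whose coordinates are independent,
    binomial up to scaling, and have mean x. *)
Definition bcoord x i : R := (x ord0 i + L) / (2 * L).

Definition bnode k : 'rV[R]_m := \row_i (2 * L / n%:R * (k i)%:R - L).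

Definition bker k x : R := \prod_i bern n (k i) (bcoord x i).

Definition bernstein psi x : R := \sum_k psi (bnode k) * bker k x.

Let n0R : n%:R != 0 :> R. Proof. by rewrite pnatr_eq0 -lt0n. Qed.
Let L0R : L != 0. Proof. by rewrite gt_eqF. Qed.

Lemma bnodeB k x i : (bnode k - x) ord0 i =
  2 * L / n%:R * ((k i)%:R - n%:R * bcoord x i).
Proof. by rewrite !mxE /bcoord; field; rewrite ?L0R ?n0R. Qed.

(** Independence of the coordinates: the expectation of a product is the product of the
    expectations, by distributivity. *)
Lemma bker_distr x (F : 'I_m -> nat -> R) :
  \sum_k bker k x * \prod_i F i (k i) =
  \prod_i \sum_(a < n.+1) bern n a (bcoord x i) * F i a.
Proof. by rewrite bigA_distr_bigA; apply: eq_bigr => k _; rewrite -big_split. Qed.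

Lemma sum_bern t : \sum_(a < n.+1) bern n a t = 1 :> R.
Proof. by rewrite -(bmom0 n t); apply: eq_bigr => a _; rewrite expr0 mulr1. Qed.

Lemma sum_bker x : \sum_k bker k x = 1.
Proof.
transitivity (\sum_k bker k x * \prod_(i < m) (fun _ _ => 1) i (k i)).
  by apply: eq_bigr => k _; rewrite big1 ?mulr1.
rewrite (bker_distr x (fun _ _ => 1)) big1// => i _.
by rewrite -[RHS](sum_bern (bcoord x i)); apply: eq_bigr => a _; rewrite mulr1.
Qed.

Lemma bker_moment x j r :
  \sum_k bker k x * (bnode k - x) ord0 j ^+ r =
  (2 * L / n%:R) ^+ r * bmom n r (bcoord x j).
Proof.
pose F i (a : nat) := if i == j then (2 * L / n%:R * (a%:R - n%:R * bcoord x j)) ^+ r else 1.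
transitivity (\sum_k bker k x * \prod_i F i (k i)).
  apply: eq_bigr => k _; congr (_ * _).
  rewrite (bigD1 j)//= /F eqxx big1 ?mulr1 ?bnodeB// => i /negbTE ->//.
rewrite bker_distr (bigD1 j)//= [X in _ * X]big1 => [|i /negbTE ij]; last first.
  by rewrite /F ij; under eq_bigr do rewrite mulr1; exact: sum_bern.
rewrite mulr1 /F eqxx mulr_sumr; apply: eq_bigr => a _.
by rewrite exprMn; ring.
Qed.

Lemma bker_moment_cross x i j : i != j ->
  \sum_k bker k x * ((bnode k - x) ord0 i * (bnode k - x) ord0 j) = 0.
Proof.
move=> ij.
pose G l (a : nat) := 2 * L / n%:R * (a%:R - n%:R * bcoord x l).
pose F l (a : nat) := if l == i then G i a else if l == j then G j a else 1.
transitivity (\sum_k bker k x * \prod_l F l (k l)).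
  apply: eq_bigr => k _; congr (_ * _).
  rewrite (bigD1 i)//= (bigD1 j)/= 1?eq_sym// /F !eqxx [j == i]eq_sym (negbTE ij) big1.
    by rewrite mulr1 !bnodeB.
  by move=> l /andP[/negbTE -> /negbTE ->].
rewrite bker_distr (bigD1 i)//=.
rewrite [X in X * _](_ : _ = 0) ?mul0r// /F eqxx.
transitivity (2 * L / n%:R * bmom n 1 (bcoord x i)); last by rewrite bmom1 mulr0.
by rewrite mulr_sumr; apply: eq_bigr => a _; rewrite expr1 /G; ring.
Qed.

Lemma bcoord_line x j s i : bcoord (x + s *: delta_mx ord0 j) i =
  bcoord x i + (i == j)%:R * (s / (2 * L)).
Proof. by rewrite /bcoord !mxE eqxx /=; field; rewrite ?L0R. Qed.

(* The logarithmic derivative of bker k with respect to x_j is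
   bgamma x j * (bnode k - x)_j. *)
Definition bgamma x j : R := n%:R / (4 * L ^+ 2 * (bcoord x j * (1 - bcoord x j))).

Lemma is_derive_bker k x j : 0 < bcoord x j < 1 ->
  is_derive x (delta_mx ord0 j) (bker k)
    (bgamma x j * (bker k x * (bnode k - x) ord0 j)).
Proof.
move=> /andP[y0 y1].
suff : is_derive (x + 0 *: delta_mx ord0 j) (delta_mx ord0 j) (bker k)
    (bgamma x j * (bker k x * (bnode k - x) ord0 j)) by rewrite scale0r addr0.
apply/is_derive_line.
pose C := \prod_(i | i != j) bern n (k i) (bcoord x i).
have E s : bker k (x + s *: delta_mx ord0 j) =
    bern n (k j) (bcoord x j + s / (2 * L)) * C.
  rewrite /bker (bigD1 j)//= bcoord_line eqxx mul1r; congr (_ * _).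
  by apply: eq_bigr => i /negbTE ij; rewrite bcoord_line ij mul0r addr0.
rewrite (_ : (fun s => _) = (fun s => C * bern n (k j) (bcoord x j + s / (2 * L)))); last first.
  by apply/funext => s; rewrite E mulrC.
have D1 : is_derive (0 : R) 1 (fun s : R => bcoord x j + s / (2 * L)) (2 * L)^-1.
  have -> : (fun s : R => bcoord x j + s / (2 * L)) = cst (bcoord x j) + (2 * L)^-1 \*: @id R.
    by apply/funext => s; rewrite mulrC.
  apply: (is_derive_rw (is_deriveD (is_derive_cst (bcoord x j) (0 : R) 1)
    (is_deriveZ (2 * L)^-1 (is_derive_id (0 : R) 1)))).
  by rewrite add0r [_ *: 1]mulr1.
have D2 := is_derive1_comp (f := bern n (k j)) (is_derive_bern n (k j) _) D1.
apply: (is_derive_rw (is_deriveZ C D2)).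
rewrite mul0r addr0 bnodeB [_ *: _]mulrC.
have -> : bker k x = bern n (k j) (bcoord x j) * C by rewrite /bker (bigD1 j).
have yy : bcoord x j * (1 - bcoord x j) != 0 by rewrite gt_eqF// mulr_gt0// subr_gt0.
have ode := @bern_ode R n (k j) (bcoord x j) (leq_ord (k j)).
have -> : dbern n (k j) (bcoord x j) = ((k j)%:R - n%:R * bcoord x j)
    * bern n (k j) (bcoord x j) / (bcoord x j * (1 - bcoord x j)).
  by rewrite -ode mulrAC mulfV// mul1r.
rewrite /bgamma; move: yy; set q := bcoord x j * _ => yy; field.
by rewrite yy L0R n0R.
Qed.

Lemma smooth_expr_bernstein psi : smooth_expr (bernstein psi).
Proof.
have sc i : smooth_expr (fun x : 'rV[R]_m => bcoord x i).
  by apply: smooth_exprM; [apply: smooth_exprD; [exact: smooth_expr_coord|exact: smooth_expr_cst]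
    |exact: smooth_expr_cst].
apply: smooth_expr_sum => k; apply: smooth_exprM; first exact: smooth_expr_cst.
apply: smooth_expr_prod => i; apply: smooth_exprM; first exact: smooth_expr_cst.
apply: smooth_exprM; first exact: smooth_expr_exp.
apply: (smooth_expr_exp (f := fun x => 1 - bcoord x i)).
have -> : (fun x : 'rV[R]_m => 1 - bcoord x i) = (fun x => 1 + (-1) * bcoord x i).
  by apply/funext => x; rewrite mulN1r.
apply: smooth_exprD; first exact: smooth_expr_cst.
by apply: smooth_exprM => //; exact: smooth_expr_cst.
Qed.

Lemma partial_bernstein psi x j : 0 < bcoord x j < 1 ->
  partial j (bernstein psi) x =
  bgamma x j * \sum_k bker k x * (psi (bnode k) * (bnode k - x) ord0 j).
Proof.
move=> y01.
have D : is_derive x (delta_mx ord0 j) (bernstein psi)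
  (\sum_k psi (bnode k) * (bgamma x j * (bker k x * (bnode k - x) ord0 j))).
  rewrite /bernstein -(big_enum _ _ _ (fun k => psi (bnode k) * (bgamma x j * (bker k x * (bnode k - x) ord0 j)))).
  have -> : (fun x => \sum_k psi (bnode k) * bker k x) =
    (fun x => \sum_(k <- enum {ffun 'I_m -> 'I_n.+1}) psi (bnode k) * bker k x).
    by apply/funext => z; rewrite big_enum.
  elim: (enum _) => [|k s IH].
    rewrite big_nil (_ : (fun x0 => _) = cst 0); first exact: is_derive_cst.
    by apply/funext => z; rewrite big_nil.
  rewrite big_cons (_ : (fun x0 => _) = (fun z => psi (bnode k) * bker k z)
    + (fun z => \sum_(k <- s) psi (bnode k) * bker k z)).
    apply: is_deriveD IH.
    exact: (is_deriveZ (psi (bnode k)) (is_derive_bker k y01)).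
  by apply/funext => z; rewrite big_cons.
rewrite /partial (derive_val (df := _)) mulr_sumr; apply: eq_bigr => k _; ring.
Qed.

Lemma bgamma_moment x j : 0 < bcoord x j < 1 ->
  bgamma x j * \sum_k bker k x * (bnode k - x) ord0 j ^+ 2 = 1.
Proof.
move=> /andP[y0 y1]; rewrite bker_moment bmom2 /bgamma.
have : bcoord x j * (1 - bcoord x j) != 0 by rewrite gt_eqF// mulr_gt0// subr_gt0.
by set q := bcoord x j * _ => yy; field; rewrite yy L0R n0R.
Qed.

(** The error of the derivative is a weighted mean of first-order Taylor remainders of [psi]. Indeed
    the constant [psi x] contributes a first moment, which is zero, and the linear part contributes
    exactly g j, because the coordinates are uncorrelated and [bgamma] is the inverse of the
    variance. *)
Lemma partial_bernsteinB psi (g : 'I_m -> R) x j : 0 < bcoord x j < 1 ->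
  partial j (bernstein psi) x - g j = bgamma x j * \sum_k bker k x *
   ((psi (bnode k) - psi x - \sum_i g i * (bnode k - x) ord0 i) * (bnode k - x) ord0 j).
Proof.
move=> y01; rewrite partial_bernstein//.
pose d k i := (bnode k - x) ord0 i.
have E1 : \sum_k bker k x * (psi x * d k j) = 0.
  transitivity (psi x * \sum_k bker k x * d k j ^+ 1).
    by rewrite mulr_sumr; apply: eq_bigr => k _; ring.
  by rewrite bker_moment bmom1 !mulr0.
have E2 : bgamma x j * \sum_k bker k x * ((\sum_i g i * d k i) * d k j) = g j.
  transitivity (bgamma x j * \sum_i g i * \sum_k bker k x * (d k i * d k j)).
    congr (_ * _); under [RHS]eq_bigr do rewrite mulr_sumr.
    rewrite exchange_big /=; apply: eq_bigr => k _.
    by rewrite mulr_suml mulr_sumr; apply: eq_bigr => i _; ring.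
  rewrite (bigD1 j)//= [X in _ + X]big1 => [|i ij]; last first.
    by rewrite bker_moment_cross// mulr0.
  rewrite addr0 mulrCA; under eq_bigr do rewrite -expr2.
  by rewrite bgamma_moment// mulr1.
pose S1 := \sum_k bker k x * (psi (bnode k) * d k j).
pose S2 := \sum_k bker k x * ((\sum_i g i * d k i) * d k j).
pose S3 := \sum_k bker k x * (psi x * d k j).
transitivity (bgamma x j * (S1 - S3 - S2)).
  by rewrite /S3 E1 subr0 mulrBr E2.
by congr (_ * _); rewrite /S1 /S2 /S3 -!sumrB; apply: eq_bigr => k _; rewrite -/(d k j); ring.
Qed.

End bernstein.

Section approximation.
Context (R : realType) (m : nat).
Implicit Types (psi : 'rV[R]_m -> R) (x d : 'rV[R]_m).

Lemma unif_continuous_support (g : 'rV[R]_m -> R) (M e : R) : continuous g ->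
  (forall x, M < `|x| -> g x = 0) -> 0 < e ->
  exists2 r : R, 0 < r & forall x y, `|x - y| < r -> `|g x - g y| < e.
Proof.
move=> cg g0 e0.
(* The margin 1, with r < 1 below, ensures that if x is outside this ball then both x and y lie
   where g vanishes. *)
pose K := [set x : 'rV[R]_m | `|x| <= M + 1].
have /compact_near_coveringP : compact K by exact: closed_ball_compact.
move=> /(_ R 0^'+ (fun r x => forall y, `|x - y| < r -> `|g x - g y| < e) _).
have H x : K x -> \forall x' \near x & r \near 0^'+,
    forall y, `|x' - y| < r -> `|g x' - g y| < e.
  move=> _.
  have e20 : 0 < e / 2 by rewrite divr_gt0.
  have /cvgrPdist_lt/(_ _ e20)/nbhs_ballP[s /= s0 Hs] := cg x.
  have s20 : 0 < s / 2 by rewrite divr_gt0.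
  exists (ball x (s / 2), [set r | r < s / 2]).
    split; first exact: nbhsx_ballx.
    by apply: nbhs_right_lt.
  move=> [x' r] [/= xx' rs] y x'y; move: xx'; rewrite mx_norm_ball /ball_ /= => xx'.
  have Hx' : `|g x - g x'| < e / 2.
    by apply: Hs; rewrite mx_norm_ball /ball_ /=; lra.
  have Hy : `|g x - g y| < e / 2.
    apply: Hs; rewrite mx_norm_ball /ball_ /=.
    by have := ler_distD x' x y; lra.
  have := ler_distD (g x) (g x') (g y); rewrite [`|g x' - g x|]distrC.
  lra.
move=> /(_ H) N.
have : \forall r \near 0^'+, [/\ 0 < r, r < 1 & K `<=` (fun x => forall y, `|x - y| < r -> `|g x - g y| < e)].
  near=> r; split; near: r; [exact: nbhs_right_gt|exact: nbhs_right_lt|exact: N].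
move=> /filter_ex[r [r0 r1 Kr]]; exists r => // x y xy.
case: (leP `|x| (M + 1)) => [/Kr|xM]; first exact.
rewrite !g0 ?subrr ?normr0//; last lra.
have := ler_distD y x 0; rewrite !subr0; lra.
Unshelve. all: by end_near. Qed.

Lemma increment_gradient psi (g : 'I_m -> 'rV[R]_m -> R) x d :
  has_grad setT psi g -> exists z : 'I_m -> 'rV[R]_m,
    (forall i, `|z i - x| <= `|d|) /\
    psi (x + d) - psi x = \sum_i g i (z i) * d ord0 i.
Proof.
move=> Hg.
(* A path from x to x + d that changes one coordinate at a time; the mean value theorem on each leg
   gives its own intermediate point z i. *)
pose w (k : nat) : 'rV[R]_m := x + \row_j (if (j < k)%N then d ord0 j else 0).
have w0 : w 0%N = x by rewrite /w; apply/rowP => j; rewrite !mxE addr0.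
have wm : w m = x + d by rewrite /w; apply/rowP => j; rewrite !mxE ltn_ord.
have wS (i : 'I_m) : w i.+1 = w i + d ord0 i *: delta_mx ord0 i.
  apply/rowP => j; rewrite !mxE eqxx /= ltnS leq_eqVlt -val_eqE /=.
  case: (ltngtP j i) => [ji|ji|/ord_inj ->] /=; rewrite ?mulr0 ?addr0//.
  by rewrite mulr1.
have step (i : 'I_m) : exists z, `|z - x| <= `|d| /\
    psi (w i.+1) - psi (w i) = g i z * d ord0 i.
  pose f (t : R) := psi (w i + (t * d ord0 i) *: delta_mx ord0 i).
  have Df (t : R) : is_derive t 1 f (g i (w i + (t * d ord0 i) *: delta_mx ord0 i) * d ord0 i).
    have D1 : is_derive t 1 (fun t : R => t * d ord0 i) (d ord0 i).
      rewrite (_ : (fun t : R => _) = d ord0 i \*: @id R); last by apply/funext => s; rewrite mulrC.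
      by apply: (is_derive_rw (is_deriveZ (d ord0 i) (is_derive_id t (1 : R)))); rewrite [_ *: _]mulr1.
    have D2 : is_derive (t * d ord0 i) 1 (fun s : R => psi (w i + s *: delta_mx ord0 i))
       (g i (w i + (t * d ord0 i) *: delta_mx ord0 i)).
      by apply/is_derive_line; exact: ((Hg _ I).2 i).1.
    exact: (is_derive1_comp (f := fun s : R => psi (w i + s *: delta_mx ord0 i))
      (g := fun t : R => t * d ord0 i) D2 D1).
  have cf : {within `[0, 1], continuous f}.
    apply: continuous_subspaceT => t.
    by apply: differentiable_continuous; apply/derivable1_diffP; case: (Df t).
  have [t t01 Et] := MVT_segment ler01 (fun t _ => Df t) cf.
  exists (w i + (t * d ord0 i) *: delta_mx ord0 i); split; last first.
    have -> : psi (w i.+1) = f 1 by rewrite /f mul1r wS.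
    have -> : psi (w i) = f 0 by rewrite /f mul0r scale0r addr0.
    by rewrite Et subr0 mulr1.
  apply: rV_norm_le => // j; rewrite !mxE eqxx /=.
  case: (ltngtP j i) => [ji|ji|/ord_inj ji].
  - rewrite -val_eqE (ltn_eqF ji) mulr0 addr0 addrAC subrr add0r; exact: rV_coord_le.
  - by rewrite -val_eqE (gtn_eqF ji) mulr0 !addr0 subrr normr0.
  - rewrite ji eqxx mulr1 addr0 addrAC subrr add0r normrM.
    move: t01; rewrite in_itv /= => /andP[t0 t1].
    by rewrite ger0_norm// (le_trans _ (rV_coord_le d i))// ler_piMl.
have [z Hz] := choice step.
exists z; split; first by move=> i; case: (Hz i).
rewrite -wm -w0 -(telescope_sumr (fun k => psi (w k)) (leq0n m)) big_mkord.
by apply: eq_bigr => i _; case: (Hz i).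
Qed.

(** If |d| is below a modulus of continuity rm of the gradient, the remainder is at most e |d|;
    otherwise |d| <= |d|^3 / rm^2 turns the trivial linear bound into a cubic one. After
    multiplication by |d| the two terms meet the second and fourth moments of the Bernstein
    kernel. *)
Lemma taylor_remainder psi (g : 'I_m -> 'rV[R]_m -> R) (M e : R) :
  has_grad setT psi g -> (forall x, M < `|x| -> psi x = 0) -> 0 < e ->
  exists2 C : R, 0 <= C & forall x d,
    `|psi (x + d) - psi x| <= C * `|d| /\
    `|psi (x + d) - psi x - \sum_i g i x * d ord0 i| <= e * `|d| + C * `|d| ^+ 3.
Proof.
move=> Hg psi0 e0.
have cg i : continuous (g i) by move=> x; case: (Hg x I) => _ /(_ i)[].
have Dg i x : is_derive x (delta_mx ord0 i) psi (g i x) by case: (Hg x I) => _ /(_ i)[].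
have g0 i x : M + 1 < `|x| -> g i x = 0.
  apply: (is_derive_far0 (Dg i)) => y My; apply: psi0; lra.
have e'0 : 0 < e / m.+1%:R by rewrite divr_gt0.
have [r Hr] := choice (fun i => let: ex_intro2 r r0 H :=
  unif_continuous_support (cg i) (g0 i) e'0 in ex_intro (fun r => 0 < r /\ forall x y, `|x - y| < r -> `|g i x - g i y| < e / m.+1%:R) r (conj r0 H)).
have [G HG] := choice (fun i => let: ex_intro2 C C0 H :=
  continuous_support_bounded (cg i) (g0 i) in ex_intro (fun C => 0 <= C /\ forall x, `|g i x| <= C) C (conj C0 H)).
pose Gs := \sum_i G i.
have Gs0 : 0 <= Gs by apply: sumr_ge0 => i _; case: (HG i).
pose rm := \big[Num.min/1]_i r i.
have rm0 : 0 < rm by apply: lt_bigmin => // i _; case: (Hr i).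
have rmr i : rm <= r i by exact: bigmin_le_cond.
pose C := Num.max Gs (2 * Gs / rm ^+ 2).
exists C => [|x d]; first by rewrite le_max Gs0.
have [z [zx E]] := increment_gradient x d Hg.
have first_ : `|psi (x + d) - psi x| <= Gs * `|d|.
  rewrite E mulr_suml; apply: (le_trans (ler_norm_sum _ _ _)); apply: ler_sum => i _.
  by rewrite normrM ler_pM//; [case: (HG i)|exact: rV_coord_le].
split; first by apply: (le_trans first_); rewrite ler_wpM2r// le_max lexx.
have -> : psi (x + d) - psi x - \sum_i g i x * d ord0 i =
    \sum_i (g i (z i) - g i x) * d ord0 i.
  by rewrite E -sumrB; apply: eq_bigr => i _; rewrite mulrBl.
apply: (le_trans (ler_norm_sum _ _ _)).
case: (ltP `|d| rm) => drm.
  apply: (@le_trans _ _ (e * `|d|)); last by rewrite lerDl mulr_ge0 ?exprn_ge0// le_max Gs0.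
  apply: (@le_trans _ _ (\sum_(i < m) e / m.+1%:R * `|d|)).
    apply: ler_sum => i _; rewrite normrM ler_pM//; last exact: rV_coord_le.
    apply: ltW; case: (Hr i) => _; apply.
    by apply: le_lt_trans (zx i) _; exact: lt_le_trans drm (rmr i).
  rewrite sumr_const card_ord -[leLHS]mulr_natl mulrA ler_wpM2r//.
  by rewrite mulrCA ler_piMr ?(ltW e0)// ler_pdivrMr// mul1r ler_nat.
apply: (@le_trans _ _ (2 * Gs * `|d|)).
  rewrite mulr_sumr mulr_suml; apply: ler_sum => i _; rewrite normrM ler_pM//; last exact: rV_coord_le.
  apply: (le_trans (ler_normB _ _)); case: (HG i) => _ H; have := H (z i); have := H x; lra.
apply: (@le_trans _ _ (C * `|d| ^+ 3)); last by rewrite lerDr mulr_ge0// ltW.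
apply: (@le_trans _ _ (2 * Gs / rm ^+ 2 * `|d| ^+ 3)); last first.
  by rewrite ler_wpM2r ?exprn_ge0// le_max lexx orbT.
have -> : 2 * Gs / rm ^+ 2 * `|d| ^+ 3 = (2 * Gs * `|d|) * (`|d| ^+ 2 / rm ^+ 2) by ring.
rewrite ler_peMr ?mulr_ge0// ler_pdivlMr ?exprn_gt0// mul1r lerXn2r ?nnegrE//.
exact: ltW.
Qed.

End approximation.

(** * Convergence of Bernstein polynomials in C^1 *)

Section density.
Context (R : realType) (m : nat).
Implicit Types (psi : 'rV[R]_m -> R) (x d : 'rV[R]_m).

Lemma rV_norm_exp_le x r : (0 < r)%N -> ~~ odd r -> `|x| ^+ r <= \sum_i x ord0 i ^+ r.
Proof.
move=> r0 er.
have ge0 (y : R) : 0 <= y ^+ r by rewrite exprn_even_ge0.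
case: (eqVneq `|x| 0) => [->|x0].
  by rewrite expr0n eqn0Ngt r0 sumr_ge0.
have [[a i] /= E] := mx_norm_neq0 x0.
rewrite [`|x|]E (ord1 a) -normrX ger0_norm ?ge0// (bigD1 i)//= lerDl.
by apply: sumr_ge0 => j _; exact: ge0.
Qed.

(** The restriction |x| <= L / 2 keeps [bcoord] in [1/4, 3/4], so that [bgamma] is at most 2 n /
    L^2. The second moment is O(1/n) and the fourth O(1/n^2): in the derivative, the factor n is
    compensated by the small coefficient in front of the former and by the extra 1/n in the
    latter. *)
Lemma bernstein_approx psi (g : 'I_m -> 'rV[R]_m -> R) (M L e : R) : 0 < L ->
  has_grad setT psi g -> (forall x, M < `|x| -> psi x = 0) -> (forall x, 0 <= psi x) ->
  0 < e -> exists2 phi, smooth_expr phi & forall x, `|x| <= L / 2 ->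
    [/\ 0 <= phi x, `|phi x - psi x| <= e & forall i, `|partial i phi x - g i x| <= e].
Proof.
move=> L0 Hg psi0 psi_ge0 e0.
have e10 : 0 < e / (16 * m.+1%:R) by rewrite divr_gt0// mulr_gt0.
have [C C0 HC] := taylor_remainder Hg psi0 e10.
(* The first absolute moment is replaced by the second through |d| <= eta + |d|^2 / eta; this eta
   makes C eta at most e / 2. *)
pose eta := e / (2 * (C + 1)).
have eta0 : 0 < eta by rewrite divr_gt0// mulr_gt0// ltr_wpDl.
(* The first summand serves the error of the value, the second that of the derivative; each brings
   the part of the error that decays with n below e / 2. *)
pose A := 8 * C * m%:R * L ^+ 2 / (eta * e) + 256 * C * m%:R * L ^+ 2 / e.
pose n := (Num.truncn A).+1.
have n0 : (0 < n)%N by [].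
have nA : A <= n%:R by apply: ltW; exact: truncnS_gt.
have L20 : 0 <= L ^+ 2 by exact: sqr_ge0.
have c8 : 0 <= 8 * C * m%:R * L ^+ 2 / (eta * e).
  by apply: divr_ge0; [do 3 apply: mulr_ge0 => //|apply: mulr_ge0; exact: ltW].
have c256 : 0 <= 256 * C * m%:R * L ^+ 2 / e 
  by apply: divr_ge0; [do 3 apply: mulr_ge0 => //|exact: ltW].
have A1 : 8 * C * m%:R * L ^+ 2 / (eta * e) <= n%:R by apply: le_trans nA; rewrite lerDl.
have A2 : 256 * C * m%:R * L ^+ 2 / e <= n%:R by apply: le_trans nA; rewrite lerDr.
exists (bernstein n L psi); first exact: smooth_expr_bernstein.
move=> x xL.
have nR0 : 0 < n%:R :> R by rewrite ltr0n.
have y14 i : 1 / 4 <= bcoord L x i <= 3 / 4.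
  have := le_trans (rV_coord_le x i) xL; rewrite ler_norml => /andP[? ?].
  rewrite /bcoord; apply/andP; split.
    by rewrite ler_pdivlMr ?mulr_gt0//; lra.
  by rewrite ler_pdivrMr ?mulr_gt0//; lra.
have y01 i : 0 <= bcoord L x i <= 1 by have /andP[? ?] := y14 i; apply/andP; split; lra.
have y01' i : 0 < bcoord L x i < 1 by have /andP[? ?] := y14 i; apply/andP; split; lra.
have ker0 (k : {ffun 'I_m -> 'I_n.+1}) : 0 <= bker L k x.
  by apply: prodr_ge0 => i _; exact: bern_ge0.
pose d (k : {ffun 'I_m -> 'I_n.+1}) : 'rV[R]_m := bnode L k - x.
have Ed k : bnode L k = x + d k by rewrite /d addrC subrK.
have m2 : \sum_k bker L k x * `|d k| ^+ 2 <= 4 * m%:R * L ^+ 2 / n%:R.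
  apply: (@le_trans _ _ (\sum_k \sum_i bker L k x * d k ord0 i ^+ 2)).
    by apply: ler_sum => k _; rewrite -mulr_sumr ler_wpM2l// rV_norm_exp_le.
  rewrite exchange_big /=.
  apply: (@le_trans _ _ (\sum_(i < m) 4 * L ^+ 2 / n%:R)).
    apply: ler_sum => i _; rewrite bker_moment//.
    have -> : 4 * L ^+ 2 / n%:R = (2 * L / n%:R) ^+ 2 * n%:R by field; rewrite gt_eqF.
    by rewrite ler_wpM2l ?sqr_ge0// bmom2_le.
  by rewrite sumr_const card_ord -[leLHS]mulr_natl !mulrA [m%:R * 4]mulrC.
have m4 : \sum_k bker L k x * `|d k| ^+ 4 <= 64 * m%:R * L ^+ 4 / n%:R ^+ 2.
  apply: (@le_trans _ _ (\sum_k \sum_i bker L k x * d k ord0 i ^+ 4)).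
    by apply: ler_sum => k _; rewrite -mulr_sumr ler_wpM2l// rV_norm_exp_le.
  rewrite exchange_big /=.
  apply: (@le_trans _ _ (\sum_(i < m) 64 * L ^+ 4 / n%:R ^+ 2)).
    apply: ler_sum => i _; rewrite bker_moment//.
    have -> : 64 * L ^+ 4 / n%:R ^+ 2 = (2 * L / n%:R) ^+ 4 * (4 * n%:R ^+ 2).
      by field; rewrite gt_eqF.
    by rewrite ler_wpM2l ?exprn_even_ge0// bmom4_le.
  by rewrite sumr_const card_ord -[leLHS]mulr_natl !mulrA [m%:R * 64]mulrC.
split.
- by apply: sumr_ge0 => k _; rewrite mulr_ge0.
- have -> : bernstein n L psi x - psi x = \sum_k bker L k x * (psi (x + d k) - psi x).
    under [RHS]eq_bigr do rewrite mulrBr.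
    rewrite sumrB -[\sum_k bker L k x * psi x]mulr_suml sum_bker// mul1r; congr (_ - _).
    by apply: eq_bigr => k _; rewrite mulrC Ed.
  apply: (le_trans (ler_norm_sum _ _ _)).
  apply: (@le_trans _ _ (\sum_k bker L k x * (C * (eta + `|d k| ^+ 2 / eta)))).
    apply: ler_sum => k _; rewrite normrM ger0_norm// ler_wpM2l//.
    apply: (le_trans (HC x (d k)).1); rewrite ler_wpM2l//.
    case: (leP `|d k| eta) => de; first by rewrite ler_wpDr// divr_ge0 ?sqr_ge0// ltW.
    rewrite ler_wpDl ?(ltW eta0)// ler_pdivlMr// expr2 ler_wpM2l// ltW//.
  have -> : \sum_k bker L k x * (C * (eta + `|d k| ^+ 2 / eta)) =
     C * eta + C / eta * \sum_k bker L k x * `|d k| ^+ 2.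
    rewrite mulr_sumr -[C * eta]mul1r -(sum_bker n L x) mulr_suml -big_split /=.
    by apply: eq_bigr => k _; ring.
  have : C / eta * \sum_k bker L k x * `|d k| ^+ 2 <= e / 2.
    apply: (le_trans (ler_wpM2l _ m2)); first by rewrite divr_ge0// ltW.
    rewrite -subr_ge0 in A1.
    rewrite -subr_ge0.
    have -> : e / 2 - C / eta * (4 * m%:R * L ^+ 2 / n%:R) =
       (n%:R - 8 * C * m%:R * L ^+ 2 / (eta * e)) * (e / (2 * n%:R)).
      by field; rewrite !gt_eqF.
    by rewrite mulr_ge0// divr_ge0 ?(ltW e0)// mulr_ge0// ltW.
  have : C * eta <= e / 2.
    rewrite /eta mulrA ler_pdivrMr; last by rewrite mulr_gt0// ltr_wpDl.
    have -> : e / 2 * (2 * (C + 1)) = e * (C + 1) by field.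
    by nra.
  lra.
- move=> j; rewrite (partial_bernsteinB n0 L0 psi (fun i => g i x) (y01' j)).
  have /andP[yj1 yj2] := y14 j.
  have gam0 : 0 <= bgamma n L x j.
    apply: divr_ge0 => //; apply: mulr_ge0; first exact: mulr_ge0.
    by apply: mulr_ge0; lra.
  have gam : bgamma n L x j <= 2 * n%:R / L ^+ 2.
    have q1 : 1 <= 8 * (bcoord L x j * (1 - bcoord L x j)) by nra.
    rewrite /bgamma; set q := bcoord L x j * _ in q1 *.
    have q0 : 0 < q by lra.
    rewrite ler_pdivrMr; last by apply: mulr_gt0 => //; apply: mulr_gt0 => //; rewrite exprn_gt0.
    have -> : 2 * n%:R / L ^+ 2 * (4 * L ^+ 2 * q) = n%:R * (8 * q) by field; rewrite gt_eqF.
    by rewrite ler_peMr// ltW.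
  rewrite normrM ger0_norm//.
  apply: (@le_trans _ _ (2 * n%:R / L ^+ 2 * (e / (16 * m.+1%:R) * (4 * m%:R * L ^+ 2 / n%:R)
     + C * (64 * m%:R * L ^+ 4 / n%:R ^+ 2)))).
    apply: ler_pM => //.
    apply: (le_trans (ler_norm_sum _ _ _)).
    apply: (@le_trans _ _ (e / (16 * m.+1%:R) * (\sum_k bker L k x * `|d k| ^+ 2)
      + C * \sum_k bker L k x * `|d k| ^+ 4)).
      rewrite !mulr_sumr -big_split /=; apply: ler_sum => k _.
      rewrite normrM ger0_norm// -/(d k).
      have -> : e / (16 * m.+1%:R) * (bker L k x * `|d k| ^+ 2) +
        C * (bker L k x * `|d k| ^+ 4) =
        bker L k x * ((e / (16 * m.+1%:R) * `|d k| + C * `|d k| ^+ 3) * `|d k|) by ring.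
      rewrite ler_wpM2l// normrM ler_pM//; last exact: rV_coord_le.
      by rewrite Ed; exact: (HC x (d k)).2.
    by rewrite lerD// ler_wpM2l// ltW.
  have -> : 2 * n%:R / L ^+ 2 * (e / (16 * m.+1%:R) * (4 * m%:R * L ^+ 2 / n%:R)
     + C * (64 * m%:R * L ^+ 4 / n%:R ^+ 2)) =
     e / 2 * (m%:R / m.+1%:R) + 128 * C * m%:R * L ^+ 2 / n%:R.
    by field; rewrite !gt_eqF.
  have : e / 2 * (m%:R / m.+1%:R) <= e / 2.
    by rewrite ler_piMr// ?divr_ge0 ?(ltW e0)// ler_pdivrMr// mul1r ler_nat.
  have : 128 * C * m%:R * L ^+ 2 / n%:R <= e / 2.
    rewrite -subr_ge0 in A2; rewrite -subr_ge0.
    have -> : e / 2 - 128 * C * m%:R * L ^+ 2 / n%:R =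
       (n%:R - 256 * C * m%:R * L ^+ 2 / e) * (e / (2 * n%:R)) by field; rewrite !gt_eqF.
    by rewrite mulr_ge0// divr_ge0 ?(ltW e0)// mulr_ge0// ltW.
  by move=> H1 H2; rewrite [leRHS]splitr lerD.
Qed.

End density.

(** * Smooth test functions supported in annuli *)

Section annulus.
Context (R : realType) (m : nat).
Implicit Types (psi : 'rV[R]_m -> R) (x d : 'rV[R]_m).

(* psi / chi is approximated by Bernstein polynomials, where chi is a smooth function
   which is positive exactly in the annulus a < |x|^2 < b. *)
Lemma annulus_test_density psi (g : 'I_m -> 'rV[R]_m -> R) (a a1 b1 b e : R) :
  a < a1 -> b1 < b -> has_grad setT psi g -> (forall x, 0 <= psi x) ->
  (forall x, psi x != 0 -> a1 <= sqnorm x <= b1) -> 0 < e ->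
  exists phi, [/\ smooth_expr phi, forall x, 0 <= phi x,
    forall x, phi x != 0 -> a <= sqnorm x <= b,
    forall x, `|phi x - psi x| <= e & forall x i, `|partial i phi x - g i x| <= e].
Proof.
move=> aa1 b1b Hpsi psi_ge0 supp e0.
pose chi x := flat 0 (sqnorm x - a) * flat 0 (b - sqnorm x).
have schi : smooth_expr chi.
  apply: smooth_exprM; apply: smooth_expr_flat.
    by apply: smooth_exprD; [exact: smooth_expr_sqnorm|exact: smooth_expr_cst].
  have -> : (fun x : 'rV[R]_m => b - sqnorm x) = (fun x => b + (-1) * sqnorm x).
    by apply/funext => x; rewrite mulN1r.
  apply: smooth_exprD; first exact: smooth_expr_cst.
  by apply: smooth_exprM; [exact: smooth_expr_cst|exact: smooth_expr_sqnorm].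
have Hchi := smooth_expr_has_grad schi.
have chi0 x : ~~ (a < sqnorm x < b) -> chi x = 0.
  rewrite negb_and -!leNgt => /orP[xa|xb].
    by rewrite /chi flat_le0 ?mul0r// subr_le0.
  by rewrite /chi [X in _ * X]flat_le0 ?mulr0// subr_le0.
have chi_gt0 x : a < sqnorm x < b -> 0 < chi x.
  by move=> /andP[? ?]; rewrite mulr_gt0// flat_gt0// subr_gt0.
have chi_ge0 x : 0 <= chi x by rewrite mulr_ge0// flat_ge0.
have psi0 x : ~~ (a1 <= sqnorm x <= b1) -> psi x = 0.
  by move=> H; apply/eqP; apply: contraNT H; exact: supp.
(* As [0^-1] is 0, h is zero where chi vanishes. Since a < a1 and b1 < b, the open annulus and the
   complement of the closed one cover the space; the quotient rule applies on the former and h is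
   identically 0 on the latter, so h is C^1. *)
pose h x := psi x / chi x.
pose gh i x := if chi x == 0 then 0
  else g i x * (chi x)^-1 + psi x * (- chi x ^- 2 * partial i chi x).
have psiE x : psi x = chi x * h x.
  rewrite /h; case: (boolP (a < sqnorm x < b)) => xab.
    by rewrite mulrC divfK// gt_eqF// chi_gt0.
  rewrite chi0// mul0r psi0//; apply: contra xab => /andP[x1 x2].
  by rewrite (lt_le_trans aa1)// (le_lt_trans x2).
have cq := @continuous_sqnorm R m.
have oD1 : open [set x : 'rV[R]_m | a < sqnorm x < b].
  rewrite (_ : [set x | _] = (@sqnorm R m) @^-1` `]a, b[%classic); last first.
    by apply/seteqP; split => x /=; rewrite in_itv.
  by apply: open_comp => [x _|]; [exact: cq|exact: interval_open].
have oD2 : open [set x : 'rV[R]_m | ~~ (a1 <= sqnorm x <= b1)].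
  rewrite (_ : [set x | _] = ~` ((@sqnorm R m) @^-1` `[a1, b1]%classic)); last first.
    by apply/seteqP; split => x /=; rewrite in_itv /= => /negP.
  rewrite openC; apply: closed_comp => [x _|]; [exact: cq|exact: interval_closed].
have H1 : has_grad [set x : 'rV[R]_m | a < sqnorm x < b] h gh.
  apply: (has_grad_eq (f1 := fun x => psi x * (chi x)^-1)
    (g1 := fun i x => g i x * (chi x)^-1 + psi x * (- chi x ^- 2 * partial i chi x)) oD1) => //.
    by move=> x i /= xab; rewrite /gh gt_eqF// chi_gt0.
  apply: has_gradM; first exact: has_grad_sub Hpsi.
  apply: (has_grad_comp (h := GRing.inv) (dh := fun y : R => - y ^- 2)).
    exact: has_grad_sub Hchi.
  move=> x /= /chi_gt0 c0; have cn0 : chi x != 0 by rewrite gt_eqF.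
  split.
    apply: (is_derive_rw (is_deriveV (f := id) cn0 (is_derive_id (chi x) (1 : R)))).
    by rewrite [_ *: _]mulr1.
  apply: continuousN; apply: continuousV; first by rewrite expf_neq0.
  exact: exprn_continuous.
have H2 : has_grad [set x : 'rV[R]_m | ~~ (a1 <= sqnorm x <= b1)] h gh.
  apply: (has_grad_eq (f1 := fun=> 0) (g1 := fun _ _ => 0) oD2); last exact: has_grad_cst.
    by move=> x /= /psi0 x0; rewrite /h x0 mul0r.
  move=> x i /= xn; rewrite /gh; case: ifP => // _.
  rewrite (psi0 x)// mul0r addr0.
  have -> : g i x = 0; last by rewrite mul0r.
  apply: is_derive_unique ((Hpsi x I).2 i).1 _.
  have := is_derive_cst (0 : R) x (delta_mx ord0 i : 'rV[R]_m); apply: near_eq_is_derive.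
  have : \forall y \near x, ~~ (a1 <= sqnorm y <= b1) by exact: open_nbhs_nbhs.
  by apply: filterS => y /psi0 ->.
have Hh : has_grad setT h gh.
  apply: has_grad_sub (has_gradU H1 H2) => x _ /=.
  case: (boolP (a1 <= sqnorm x <= b1)) => [/andP[? ?]|]; [left|by right].
  by apply/andP; split; lra.
(* M is at least 1 and larger than b, so |x| >= M implies |x|^2 > b. *)
pose M : R := `|b| + 1.
have M1 : 1 <= M by rewrite lerDr.
have M0 : 0 < M by rewrite (lt_le_trans ltr01).
have sqM x : M <= `|x| -> b < sqnorm x.
  move=> Mx; apply: lt_le_trans (norm_sqnorm x).
  apply: (@lt_le_trans _ _ M); first by rewrite (le_lt_trans (ler_norm _))// ltrDl.
  by apply: (le_trans Mx); rewrite expr2 ler_peMl// (le_trans M1).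
have chiM x : M <= `|x| -> chi x = 0.
  by move=> /sqM bx; apply: chi0; rewrite negb_and -!leNgt (ltW bx) orbT.
have hM x : M < `|x| -> h x = 0 by move=> Mx; rewrite /h chiM ?ltW// invr0 mulr0.
have h_ge0 x : 0 <= h x by rewrite divr_ge0.
have cont_bd (f : 'rV[R]_m -> R) : continuous f -> exists C : R, forall x : 'rV[R]_m, `|x| <= M -> `|f x| <= C.
  by move=> cf; have := continuous_bounded_compact (@closed_ball_compact R m M) (continuous_subspaceT cf).
have [X0 HX0] : exists C : R, forall x : 'rV[R]_m, `|x| <= M -> `|chi x| <= C.
  by apply: cont_bd => x; case: (Hchi x I).
have [X1 HX1] : exists C : 'I_m -> R, forall i (x : 'rV[R]_m), `|x| <= M -> `|partial i chi x| <= C i.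
  have /choice[C HC] : forall i, exists C : R, forall x : 'rV[R]_m, `|x| <= M -> `|partial i chi x| <= C.
    by move=> i; apply: cont_bd => x; case: (Hchi x I) => _ /(_ i)[].
  by exists C.
pose X : R := `|X0| + \sum_i `|X1 i| + 1.
have X0X : X0 <= X.
  rewrite /X -addrA (le_trans (ler_norm _))// lerDl addr_ge0// sumr_ge0//.
have X1X i : X1 i <= X.
  rewrite /X (bigD1 i)//= addrAC addrCA (le_trans (ler_norm _))// lerDl.
  by rewrite !addr_ge0// sumr_ge0.
have Xp : 0 < X by rewrite ltr_wpDl// addr_ge0// sumr_ge0.
(* X bounds chi and its partial derivatives, so the two terms of the product rule each cost e / 2.
   The cube of half-side 2 M gives an approximation on |x| <= M, outside which chi vanishes. *)
have e'0 : 0 < e / (2 * X) by rewrite divr_gt0// mulr_gt0.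
have L0 : 0 < 2 * M by rewrite mulr_gt0.
have [B sB HB] := bernstein_approx L0 Hh hM h_ge0 e'0.
have LM : 2 * M / 2 = M by field.
rewrite LM in HB.
have HBg := smooth_expr_has_grad sB.
exists (fun x => chi x * B x).
have sp : smooth_expr (fun x => chi x * B x) by exact: smooth_exprM.
have bnd1 x : `|x| <= M -> `|chi x| <= X by move=> xM; exact: le_trans (HX0 _ xM) X0X.
have bnd2 i x : `|x| <= M -> `|partial i chi x| <= X.
  by move=> xM; exact: le_trans (HX1 _ _ xM) (X1X i).
have X2 : X * (e / (2 * X)) = e / 2 by field; rewrite gt_eqF.
split => //.
- move=> x; case: (leP `|x| M) => xM; first by rewrite mulr_ge0//; case: (HB _ xM).
  by rewrite (chiM _ (ltW xM)) mul0r.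
- move=> x; apply: contraNT => H.
  by rewrite chi0 ?mul0r//; apply: contra H => /andP[? ?]; rewrite !ltW.
- move=> x; rewrite psiE -mulrBr normrM; case: (leP `|x| M) => xM; last first.
    by rewrite (chiM _ (ltW xM)) normr0 mul0r ltW.
  case: (HB _ xM) => _ HB1 _.
  apply: (@le_trans _ _ (X * (e / (2 * X)))); first by rewrite ler_pM// bnd1.
  rewrite X2; lra.
- move=> x i.
  have -> : g i x = partial i chi x * h x + chi x * gh i x.
    apply: is_derive_unique ((Hpsi x I).2 i).1 _.
    have Epsi : psi = (fun y => chi y * h y) by apply/funext => y; exact: psiE.
    have D := (((has_gradM Hchi Hh) x I).2 i).1.
    by rewrite [X in is_derive _ _ X]Epsi.
  rewrite (has_grad_partial i (has_gradM Hchi HBg) (I : setT x)).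
  have -> : partial i chi x * B x + chi x * partial i B x -
    (partial i chi x * h x + chi x * gh i x) =
    partial i chi x * (B x - h x) + chi x * (partial i B x - gh i x) by ring.
  case: (leP `|x| M) => xM; last first.
    rewrite (chiM x (ltW xM)).
    have -> : partial i chi x = 0.
      by apply: (is_derive_far0 (fun x => ((Hchi x I).2 i).1) chiM).
    by rewrite !mul0r addr0 normr0 ltW.
  case: (HB _ xM) => _ HB1 /(_ i) HB2.
  apply: (le_trans (ler_normD _ _)); rewrite !normrM [leRHS]splitr -X2.
  apply: lerD; apply: ler_pM => //.
  - exact: bnd2.
  - by rewrite -normrM; exact: bnd1.
Qed.

End annulus.

(** Sylvester's identity, read off from two triangular factorizations of one block matrix. *)
Lemma det_1Dmul (F : comNzRingType) m n (v : 'M[F]_(m, n)) (u : 'M[F]_(n, m)) :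
  \det (1%:M + v *m u) = \det (1%:M + u *m v).
Proof.
have E : block_mx 1%:M 0 v 1%:M *m block_mx 1%:M (- u) 0 (1%:M + v *m u) =
    block_mx (1%:M + u *m v) (- u) 0 1%:M *m block_mx 1%:M 0 v 1%:M :> 'M[F]_(n + m).
  rewrite !mulmx_block !mul1mx !mulmx1 !mul0mx !mulmx0 !addr0 !add0r.
  by rewrite mulmxN mulNmx [- _ + _]addrC !addrK.
have := congr1 determinant E.
by rewrite !det_mulmx !det_lblock !det_ublock !det1 !mul1r !mulr1.
Qed.

(** P and 1 - P are complementary idempotents, so such combinations multiply componentwise. With
    reciprocal factors this inverts the metric. *)
Lemma idempotent_mix (F : comNzRingType) m (P : 'M[F]_m) (a b : F) : P *m P = P ->
  (P + a *: (1%:M - P)) *m (P + b *: (1%:M - P)) = P + (a * b) *: (1%:M - P).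
Proof.
move=> PP.
have PQ : P *m (1%:M - P) = 0 by rewrite mulmxBr mulmx1 PP subrr.
have QP : (1%:M - P) *m P = 0 by rewrite mulmxBl mul1mx PP subrr.
have QQ : (1%:M - P) *m (1%:M - P) = 1%:M - P by rewrite mulmxBl mul1mx PQ subr0.
rewrite mulmxDl !mulmxDr -!scalemxAl -!scalemxAr PP PQ QP QQ.
by rewrite !scaler0 addr0 add0r scalerA.
Qed.

(** * The model metric *)

Section geometry.
Context (R : realType) (m : nat) (sigma : R -> R).
Implicit Types (x xi eta zeta : 'rV[R]_m) (p : R).

Definition dot xi eta : R := \sum_i xi ord0 i * eta ord0 i.

Lemma dotC xi eta : dot xi eta = dot eta xi.
Proof. by apply: eq_bigr => i _; rewrite mulrC. Qed.

Lemma dotDl xi eta zeta : dot (xi + eta) zeta = dot xi zeta + dot eta zeta.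
Proof. by rewrite -big_split; apply: eq_bigr => i _; rewrite mxE mulrDl. Qed.

Lemma dotZl c xi zeta : dot (c *: xi) zeta = c * dot xi zeta.
Proof. by rewrite mulr_sumr; apply: eq_bigr => i _; rewrite mxE mulrA. Qed.

Lemma dot_ge0 xi : 0 <= dot xi xi.
Proof. by apply: sumr_ge0 => i _; rewrite -expr2 sqr_ge0. Qed.

Lemma mulmx_dot xi eta : xi *m eta^T = (dot xi eta)%:M.
Proof.
apply/matrixP => i j; rewrite !ord1 !mxE eqxx mulr1n.
by apply: eq_bigr => k _; rewrite mxE.
Qed.

Local Notation r := (@polar_radius R m).

Lemma radius_ge0 x : 0 <= r x. Proof. exact: sqrtr_ge0. Qed.

Lemma sqr_radius x : r x ^+ 2 = sqnorm x.
Proof. by rewrite sqr_sqrtr// sumr_ge0// => i _; exact: sqr_ge0. Qed.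

Lemma sqr_radius_dot x : r x ^+ 2 = dot x x.
Proof. by rewrite sqr_radius; apply: eq_bigr => i _; rewrite expr2. Qed.

Lemma radius_neq0 x : (0 < r x) = (x != 0).
Proof.
apply/idP/idP => [|x0].
  apply: contraTneq => ->; rewrite -leNgt /polar_radius big1 ?sqrtr0// => i _.
  by rewrite mxE expr0n.
rewrite lt_neqAle radius_ge0 andbT eq_sym; apply: contra x0 => /eqP r0.
have := sqr_radius x; rewrite r0 expr0n /= => /esym/eqP.
rewrite psumr_eq0 => [|i _]; last exact: sqr_ge0.
move=> /allP H; apply/eqP/rowP => i; rewrite mxE.
by apply/eqP; rewrite -sqrf_eq0; apply: H; rewrite mem_index_enum.
Qed.

(* The metric of covectors: the inverse of the Gram matrix P + (sigma / r)^2 (1 - P)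
   is P + (r / sigma)^2 (1 - P). *)
Definition dual x xi eta : R :=
  dot xi x * dot eta x / r x ^+ 2
  + (r x / sigma (r x)) ^+ 2 * (dot xi eta - dot xi x * dot eta x / r x ^+ 2).

Lemma dualC x xi eta : dual x xi eta = dual x eta xi.
Proof. by rewrite /dual (dotC xi eta) [dot xi x * _]mulrC. Qed.

Lemma dualDl x xi eta zeta : dual x (xi + eta) zeta = dual x xi zeta + dual x eta zeta.
Proof. by rewrite /dual !dotDl; ring. Qed.

Lemma dualZl x c xi zeta : dual x (c *: xi) zeta = c * dual x xi zeta.
Proof. by rewrite /dual !dotZl; ring. Qed.

Lemma dualDr x xi eta zeta : dual x zeta (xi + eta) = dual x zeta xi + dual x zeta eta.
Proof. by rewrite dualC dualDl !(dualC x zeta). Qed.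

Lemma dualZr x c xi zeta : dual x zeta (c *: xi) = c * dual x zeta xi.
Proof. by rewrite dualC dualZl dualC. Qed.

Lemma dualBr x xi eta zeta : dual x zeta (xi - eta) = dual x zeta xi - dual x zeta eta.
Proof. by rewrite dualDr -scaleN1r dualZr mulN1r. Qed.

Lemma dual_sum x xi zeta : dual x xi zeta =
  \sum_i zeta ord0 i * dual x xi (delta_mx ord0 i).
Proof.
rewrite [in LHS](row_sum_delta zeta).
have dual0 : dual x xi 0 = 0 by rewrite -(scale0r (0 : 'rV[R]_m)) dualZr mul0r.
elim/big_ind2 : _ => // [a b c d <- <-|i _]; first exact: dualDr.
by rewrite dualZr.
Qed.

Section away_from_pole.
Variable x : 'rV[R]_m.
Hypotheses (x0 : x != 0) (s0 : 0 < sigma (r x)).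

Let rx0 : 0 < r x. Proof. by rewrite radius_neq0. Qed.
Let rn0 : r x != 0. Proof. by rewrite gt_eqF. Qed.
Let sn0 : sigma (r x) != 0. Proof. by rewrite gt_eqF. Qed.

Let P := (r x ^+ 2)^-1 *: (x^T *m x).

Let PP : P *m P = P.
Proof.
rewrite /P -scalemxAl -scalemxAr scalerA mulmxA -(mulmxA x^T x) mulmx_dot.
rewrite -sqr_radius_dot mul_mx_scalar -scalemxAl scalerA -mulrA mulVf ?mulr1//.
by rewrite expf_neq0.
Qed.

Let PT : P^T = P.
Proof. by rewrite /P linearZ /= trmx_mul trmxK. Qed.

Let g := metric sigma x.
Let gE : g = P + (sigma (r x) / r x) ^+ 2 *: (1%:M - P).
Proof. by rewrite /g /metric (negbTE x0). Qed.

Let G := P + (r x / sigma (r x)) ^+ 2 *: (1%:M - P).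

Let gG : g *m G = 1%:M.
Proof.
rewrite gE /G (idempotent_mix _ _ PP) -exprMn.
have -> : sigma (r x) / r x * (r x / sigma (r x)) = 1 by field; rewrite rn0 sn0.
by rewrite expr1n scale1r addrC subrK.
Qed.

Let gunit : g \in unitmx.
Proof. by have [] := mulmx1_unit gG. Qed.

Let invg : invmx g = G.
Proof. by rewrite -[LHS]mulmx1 -gG mulmxA mulVmx// mul1mx. Qed.

Let dualG xi eta : xi *m G *m eta^T = (dual x xi eta)%:M.
Proof.
have HP : xi *m P *m eta^T = (dot xi x * dot eta x / r x ^+ 2)%:M.
  have -> : xi *m P *m eta^T = (r x ^+ 2)^-1 *: ((xi *m x^T) *m (x *m eta^T)).
    by rewrite /P -scalemxAr -scalemxAl !mulmxA.
  by rewrite !mulmx_dot mul_scalar_mx !scale_scalar_mx (dotC x) mulrC.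
rewrite /G mulmxDr mulmxDl HP -scalemxAr -scalemxAl mulmxBr mulmxBl mulmx1 HP mulmx_dot.
by rewrite /dual; apply/matrixP => i j; rewrite !ord1 !mxE eqxx !mulr1n.
Qed.

Lemma inner_sharp c xi eta :
  inner sigma x (c *: sharp sigma x xi) (sharp sigma x eta) = c * dual x xi eta.
Proof.
rewrite /inner /sharp -/g invg -scalemxAl -scalemxAl mxE; congr (_ * _).
have GT : G^T = G by rewrite /G raddfD /= PT linearZ /= raddfB /= PT trmx1.
have -> : xi *m G *m g *m (eta *m G)^T = (dual x xi eta)%:M.
  rewrite trmx_mul GT -(mulmxA xi) -(mulmxA xi) -(mulmxA G) (mulmxA g) gG mul1mx.
  by rewrite mulmxA dualG.
by rewrite mxE eqxx mulr1n.
Qed.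

Lemma riem_norm_sharp xi : riem_norm sigma x (sharp sigma x xi) = Num.sqrt (dual x xi xi).
Proof.
by rewrite /riem_norm -[sharp sigma x xi in X in inner _ _ X]scale1r inner_sharp mul1r.
Qed.

(** The metric is s^2 times a rank-one perturbation of the identity; Sylvester's identity reduces
    its determinant to a scalar, s^(-2), against s^(2 m) from the homothety. *)
Lemma det_metric : \det (metric sigma x) = (sigma (r x) / r x) ^+ (2 * m.-1).
Proof.
set s := sigma (r x) / r x.
have s0' : s != 0 by rewrite mulf_neq0// invr_eq0.
have sE : sigma (r x) / r x = s by [].
pose c := (s ^- 2 - 1) / r x ^+ 2.
have -> : metric sigma x = s ^+ 2 *: (1%:M + x^T *m (c *: x)).
  have E : s ^+ 2 *: (x^T *m (c *: x)) = (1 - s ^+ 2) *: P.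
    rewrite -scalemxAr scalerA /P scalerA; congr (_ *: _).
    by rewrite /c; field; rewrite s0' rn0.
  rewrite [RHS]scalerDr E -/g gE -/s scalerBl scale1r [s ^+ 2 *: (1%:M - P)]scalerDr scalerN.
  by rewrite addrCA.
rewrite detZ det_1Dmul -scalemxAl mulmx_dot -sqr_radius_dot scale_scalar_mx.
have -> : 1%:M + (c * r x ^+ 2)%:M = (s ^- 2)%:M :> 'M[R]_1.
  rewrite -raddfD /=; congr (_%:M); rewrite /c; field.
  by rewrite s0' rn0.
rewrite det_scalar expr1.
have m0 : (0 < m)%N.
  case: (posnP m) => // mz; move: x0.
  suff -> : x = 0 by rewrite eqxx.
  by apply/rowP => i; have := ltn_ord i; rewrite {2}mz.
rewrite -exprM -{1}(prednK m0) mulnS exprD mulrC mulrA mulVf ?mul1r//.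
by rewrite expf_neq0.
Qed.

Lemma vol_densityE : vol_density sigma x = (sigma (r x) / r x) ^+ m.-1.
Proof.
rewrite /vol_density det_metric mulnC exprM sqrtr_sqr ger0_norm//.
by rewrite exprn_ge0// divr_ge0// ltW.
Qed.

Lemma dual_ge0 xi : 0 <= dual x xi xi.
Proof.
have CS : dot xi x * dot xi x / r x ^+ 2 <= dot xi xi.
  (* Euclidean Cauchy-Schwarz: up to the factor r^2, this vector is the component of xi orthogonal
     to x. *)
  have := dot_ge0 (r x ^+ 2 *: xi + (- dot xi x) *: x).
  rewrite dotDl !dotZl !(dotC _ (_ + _)) !dotDl !dotZl -(sqr_radius_dot x) (dotC x xi).
  set a := dot xi x; set b := dot xi xi; set q := r x ^+ 2 => H.
  have q0 : 0 < q by rewrite exprn_gt0.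
  rewrite ler_pdivrMr//.
  have : 0 <= q * (b * q - a * a) by move: H; congr (_ <= _); ring.
  by rewrite pmulr_rge0// subr_ge0.
rewrite addr_ge0//; first by rewrite divr_ge0 ?sqr_ge0// -expr2 sqr_ge0.
by rewrite mulr_ge0 ?sqr_ge0// subr_ge0.
Qed.

Lemma dual_CS xi eta : dual x xi eta ^+ 2 <= dual x xi xi * dual x eta eta.
Proof.
set a := dual x eta eta; set b := dual x xi eta; set c := dual x xi xi.
have Q t : 0 <= c + 2 * t * b + t ^+ 2 * a.
  have := dual_ge0 (xi + t *: eta); congr (_ <= _).
  by rewrite dualDl !dualDr !dualZl !dualZr (dualC x eta xi) -/a -/b -/c; ring.
have a0 : 0 <= a by exact: dual_ge0.
have c0 : 0 <= c by exact: dual_ge0.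
have [az|an] := eqVneq a 0.
  rewrite az mulr0; have [->|bn] := eqVneq b 0; first by rewrite expr0n.
  (* For a = 0 the quadratic is affine in t; with b nonzero this t gives it the negative value - c -
     2. *)
  have := Q (- (c + 1) / b); rewrite az mulr0 addr0.
  have -> : c + 2 * (- (c + 1) / b) * b = - c - 2 by field.
  lra.
have ap : 0 < a by rewrite lt_neqAle eq_sym an.
have := Q (- b / a).
have -> : c + 2 * (- b / a) * b + (- b / a) ^+ 2 * a = (c * a - b ^+ 2) / a by field.
by rewrite pmulr_lge0 ?invr_gt0// subr_ge0.
Qed.

Definition dual_norm xi := Num.sqrt (dual x xi xi).

Lemma sqr_dual_norm xi : dual_norm xi ^+ 2 = dual x xi xi.
Proof. by rewrite sqr_sqrtr// dual_ge0. Qed.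

Lemma dual_norm_ge0 xi : 0 <= dual_norm xi. Proof. exact: sqrtr_ge0. Qed.

Lemma dual_le xi eta : `|dual x xi eta| <= dual_norm xi * dual_norm eta.
Proof.
rewrite -sqrtr_sqr /dual_norm -sqrtrM ?dual_ge0// ler_sqrt ?mulr_ge0 ?dual_ge0//.
exact: dual_CS.
Qed.

(** The case a = 0 is included: even for p < 2, both sides are then 0. This makes the degenerate
    points of the gradient harmless. *)
Lemma powR_sub2 (p a : R) : 1 < p -> 0 <= a -> a `^ (p - 2) * a = a `^ (p - 1).
Proof.
move=> p1 a0; have q0 : 0 < p - 1 by lra.
by rewrite mulrC -(mulr_powRB1 a0 q0); congr (_ * _ `^ _); ring.
Qed.

(** Write a and c for the two norms. Bounding the mixed terms by Cauchy-Schwarz leaves (a^(p-1) -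
    c^(p-1)) (a - c), which is nonnegative because t^(p-1) is increasing. *)
Lemma plap_monotone p xi eta : 1 < p ->
  0 <= dual_norm xi `^ (p - 2) * dual x xi (xi - eta)
     - dual_norm eta `^ (p - 2) * dual x eta (xi - eta).
Proof.
move=> p1; rewrite !dualBr -!sqr_dual_norm (dualC x eta xi).
set b := dual x xi eta; set a := dual_norm xi; set c := dual_norm eta.
have a0 : 0 <= a by exact: dual_norm_ge0.
have c0 : 0 <= c by exact: dual_norm_ge0.
have bac : b <= a * c by apply: le_trans (ler_norm _) (dual_le _ _).
have pa := powR_sub2 p1 a0; have pc := powR_sub2 p1 c0.
have pa0 := powR_ge0 a (p - 2); have pc0 := powR_ge0 c (p - 2).
apply: (@le_trans _ _ ((a `^ (p - 1) - c `^ (p - 1)) * (a - c))).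
  case: (leP a c) => ac.
    rewrite mulr_le0// ?subr_le0// ge0_ler_powR//; lra.
  rewrite mulr_ge0// ?subr_ge0 ?(ltW ac)// ge0_ler_powR ?(ltW ac)//; lra.
rewrite -pa -pc.
have H : (a `^ (p - 2) + c `^ (p - 2)) * b <= (a `^ (p - 2) + c `^ (p - 2)) * (a * c).
  by rewrite ler_wpM2l// addr_ge0.
rewrite -subr_ge0 in H; rewrite -subr_ge0; move: H; congr (_ <= _); ring.
Qed.

(** On multiples of dr the tangential part drops out, so sigma disappears. *)
Lemma dual_radial c zeta : dual x (c *: x) zeta = c * dot x zeta.
Proof.
rewrite /dual !dotZl -sqr_radius_dot (dotC x zeta).
have -> : c * r x ^+ 2 * dot zeta x / r x ^+ 2 = c * dot zeta x by field.
by rewrite subrr mulr0 addr0.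
Qed.

Lemma dual_norm_radial c : dual_norm (c *: x) = `|c| * r x.
Proof.
by rewrite /dual_norm dual_radial (dotC x) dotZl -sqr_radius_dot mulrA -expr2 -exprMn
  sqrtr_sqr normrM [`|r x|]ger0_norm// radius_ge0.
Qed.

End away_from_pole.
End geometry.

(** * Radial fields *)

Section radial.
Context (R : realType) (m : nat).
Implicit Types (x : 'rV[R]_m).
Local Notation r := (@polar_radius R m).
Local Notation mu := (lebesgue_rV R m).

Lemma continuous_sum_at (T : topologicalType) (I : Type) (s : seq I) (F : I -> T -> R) (x : T) :
  (forall i, {for x, continuous (F i)}) ->
  {for x, continuous (fun y => \sum_(i <- s) F i y)}.
Proof.
move=> cF; elim: s => [|i s IH].
  by apply: (eq_continuous (f := cst 0)) => [y|]; [rewrite big_nil|exact: cst_continuous].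
apply: (eq_continuous (f := fun y => F i y + \sum_(j <- s) F j y)) => [y|].
  by rewrite big_cons.
exact: continuousD.
Qed.

Lemma continuous_radius : continuous r.
Proof.
move=> x; apply: (continuous_comp (f := @sqnorm R m) (g := Num.sqrt)).
  exact: continuous_sqnorm.
exact: sqrt_continuous.
Qed.

Lemma open_radius_gt (a : R) : open [set x | a < r x].
Proof.
rewrite (_ : [set x | _] = r @^-1` `]a, +oo[%classic); last first.
  by apply/seteqP; split => x /=; rewrite in_itv /= andbT.
by apply: open_comp => [x _|]; [exact: continuous_radius|exact: interval_open].
Qed.

Lemma open_radius_lt (a : R) : open [set x | r x < a].
Proof.
rewrite (_ : [set x | _] = r @^-1` `]-oo, a[%classic); last first.
  by apply/seteqP; split => x /=; rewrite in_itv.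
by apply: open_comp => [x _|]; [exact: continuous_radius|exact: interval_open].
Qed.

Lemma norm_le_radius x : `|x| <= r x.
Proof.
rewrite -[leLHS]ger0_norm// -sqrtr_sqr ler_sqrt ?norm_sqnorm//; exact: sqnorm_ge0.
Qed.

Lemma has_grad_radius : has_grad [set x | 0 < r x] r (fun i x => x ord0 i / r x).
Proof.
have H : has_grad [set x | 0 < r x] (fun x : 'rV[R]_m => Num.sqrt (sqnorm x))
  (fun i x => (2 * Num.sqrt (sqnorm x))^-1 * (2 * x ord0 i)); last first.
  refine (has_grad_eq (@open_radius_gt 0) _ _ H) => //.
  move=> x i /= rx; rewrite -/(r x); field.
  by rewrite gt_eqF.
apply: (@has_grad_comp _ _ _ _ _ Num.sqrt (fun q => (2 * Num.sqrt q)^-1)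
  (@has_grad_sqnorm R m [set x | 0 < r x])).
move=> x /= rx; have q0 : 0 < sqnorm x by rewrite -sqr_radius exprn_gt0.
split; first exact: is_derive1_sqrt.
apply: continuousV; first by rewrite mulf_neq0// gt_eqF.
by apply: continuousM; [exact: cst_continuous|exact: sqrt_continuous].
Qed.

Lemma has_grad_radial (a : R) (Z dZ : R -> R) : 0 <= a ->
  (forall rho : R, a < rho -> is_derive rho 1 Z (dZ rho) /\ {for rho, continuous dZ}) ->
  has_grad [set x | a < r x] (fun x => Z (r x)) (fun i x => dZ (r x) * (x ord0 i / r x)).
Proof.
move=> a0 HZ; apply: has_grad_comp => [|x /= ax]; last exact: HZ.
by apply: has_grad_sub has_grad_radius => x /=; exact: le_lt_trans.
Qed.

Variables (Y dY : R -> R) (psi : 'rV[R]_m -> R) (g : 'I_m -> 'rV[R]_m -> R) (a L : R).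
Hypotheses (a0 : 0 < a)
  (HY : forall rho : R, 0 < rho -> is_derive rho 1 Y (dY rho) /\ {for rho, continuous dY})
  (Hpsi : has_grad setT psi g) (psiL : forall x, L < `|x| -> psi x = 0)
  (near_pole : forall x, r x < a ->
    (psi x = 0 /\ forall i, g i x = 0) \/ (Y (r x) = 0 /\ dY (r x) = 0)).

Let Z (rho : R) : R := Y rho / rho ^+ m.
Let dZ (rho : R) : R := dY rho / rho ^+ m - m%:R * Y rho / rho ^+ m.+1.

Let HZ (rho : R) : 0 < rho -> is_derive rho 1 Z (dZ rho) /\ {for rho, continuous dZ}.
Proof.
move=> r0; have [DY cdY] := HY r0.
have rn : rho != 0 by rewrite gt_eqF.
have rm : rho ^+ m != 0 by rewrite expf_neq0.
have cY : {for rho, continuous Y}.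
  by apply: differentiable_continuous; apply/derivable1_diffP; case: DY.
split.
  have D1 := is_deriveV (f := fun s : R => s ^+ m) rm (is_derive_exprn m rho).
  apply: (is_derive_rw (is_deriveM DY D1)).
  have -> : m%:R * rho ^+ m.-1 = m%:R * rho ^+ m / rho :> R.
    by case: m => [|k] /=; rewrite ?mul0r// exprSr mulrA mulfK.
  rewrite /GRing.scale /= /dZ [rho ^+ m.+1]exprS.
  move: rm; set q := rho ^+ m => rm; field.
  by rewrite rn rm.
have c1 k : {for rho, continuous (fun s : R => (s ^+ k)^-1)}.
  by apply: continuousV; [rewrite expf_neq0|exact: exprn_continuous].
apply: continuousB.
  by apply: continuousM => //; exact: c1.
apply: continuousM; last exact: c1.
by apply: continuousM => //; exact: cst_continuous.
Qed.

(** The pairing of the gradient g with the field Y(r) r^(-m) x; [radial_source] is psi times the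
    divergence of that field. By [near_pole], either psi or Y vanishes near the origin, so the
    singularity of the field never matters. *)
Definition radial_pairing x := \sum_i g i x * (Y (r x) / r x ^+ m * x ord0 i).
Definition radial_source x := psi x * (dY (r x) * r x / r x ^+ m).

Let Fi i x := psi x * (Z (r x) * x ord0 i).
Let Gij i j x := g j x * (Z (r x) * x ord0 i)
  + psi x * ((dZ (r x) * (x ord0 j / r x)) * x ord0 i + Z (r x) * (i == j)%:R).
(** The partial derivative of [Fi i] on the whole space: [Fi i] is zero near the pole, and the
    product rule holds elsewhere. *)
Let Gi i x := if r x < a then 0 else Gij i i x.

Let grad1 i : has_grad [set x | 0 < r x] (Fi i) (Gij i).
Proof.
apply: has_gradM; first exact: has_grad_sub Hpsi.
apply: has_gradM; last exact: has_grad_coord.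
by apply: (@has_grad_radial 0) => // rho; exact: HZ.
Qed.

Let Fi0 i x : r x < a -> Fi i x = 0.
Proof. by rewrite /Fi /Z => /near_pole[[-> _]|[-> _]]; rewrite ?mul0r ?mulr0. Qed.

Let near_small x : r x < a -> \forall y \near x, r y < a.
Proof. by move=> xa; exact: open_nbhs_nbhs (conj (@open_radius_lt a) xa). Qed.

Let Gii i : (forall x, is_derive x (delta_mx ord0 i) (Fi i) (Gi i x)) /\ continuous (Gi i).
Proof.
have H1 x : 0 < r x -> is_derive x (delta_mx ord0 i) (Fi i) (Gij i i x) /\
    {for x, continuous (Gij i i)} by move=> rx; have [_] := @grad1 i x rx; exact.
have D0 x : r x < a -> is_derive x (delta_mx ord0 i) (Fi i) 0.
  move=> rx; have := is_derive_cst (0 : R) x (delta_mx ord0 i : 'rV[R]_m).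
  by apply: near_eq_is_derive; apply: filterS (near_small rx) => y /Fi0 ->.
have E x : 0 < r x -> Gi i x = Gij i i x.
  move=> rx; rewrite /Gi; case: ifPn => // xa.
  by apply: is_derive_unique (D0 _ xa) (H1 _ rx).1.
split => x.
  rewrite /Gi; case: ifPn => [|xa]; first exact: D0.
  by case: (H1 x) => //; rewrite (lt_le_trans a0)// leNgt.
case: (ltP 0 (r x)) => rx.
  apply: near_continuous (H1 _ rx).2.
  have : \forall y \near x, 0 < r y by exact: open_nbhs_nbhs (conj (@open_radius_gt 0) rx).
  by apply: filterS => y /E ->.
have xa : r x < a by exact: le_lt_trans a0.
have : {for x, continuous (cst (0 : R) : 'rV[R]_m -> R)} by exact: cst_continuous.
by apply: near_continuous; apply: filterS (near_small xa) => y ya; rewrite /Gi ya.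
Qed.

Let psi_far x : L + 1 <= `|x| -> psi x = 0.
Proof. by move=> Lx; apply: psiL; lra. Qed.

Let cont_pairing : continuous radial_pairing.
Proof.
move=> x; case: (ltP (r x) a) => xa.
  have : {for x, continuous (cst (0 : R) : 'rV[R]_m -> R)} by exact: cst_continuous.
  apply: near_continuous; apply: filterS (near_small xa) => y ya.
  rewrite /radial_pairing big1// => i _.
  by case: (near_pole ya) => [[_ ->]|[-> _]]; rewrite ?mul0r ?mulr0.
have rx : 0 < r x by exact: lt_le_trans xa.
apply: continuous_sum_at => i; apply: continuousM.
  by case: (Hpsi (I : setT x)) => _ /(_ i)[].
apply: continuousM; last exact: coord_continuous.
apply: (continuous_comp (f := r) (g := Z)); first exact: continuous_radius.
by apply: differentiable_continuous; apply/derivable1_diffP; case: (HZ rx) => -[].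
Qed.

(** Away from the pole this is psi div F = div(psi F) - grad psi . F, where div F = r dZ + m Z; the
    terms with m cancel and leave Y'(r) r^(1 - m). *)
Let source_pairing x : radial_source x = \sum_i Gi i x - radial_pairing x.
Proof.
case: (ltP (r x) a) => xa.
  rewrite /radial_source /radial_pairing [X in X - _]big1 => [|i _]; last by rewrite /Gi xa.
  case: (near_pole xa) => [[-> g0]|[-> ->]].
    by rewrite mul0r big1 ?subrr// => i _; rewrite g0 mul0r.
  by rewrite !mul0r mulr0 big1 ?subrr// => i _; rewrite !mul0r mulr0.
have rx : 0 < r x by exact: lt_le_trans xa.
rewrite /radial_pairing -sumrB.
transitivity (\sum_i psi x * ((dZ (r x) / r x) * x ord0 i ^+ 2 + Z (r x))); last first.
  apply: eq_bigr => i _; rewrite /Gi ltNge xa /= /Gij eqxx mulr1 /Z; set q := dZ _; ring.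
rewrite -mulr_sumr big_split /= -mulr_sumr sumr_const card_ord.
rewrite -[\sum_i _]/(sqnorm x) -sqr_radius /radial_source; congr (_ * _).
rewrite /dZ /Z -mulr_natl exprS; field.
by rewrite expf_neq0 gt_eqF.
Qed.

(* The field Y(r) r^(-m) x has divergence Y'(r) r^(1 - m). *)
Lemma radial_divergence :
  [/\ mu.-integrable setT (EFin \o radial_pairing),
      mu.-integrable setT (EFin \o radial_source) &
      (\int[mu]_x (radial_source x)%:E = - \int[mu]_x (radial_pairing x)%:E)%E].
Proof.
have mcont (f : 'rV[R]_m -> R) : continuous f -> measurable_fun setT (f : 'rV[R]_m -> measurableTypeR R).
  by move=> cf; apply: continuous_measurable_rV => [|x _]; [exact: openT|exact: cf].
have icont (f : 'rV[R]_m -> R) : continuous f -> (forall x, L + 1 < `|x| -> f x = 0) ->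
    mu.-integrable setT (EFin \o f).
  move=> cf f0; have [C _ HC] := continuous_support_bounded cf f0.
  by apply: (@integrable_rV _ _ _ f C (L + 1)) => // [|x _]; [exact: mcont|exact: f0].
have Gi0 i x : L + 1 < `|x| -> Gi i x = 0.
  by apply: (is_derive_far0 (Gii i).1) => y Ly; rewrite /Fi psi_far// mul0r.
have iG i : mu.-integrable setT (EFin \o Gi i) by apply: icont; [exact: (Gii i).2|exact: Gi0].
have g0 i x : L + 1 < `|x| -> g i x = 0.
  by apply: (is_derive_far0 (fun x => ((Hpsi (I : setT x)).2 i).1)) => y; exact: psi_far.
have iP : mu.-integrable setT (EFin \o radial_pairing).
  apply: icont => // x Lx; rewrite /radial_pairing big1// => i _.
  by rewrite g0// mul0r.
have iS : mu.-integrable setT (EFin \o (fun x => \sum_i Gi i x)).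
  rewrite (_ : EFin \o _ = (fun x => (\sum_i (Gi i x)%:E)%E)); last first.
    by apply/funext => x /=; rewrite sumEFin.
  by apply: (@integrable_sum _ _ _ _ _ measurableT _ _ _ (fun i => EFin \o Gi i)) => i _; exact: iG.
have -> : EFin \o radial_source = ((EFin \o (fun x => (\sum_i Gi i x)%R)) \- (EFin \o radial_pairing))%E.
  by apply/funext => x /=; rewrite source_pairing EFinB.
split => //; first exact: integrableB.
under eq_integral do rewrite source_pairing EFinB.
rewrite integralB//; have -> : (\int[mu]_x (\sum_i Gi i x)%:E = 0)%E.
  under eq_integral do rewrite -sumEFin.
  rewrite integral_sum// big1// => i _.
  apply: (integral_partial0 (i := i) (f := Fi i) (L := L + 1)); first exact: (Gii i).1.
    exact: (Gii i).2.
  by move=> x Lx; rewrite /Fi psi_far// mul0r.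
by rewrite add0e.
Qed.

End radial.

(** * The radial ordinary differential equation *)

Section positive_part_power.
Context (R : realType).

(** For b = 0 this is the constant 1, also at t <= 0, which explains the hypotheses [b != 0]
    below. *)
Definition pospow (b t : R) : R := Num.max t 0 `^ b.

Lemma pospow_ge0 b t : 0 <= pospow b t. Proof. exact: powR_ge0. Qed.

Lemma pospowE b t : 0 <= t -> pospow b t = t `^ b.
Proof. by move=> t0; rewrite /pospow max_l. Qed.

Lemma pospow0 b t : b != 0 -> t <= 0 -> pospow b t = 0.
Proof. by move=> b0 t0; rewrite /pospow max_r// powR0. Qed.

Lemma pospow_gt0 b t : 0 < t -> 0 < pospow b t.
Proof. by move=> t0; rewrite pospowE ?ltW// powR_gt0. Qed.

Lemma is_derive_cont (f : R -> R) (t d : R) : is_derive t 1 f d -> {for t, continuous f}.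
Proof. by move=> [D _]; apply: differentiable_continuous; apply/derivable1_diffP. Qed.

Lemma near_pospow b (t : R) : 0 < t -> {near t, (powR (R:=R))^~ b =1 pospow b}.
Proof.
move=> t0; have : \forall s \near t, 0 < s by exact: lt_nbhsr.
by apply: filterS => s s0; rewrite pospowE// ltW.
Qed.

Lemma continuous_pospow b : 0 < b -> continuous (pospow b).
Proof.
move=> b0 t; have bn : b != 0 by rewrite gt_eqF.
case: (ltgtP 0 t) => [t0|t0|<-].
- apply: near_continuous (near_pospow b t0) _.
  by apply: is_derive_cont; exact: is_derive1_powR.
- have : {for t, continuous (cst (0 : R) : R -> R)} by exact: cst_continuous.
  apply: near_continuous; have : \forall s \near t, s < 0 by exact: lt_nbhsl.
  by apply: filterS => s s0; rewrite pospow0// ltW.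
- apply/cvgrPdist_le => e e0; rewrite (pospow0 bn (lexx 0)).
  have d0 : 0 < e `^ b^-1 by rewrite powR_gt0.
  have : \forall s \near (0 : R), s < e `^ b^-1 by exact: lt_nbhsl.
  apply: filterS => s se; rewrite sub0r normrN ger0_norm ?pospow_ge0//.
  case: (leP s 0) => s0; first by rewrite pospow0// ltW.
  rewrite (pospowE _ (ltW s0)).
  have -> : e = (e `^ b^-1) `^ b by rewrite -powRrM mulVf// powRr1// ltW.
  by apply: ge0_ler_powR; rewrite ?nnegrE ltW.
Qed.

Lemma is_derive_pospow b (t : R) : 1 < b ->
  is_derive t 1 (pospow b) (b * pospow (b - 1) t).
Proof.
move=> b1; have b0 : 0 < b by lra.
have bn : b != 0 by rewrite gt_eqF.
have b10 : 0 < b - 1 by lra.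
have b1n : b - 1 != 0 by rewrite gt_eqF.
case: (ltgtP 0 t) => [t0|t0|<-].
- rewrite pospowE ?ltW//; apply: near_eq_is_derive (near_pospow b t0) _.
  exact: is_derive1_powR.
- rewrite pospow0 ?ltW// mulr0.
  have := is_derive_cst (0 : R) t (1 : R); apply: near_eq_is_derive.
  have : \forall s \near t, s < 0 by exact: lt_nbhsl.
  by apply: filterS => s s0; rewrite pospow0// ltW.
- rewrite (pospow0 b1n (lexx 0)) mulr0.
  apply: (is_derive_squeeze (w := fun h => pospow (b - 1) `|h|)).
    move=> h; rewrite add0r (pospow0 bn (lexx 0)) mul0r !subr0.
    rewrite ger0_norm ?pospow_ge0//.
    case: (leP h 0) => h0; first by rewrite pospow0// mulr_ge0// pospow_ge0.
    have h0' := ltW h0.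
    by rewrite ger0_norm// !pospowE// mulr_powRB1.
  have c0 : {for (0 : R), continuous (fun h : R => pospow (b - 1) `|h|)}.
    by apply: (continuous_comp (g := pospow (b - 1)));
      [exact: norm_continuous|exact: continuous_pospow].
  have E : pospow (b - 1) `|0 : R| = 0 by rewrite normr0 pospow0.
  by move: c0; rewrite /prop_for /continuous_at E.
Qed.

Lemma pospow_le b s t : 0 <= b -> s <= t -> pospow b s <= pospow b t.
Proof.
move=> b0 st; rewrite /pospow; apply: ge0_ler_powR => //.
- by rewrite nnegrE le_max lexx orbT.
- by rewrite nnegrE le_max lexx orbT.
- by rewrite ge_max !le_max st lexx orbT.
Qed.

Lemma pospowM b c t : c != 0 -> pospow b t `^ c = pospow (b * c) t.
Proof. by move=> c0; rewrite /pospow powRrM. Qed.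

Lemma pospowD b c t : b + c != 0 -> pospow b t * pospow c t = pospow (b + c) t.
Proof.
move=> bc; case: (ltP 0 t) => t0; first by rewrite /pospow max_l ?(ltW t0)// powRD// (negbTE bc).
rewrite /pospow max_r//.
case: (eqVneq b 0) => [b0|bn]; case: (eqVneq c 0) => [c0|cn].
- by move: bc; rewrite b0 c0 addr0 eqxx.
- by rewrite (powR0 cn) mulr0 powR0.
- by rewrite (powR0 bn) mul0r powR0.
- by rewrite (powR0 bn) mul0r powR0.
Qed.

End positive_part_power.

Section antiderivative.
Context (R : realType).

Lemma antiderivative_from (f : R -> R) (T : R) : continuous f ->
  (forall x, x <= T -> f x = 0) ->
  exists2 F : R -> R, (forall x : R, is_derive x 1 F (f x)) & forall x, x <= T -> F x = 0.
Proof.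
move=> cf f0.
(* The integral starts at T - 1 so that every x >= T is interior to an interval on which the
   fundamental theorem applies; f is zero on the additional piece. *)
pose F (x : R) := (\int[@lebesgue_measure R]_(t in `[(T - 1), x]) f t)%R.
have F0 x : x <= T -> F x = 0.
  move=> xT; rewrite /F /Rintegral.
  have -> : (\int[@lebesgue_measure R]_(t in `[(T - 1)%R, x]) (f t)%:E = 0)%E.
    apply: integral0_eq => t /=; rewrite in_itv /= => /andP[_ tx].
    by rewrite f0//; exact: le_trans tx xT.
  by [].
exists F => // x; case: (ltP x T) => xT.
  rewrite f0 ?ltW//; have := is_derive_cst (0 : R) x (1 : R); apply: near_eq_is_derive.
  have : \forall s \near x, s < T by exact: lt_nbhsl.
  by apply: filterS => s s0; rewrite F0// ltW.
have xx : x < x + 1 by lra.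
have int : lebesgue_measure.-integrable `[(T - 1), (x + 1)] (EFin \o f).
  apply: continuous_compact_integrable; first exact: segment_compact.
  exact: continuous_subspaceT.
have Tx : T - 1 < x by lra.
have [D E] := continuous_FTC1_closed xx int Tx (cf x).
exact: (DeriveDef D (etrans (esym (derive1E _ _)) E)).
Qed.

Lemma is_derive_ge0_le (f df : R -> R) (a b : R) : a <= b ->
  (forall x : R, is_derive x 1 f (df x)) -> (forall x, a <= x <= b -> 0 <= df x) ->
  f a <= f b.
Proof.
move=> ab Df df0.
have [c /[!in_itv]/= cab E] := MVT_segment ab (fun t _ => Df t)
  (continuous_subspaceT (fun t => is_derive_cont (Df t))).
by rewrite -subr_ge0 E mulr_ge0 ?df0// subr_ge0.
Qed.

Lemma is_derive_gt0_lt (f df : R -> R) (a b : R) : a < b ->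
  (forall x : R, is_derive x 1 f (df x)) -> (forall x, a < x < b -> 0 < df x) ->
  f a < f b.
Proof.
move=> ab Df df0.
have [c /[!in_itv]/= cab E] := MVT ab (fun t _ => Df t)
  (continuous_subspaceT (fun t => is_derive_cont (Df t))).
by rewrite -subr_gt0 E mulr_gt0 ?df0// subr_gt0.
Qed.

End antiderivative.

Section khasminskii.
Context (R : realType) (S : R -> R) (p T : R).
Hypotheses (p1 : 1 < p) (cS : continuous S) (S0 : forall s, T <= s -> 0 < S s).

(** A source that starts continuously from 0 at T, so that the flux W is C^1 while v vanishes up to
    T. The bound 1 lets kap dominate the source in the barrier, and the value 1 beyond T + 1 serves
    the truncations. *)
Definition ramp (s : R) : R := Num.min 1 (Num.max (s - T) 0).

Lemma continuous_ramp : continuous ramp.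
Proof.
move=> s; apply: (@continuous_min R R (cst 1) (fun s => Num.max (s - T) 0)).
  exact: cst_continuous.
apply: (@continuous_max R R (fun s => s - T) (cst 0)); last exact: cst_continuous.
by apply: continuousB; [exact: cvg_id|exact: cst_continuous].
Qed.

Lemma ramp_ge0 s : 0 <= ramp s.
Proof. by rewrite /ramp le_min ler01 le_max lexx orbT. Qed.

Lemma ramp_le1 s : ramp s <= 1.
Proof. by rewrite /ramp ge_min lexx. Qed.

Lemma ramp0 s : s <= T -> ramp s = 0.
Proof. by move=> sT; rewrite /ramp max_r ?subr_le0// min_r. Qed.

Lemma ramp_gt0 s : T < s -> 0 < ramp s.
Proof. by move=> sT; rewrite /ramp lt_min ltr01 lt_max subr_gt0 sT. Qed.

Lemma ramp1 s : T + 1 <= s -> ramp s = 1.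
Proof.
move=> sT; have a : 0 <= s - T by lra.
have b : 1 <= s - T by lra.
by rewrite /ramp max_l// min_l.
Qed.

(* On [T, +oo[ the radial function v satisfies (S |v'|^(p-2) v')' = S ramp. *)
Lemma khasminskii_function : exists W v z : R -> R,
  [/\ forall s : R, is_derive s 1 W (S s * ramp s),
      forall s : R, is_derive s 1 v (z s), continuous z,
      forall s, s <= T -> [/\ W s = 0, v s = 0 & z s = 0] &
      forall s, T <= s -> [/\ 0 <= z s, z s `^ (p - 1) * S s = W s & (T < s -> 0 < z s)]].
Proof.
have p10 : 0 < p - 1 by rewrite subr_gt0.
have pi0 : 0 < (p - 1)^-1 by rewrite invr_gt0.
have pin : (p - 1)^-1 != 0 by rewrite gt_eqF.
have cSk : continuous (fun s => S s * ramp s).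
  by move=> s; apply: continuousM; [exact: cS|exact: continuous_ramp].
have [W DW W0] := antiderivative_from cSk (fun s sT =>
  etrans (congr1 (fun y => S s * y) (ramp0 sT)) (mulr0 _)).
have cW s : {for s, continuous W} by exact: is_derive_cont (DW s).
(* S is known to be positive only from T on, whence the maximum; for s <= T the numerator W s is
   zero anyway. *)
pose z s := pospow (p - 1)^-1 (W s / S (Num.max s T)).
have SmT s : 0 < S (Num.max s T) by apply: S0; rewrite le_max lexx orbT.
have cz : continuous z.
  move=> s; apply: (continuous_comp (f := fun s => W s / S (Num.max s T))
    (g := pospow (p - 1)^-1)); last exact: continuous_pospow.
  apply: continuousM; first exact: cW.
  apply: continuousV; first by rewrite gt_eqF.
  apply: (continuous_comp (f := fun s => Num.max s T) (g := S)); last exact: cS.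
  by apply: (@continuous_max R R id (cst T)); [exact: cvg_id|exact: cst_continuous].
have z0 s : s <= T -> z s = 0.
  by move=> sT; rewrite /z W0// mul0r pospow0.
have W_ge0 s : T <= s -> 0 <= W s.
  move=> Ts; rewrite -(W0 _ (lexx T)); apply: (is_derive_ge0_le Ts DW) => x /andP[Tx _].
  by rewrite mulr_ge0 ?ramp_ge0// ltW// S0.
have W_gt0 s : T < s -> 0 < W s.
  move=> Ts; rewrite -(W0 _ (lexx T)); apply: (is_derive_gt0_lt Ts DW) => x /andP[Tx _].
  by rewrite mulr_gt0 ?ramp_gt0// S0// ltW.
have [v Dv v0] := antiderivative_from cz z0.
exists W, v, z; split => // s sT; first by split; [exact: W0|exact: v0|exact: z0].
have Ss : S (Num.max s T) = S s by rewrite max_l.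
split; first exact: pospow_ge0.
  rewrite /z Ss pospowM ?gt_eqF// mulVf ?gt_eqF// pospowE; last first.
    by rewrite divr_ge0 ?W_ge0// ltW// S0.
  rewrite powRr1; last by rewrite divr_ge0 ?W_ge0// ltW// S0.
  by rewrite divfK// gt_eqF// S0.
move=> Ts; rewrite /z Ss; apply: pospow_gt0; rewrite divr_gt0 ?W_gt0//; exact: S0.
Qed.

End khasminskii.

(** * Stochastic completeness *)

Section test_functions.
Context (R : realType) (m : nat).
Implicit Types (phi : 'rV[R]_m -> R) (D : set 'rV[R]_m).

Lemma test_function_has_grad D phi : test_function D phi ->
  has_grad setT phi (fun i => partial i phi).
Proof. by move=> [/(_ 1%N) H _ _]; exact: Cn_has_grad. Qed.

Lemma test_function_support D phi : test_function D phi ->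
  exists L, forall x, L < `|x| -> phi x = 0.
Proof.
move=> [_ cK _]; have [M [_ HM]] := compact_bounded cK.
exists (M + 1) => x Mx; apply/eqP; apply: contraTT Mx => px; rewrite -leNgt.
by apply: (HM (M + 1)); [rewrite ltrDl|exact: subset_closure].
Qed.

Lemma test_function_sub D E phi : D `<=` E -> test_function D phi -> test_function E phi.
Proof. by move=> DE [? ? sD]; split => //; exact: subset_trans sD DE. Qed.

Lemma continuous_measurableT (f : 'rV[R]_m -> R) : continuous f ->
  measurable_fun setT (f : 'rV[R]_m -> measurableTypeR R).
Proof. by move=> cf; apply: continuous_measurable_rV => [|x _]; [exact: openT|exact: cf]. Qed.

Lemma continuous_integrable (f : 'rV[R]_m -> R) L : continuous f ->
  (forall x, L < `|x| -> f x = 0) -> (lebesgue_rV R m).-integrable setT (EFin \o f).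
Proof.
move=> cf f0; have [C _ HC] := continuous_support_bounded cf f0.
by apply: (@integrable_rV _ _ _ f C L) => // [|x _];
  [exact: continuous_measurableT|exact: f0].
Qed.

Lemma continuous_integral_compact (f : 'rV[R]_m -> R) K : continuous f -> compact K ->
  (\int[lebesgue_rV R m]_(x in K) (f x)%:E < +oo)%E.
Proof.
move=> cf cK.
have [C HC] := continuous_bounded_compact cK (continuous_subspaceT cf).
have [M [_ HM]] := compact_bounded cK.
have mK : measurable K by exact: compact_measurable_rV.
have : (lebesgue_rV R m).-integrable K (EFin \o f).
  apply: (@integrable_rV _ _ _ f C (M + 1)) => //.
    exact: (measurable_funS measurableT (@subsetT _ K) (continuous_measurableT cf)).
  move=> x Kx; have : `|x| <= M + 1 by apply: (HM (M + 1)); [rewrite ltrDl|].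
  by move=> ? ?; lra.
move=> /(integrable_fin_num mK); rewrite fin_numElt => /andP[_]; exact.
Qed.

Lemma dfunE (f : 'rV[R]_m -> R) (g : 'I_m -> 'rV[R]_m -> R) D x :
  has_grad D f g -> D x -> dfun f x = \row_i g i x.
Proof.
by move=> H Dx; apply/rowP => i; rewrite !mxE; apply: has_grad_partial H Dx.
Qed.

Lemma weak_diff_C1 (f : 'rV[R]_m -> R) (g : 'I_m -> 'rV[R]_m -> R) :
  has_grad setT f g -> weak_diff f (dfun f).
Proof.
move=> Hf i phi tphi.
have Hphi := test_function_has_grad tphi.
have [L HL] := test_function_support tphi.
have cf : continuous f by move=> x; case: (Hf x I).
have cg j : continuous (g j) by move=> x; case: (Hf x I) => _ /(_ j)[].
have cphi : continuous phi by move=> x; case: (Hphi x I).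
have cdphi j : continuous (partial j phi) by move=> x; case: (Hphi x I) => _ /(_ j)[].
have L1 x : L + 1 <= `|x| -> phi x = 0 by move=> ?; apply: HL; lra.
have dphi0 x : L + 1 < `|x| -> partial i phi x = 0.
  by apply: (is_derive_far0 (fun x => ((Hphi x I).2 i).1) L1).
have L1' x : L + 1 < `|x| -> phi x = 0 by move=> ?; apply: L1; lra.
have i1 : (lebesgue_rV R m).-integrable setT (EFin \o (fun x => f x * partial i phi x)).
  apply: (@continuous_integrable _ (L + 1)) => [x|x /dphi0 ->]; last by rewrite mulr0.
  by apply: continuousM; [exact: cf|exact: cdphi].
have i2 : (lebesgue_rV R m).-integrable setT (EFin \o (fun x => g i x * phi x)).
  apply: (@continuous_integrable _ (L + 1)) => [x|x /L1' ->]; last by rewrite mulr0.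
  by apply: continuousM; [exact: cg|exact: cphi].
have I0 : (\int[lebesgue_rV R m]_x (g i x * phi x + f x * partial i phi x)%:E = 0)%E.
  apply: (integral_partial0 (i := i) (f := fun x => f x * phi x) (L := L + 1)).
  - by move=> x; exact: (((has_gradM Hf Hphi) x I).2 i).1.
  - by move=> x; exact: (((has_gradM Hf Hphi) x I).2 i).2.
  - by move=> x /L1 ->; rewrite mulr0.
have E2 : (\int[lebesgue_rV R m]_x (dfun f x ord0 i * phi x)%:E =
    \int[lebesgue_rV R m]_x (g i x * phi x)%:E)%E.
  by apply: eq_integral => x _; rewrite (dfunE Hf (I : setT x)) mxE.
rewrite E2; move: I0; under eq_integral do rewrite EFinD.
rewrite integralD//=.
have f1 := integrable_fin_num measurableT i1.
have f2 := integrable_fin_num measurableT i2.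
move: f1 f2; rewrite /comp => f1 f2; rewrite -(fineK f1) -(fineK f2) -EFinD -EFinN => -[H].
by congr (_%:E); lra.
Qed.

End test_functions.

(** * Subsolutions obtained by truncating the radial solution *)

Section model.
Context (R : realType) (m : nat) (sigma : R -> R) (p : R).
Hypotheses (m0 : (0 < m)%N) (p1 : 1 < p) (Hsigma : warping_function sigma).
Local Notation r := (@polar_radius R m).

Lemma warping_smooth : exists tau dtau : R -> R,
  [/\ forall t : R, is_derive t 1 tau (dtau t), continuous tau, continuous dtau,
      forall t, 0 <= t -> sigma t = tau t & forall t, 0 < t -> derive1 sigma t = dtau t].
Proof.
have [_ _ [tau [Htau E _ _]]] := Hsigma.
have D0 (t : R) : is_derive t 1 tau (derive1 tau t).
  by apply: DeriveDef; [exact: (Htau 0%N)|rewrite derive1E].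
exists tau, (derive1 tau); split => //.
- by move=> t; exact: is_derive_cont (D0 t).
- move=> t; have := Htau 1%N t; rewrite derive1n1 => D.
  by apply: differentiable_continuous; apply/derivable1_diffP.
- move=> t t0; rewrite !derive1E; apply: near_eq_derive.
  have : \forall s \near t, 0 < s by exact: lt_nbhsr.
  by apply: filterS => s s0; rewrite E// ltW.
Qed.

Lemma warping_gt0 t : 0 < t -> 0 < sigma t.
Proof. by case: Hsigma => _ + _; exact. Qed.

Lemma plap_integrand x (xi eta : 'rV[R]_m) : x != 0 ->
  (let X := sharp sigma x xi in
   inner sigma x (riem_norm sigma x X `^ (p - 2) *: X) (sharp sigma x eta)) *
   vol_density sigma x =
  dual_norm sigma x xi `^ (p - 2) * dual sigma x xi eta * (sigma (r x) / r x) ^+ m.-1.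
Proof.
move=> x0; have s0 : 0 < sigma (r x) by apply: warping_gt0; rewrite radius_neq0.
by rewrite /= inner_sharp// riem_norm_sharp// vol_densityE.
Qed.

Lemma plap_integrand0 x (eta : 'rV[R]_m) :
  (let X := sharp sigma x 0 in
   inner sigma x (riem_norm sigma x X `^ (p - 2) *: X) (sharp sigma x eta)) *
   vol_density sigma x = 0.
Proof. by rewrite /= /sharp mul0mx scaler0 /inner !mul0mx mxE mul0r. Qed.

(* The flux of a radial function with derivative d through the sphere of radius
   rho is [signed_power d * sigma rho ^+ m.-1]. *)
Definition signed_power (d : R) : R := `|d| `^ (p - 2) * d.

Lemma signed_power_ge0 d : 0 <= d -> signed_power d = d `^ (p - 1).
Proof. by move=> d0; rewrite /signed_power ger0_norm// powR_sub2. Qed.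

Lemma signed_power_le0 d : d <= 0 -> signed_power d = - (- d) `^ (p - 1).
Proof.
move=> d0; have nd0 : 0 <= - d by rewrite oppr_ge0.
by rewrite /signed_power ler0_norm// -(powR_sub2 p1 nd0) mulrN opprK.
Qed.

Lemma radial_plap_integrand x (d : R) (eta : 'rV[R]_m) : x != 0 ->
  dual_norm sigma x (d / r x *: x) `^ (p - 2) * dual sigma x (d / r x *: x) eta
    * (sigma (r x) / r x) ^+ m.-1 =
  \sum_i eta ord0 i * (signed_power d * sigma (r x) ^+ m.-1 / r x ^+ m * x ord0 i).
Proof.
move=> x0; have rx : 0 < r x by rewrite radius_neq0.
have rn : r x != 0 by rewrite gt_eqF.
have s0 : 0 < sigma (r x) by exact: warping_gt0.
rewrite dual_norm_radial// dual_radial// normrM normfV [`|r x|]ger0_norm ?(ltW rx)//.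
rewrite divfK// expr_div_n.
have -> : r x ^+ m = r x ^+ m.-1 * r x by rewrite -exprSr prednK.
rewrite /dot; under [RHS]eq_bigr do rewrite mulrCA.
rewrite -mulr_sumr.
have -> : \sum_i eta ord0 i * x ord0 i = \sum_i x ord0 i * eta ord0 i.
  by apply: eq_bigr => i _; rewrite mulrC.
rewrite /signed_power; field.
by rewrite rn expf_neq0.
Qed.

Lemma radial_dfun (Phi dPhi : R -> R) (a : R) x : 0 <= a ->
  (forall rho : R, a < rho -> is_derive rho 1 Phi (dPhi rho) /\ {for rho, continuous dPhi}) ->
  a < r x -> dfun (fun x => Phi (r x)) x = dPhi (r x) / r x *: x.
Proof.
move=> a0 H ax; rewrite (dfunE (has_grad_radial a0 H) ax); apply/rowP => i.
by rewrite !mxE mulrA mulrAC.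
Qed.

Variables (T : R) (tau : R -> R) (W v z : R -> R).
Hypotheses (T0 : 0 < T) (ctau : continuous tau)
  (tauE : forall t, 0 <= t -> sigma t = tau t).
Let S s := tau s ^+ m.-1.
Hypotheses
  (DW : forall s : R, is_derive s 1 W (S s * ramp T s))
  (Dv : forall s : R, is_derive s 1 v (z s)) (cz : continuous z)
  (low : forall s, s <= T -> [/\ W s = 0, v s = 0 & z s = 0])
  (high : forall s, T <= s -> [/\ 0 <= z s, z s `^ (p - 1) * S s = W s & (T < s -> 0 < z s)]).

Let z_ge0 s : 0 <= z s.
Proof. by case: (leP s T) => [/low[_ _ ->]//|/ltW/high[]]. Qed.

Let v_le s t : s <= t -> v s <= v t.
Proof. by move=> st; apply: (is_derive_ge0_le st Dv) => x _; exact: z_ge0. Qed.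

Let W_ge0 s : 0 <= W s.
Proof.
case: (leP s T) => [/low[->]//|Ts]; have [_ <- _] := high (ltW Ts).
by rewrite mulr_ge0 ?powR_ge0// exprn_ge0// -tauE ?ltW// ?warping_gt0//; exact: lt_trans Ts.
Qed.

Let p10 : 0 < p - 1. Proof. by rewrite subr_gt0. Qed.

Section truncation.
Variables (c lambda : R).
Hypotheses (l0 : 0 < lambda) (cT : v (T + 1) <= c)
  (cl : forall s, lambda * pospow (p - 1) (v s - c) <= 1).

(* With this exponent the flux of ((v - c)_+)^(a + 1) is C^1. *)
Let a := 2 / (p - 1).
Let a0 : 0 < a. Proof. by rewrite divr_gt0. Qed.
Let a1 : 1 < a + 1. Proof. by rewrite ltrDr. Qed.
Let an : a != 0. Proof. by rewrite gt_eqF. Qed.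
Let U s := pospow (a + 1) (v s - c).
Let dU s := (a + 1) * pospow a (v s - c) * z s.
Let Y s := (a + 1) `^ (p - 1) * (pospow 2 (v s - c) * W s).
Let dY s := (a + 1) `^ (p - 1) *
  (pospow 2 (v s - c) * (S s * ramp T s) + W s * (2 * pospow 1 (v s - c) * z s)).

Let small s : s <= T + 1 -> v s - c <= 0.
Proof. by move=> sT; rewrite subr_le0 (le_trans (v_le sT)). Qed.

Let Dvc (s : R) : is_derive s 1 (fun s => v s - c) (z s).
Proof.
apply: (is_derive_rw (is_deriveB (Dv s) (is_derive_cst c s (1 : R)))).
by rewrite subr0.
Qed.

Let cvc : continuous (fun s : R => v s - c).
Proof. by move=> s; exact: is_derive_cont (Dvc s). Qed.

Let cpos b : 0 < b -> continuous (fun s => pospow b (v s - c)).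
Proof.
move=> b0 s; apply: (continuous_comp (f := fun s => v s - c) (g := pospow b)).
  exact: cvc.
exact: continuous_pospow.
Qed.

Let DU (s : R) : is_derive s 1 U (dU s).
Proof.
have := is_derive1_comp (f := pospow (a + 1)) (is_derive_pospow _ a1) (Dvc s).
by rewrite /dU addrK.
Qed.

Let cdU : continuous dU.
Proof.
move=> s; apply: (@continuousM _ _ (fun s => (a + 1) * pospow a (v s - c))); last exact: cz.
by apply: (@continuousM _ _ (cst (a + 1))); [exact: cst_continuous|exact: cpos].
Qed.

Let DY (s : R) : is_derive s 1 Y (dY s).
Proof.
have D2 : is_derive s 1 (fun s => pospow 2 (v s - c)) (2 * pospow 1 (v s - c) * z s).
  have := is_derive1_comp (f := pospow 2) (is_derive_pospow _ (ltr1n _ 2)) (Dvc s).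
  by have -> : 2 - 1 = 1 :> R by ring.
exact: (is_deriveZ ((a + 1) `^ (p - 1)) (is_deriveM D2 (DW s))).
Qed.

Let cW : continuous W. Proof. by move=> s; exact: is_derive_cont (DW s). Qed.

Let cdY : continuous dY.
Proof.
have c0 : continuous (fun s => S s * ramp T s).
  move=> s; apply: (@continuousM _ _ S); last exact: continuous_ramp.
  apply: (continuous_comp (f := tau) (g := fun s => s ^+ m.-1)); first exact: ctau.
  exact: exprn_continuous.
have c1 : continuous (fun s => pospow 2 (v s - c) * (S s * ramp T s)).
  move=> s; apply: (@continuousM _ _ (fun s => pospow 2 (v s - c)) (fun s => S s * ramp T s)).
    exact: cpos.
  exact: c0.
have c2 : continuous (fun s => W s * (2 * pospow 1 (v s - c) * z s)).
  move=> s; apply: (@continuousM _ _ W (fun s => 2 * pospow 1 (v s - c) * z s)).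
    exact: cW.
  apply: (@continuousM _ _ (fun s => 2 * pospow 1 (v s - c)) z); last exact: cz.
  by apply: (@continuousM _ _ (cst 2)); [exact: cst_continuous|exact: cpos].
move=> s; apply: (@continuousM _ _ (cst ((a + 1) `^ (p - 1))) (fun s =>
  pospow 2 (v s - c) * (S s * ramp T s) + W s * (2 * pospow 1 (v s - c) * z s))).
  exact: cst_continuous.
apply: (@continuousD _ _ _ (fun s => pospow 2 (v s - c) * (S s * ramp T s))).
  exact: c1.
exact: c2.
Qed.

Let U0 s : s <= T + 1 -> U s = 0.
Proof. by move=> /small s0; rewrite /U pospow0// gt_eqF// (lt_trans ltr01). Qed.
Let dU0 s : s <= T + 1 -> dU s = 0.
Proof. by move=> /small s0; rewrite /dU pospow0// mulr0 mul0r. Qed.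
Let Y0 s : s <= T + 1 -> Y s = 0.
Proof. by move=> /small s0; rewrite /Y pospow0// mul0r mulr0. Qed.
Let dY0 s : s <= T + 1 -> dY s = 0.
Proof. by move=> /small s0; rewrite /dY !pospow0// mulr0 !mul0r mulr0 addr0 mulr0. Qed.

Let dU_ge0 s : 0 <= dU s.
Proof. by rewrite !mulr_ge0 ?pospow_ge0// ltW// (lt_trans ltr01). Qed.

Let flux s : 0 < s -> signed_power (dU s) * sigma s ^+ m.-1 = Y s.
Proof.
move=> s0; case: (leP s (T + 1)) => sT.
  by rewrite dU0// Y0// /signed_power mulr0 mul0r.
have Ts : T <= s by lra.
have [zs zS _] := high Ts.
rewrite signed_power_ge0// /dU powRM ?mulr_ge0 ?pospow_ge0//; last first.
  by rewrite ltW// (lt_trans ltr01).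
rewrite powRM ?pospow_ge0//; last by rewrite ltW// (lt_trans ltr01).
rewrite pospowM ?gt_eqF// /a divfK ?gt_eqF//.
by rewrite tauE ?(ltW s0)// -mulrA -[z s `^ _ * _]/(z s `^ (p - 1) * S s) zS /Y mulrA.
Qed.

(** U^(p-1) is (v - c)_+ to the power (p - 1) + 2. The hypothesis [cl] absorbs lambda and the power
    p - 1, and the remaining (v - c)_+^2 S is at most dY, because [ramp] is 1 wherever v > c. *)
Let source s : 0 < s -> lambda * U s `^ (p - 1) * S s <= dY s.
Proof.
move=> s0; case: (leP s (T + 1)) => sT.
  by rewrite U0// dY0// powR0 ?gt_eqF// mulr0 mul0r.
have Ts : T <= s by lra.
have S_ge0 : 0 <= S s by rewrite exprn_ge0// -tauE ?(ltW s0)// ltW// warping_gt0.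
have H1 : pospow 2 (v s - c) * S s <= dY s.
  rewrite /dY ramp1 ?(ltW sT)// mulr1.
  have A1 : 1 <= (a + 1) `^ (p - 1).
    by have := ler_powR (ltW a1) (ltW p10); rewrite powRr0.
  have B0 : 0 <= W s * (2 * pospow 1 (v s - c) * z s).
    by rewrite !mulr_ge0 ?pospow_ge0.
  have C0 : 0 <= pospow 2 (v s - c) * S s by rewrite mulr_ge0// pospow_ge0.
  apply: (@le_trans _ _ ((a + 1) `^ (p - 1) * (pospow 2 (v s - c) * S s))).
    by rewrite ler_peMl.
  by rewrite ler_wpM2l ?powR_ge0// lerDl.
apply: le_trans H1; rewrite ler_wpM2r//.
rewrite /U pospowM ?gt_eqF//.
have -> : (a + 1) * (p - 1) = (p - 1) + 2.
  by rewrite mulrDl mul1r /a divfK ?gt_eqF// addrC.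
rewrite -pospowD; last by rewrite gt_eqF// addr_gt0.
rewrite mulrA ler_piMl ?pospow_ge0//; exact: cl.
Qed.

Let u x := U (r x).
Let gu (i : 'I_m) x := dU (r x) * (x ord0 i / r x).

Let Hu : has_grad setT u gu.
Proof.
have H1 : has_grad [set x | 0 < r x] u gu.
  by apply: (@has_grad_radial _ _ 0 U dU) => // rho _; split; [exact: DU|exact: cdU].
have H2 : has_grad [set x | r x < T] u gu.
  apply: (@has_grad_eq _ _ _ (fun=> 0) _ (fun _ _ => 0) _ (@open_radius_lt R m T)); last exact: has_grad_cst.
    by move=> x /= xT; rewrite /u U0//; lra.
  by move=> x i /= xT; rewrite /gu dU0 ?mul0r//; lra.
apply: has_grad_sub (has_gradU H1 H2) => x _ /=.
by case: (ltP (r x) T) => [|H]; [right|left; exact: lt_le_trans H].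
Qed.

Let dfu x : 0 < r x -> dfun u x = dU (r x) / r x *: x.
Proof.
by move=> rx; apply: (@radial_dfun U dU 0) => // rho _; split; [exact: DU|exact: cdU].
Qed.

Let dfu0 x : r x <= T -> dfun u x = 0.
Proof.
move=> xT; rewrite (dfunE Hu (I : setT x)); apply/rowP => i; rewrite !mxE /gu dU0 ?mul0r//; lra.
Qed.

(** A continuous function on the whole space that agrees with the volume density for r > T, where
    the truncation is supported; it replaces the density in measurability and integrability
    arguments. *)
Let omega x := (tau (Num.max (r x) T) / Num.max (r x) T) ^+ m.-1.

Let comega : continuous omega.
Proof.
have cm : continuous (fun x : 'rV[R]_m => Num.max (r x) T).
  move=> x; apply: (@continuous_max _ _ r (cst T)); first exact: continuous_radius.
  exact: cst_continuous.
have mT x : Num.max (r x) T != 0 by rewrite gt_eqF// lt_max T0 orbT.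
move=> x; apply: (continuous_comp (f := fun x => tau (Num.max (r x) T) / Num.max (r x) T)
  (g := fun s : R => s ^+ m.-1)); last exact: exprn_continuous.
apply: continuousM; last by apply: continuousV; [exact: mT|exact: cm].
by apply: (continuous_comp (f := fun x => Num.max (r x) T) (g := tau)); [exact: cm|exact: ctau].
Qed.

Let vol_omega x : T < r x -> vol_density sigma x = omega x.
Proof.
move=> Tx; have rx : 0 < r x by exact: lt_trans Tx.
rewrite vol_densityE; [|by rewrite -radius_neq0|exact: warping_gt0].
by rewrite /omega max_l ?(ltW Tx)// tauE ?ltW.
Qed.

Let p0 : 0 < p. Proof. exact: lt_trans p1. Qed.

Let W1p : W1p_loc sigma p u (dfun u).
Proof.
have cu : continuous u by move=> x; case: (Hu (I : setT x)).
split.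
- exact: continuous_measurableT.
- apply: measurable_fun_rV => i.
  have E : (fun x => dfun u x ord0 i) = gu i.
    by apply/funext => x; rewrite (dfunE Hu (I : setT x)) mxE.
  rewrite E; apply: continuous_measurableT => x.
  by case: (Hu (I : setT x)) => _ /(_ i)[].
- exact: weak_diff_C1 Hu.
- move=> K cK; split.
    rewrite /int_vol.
    have -> : (\int[lebesgue_rV R m]_(x in K) (`|u x| `^ p * vol_density sigma x)%:E =
      \int[lebesgue_rV R m]_(x in K) (pospow ((a + 1) * p) (v (r x) - c) * omega x)%:E)%E.
      apply: eq_integral => x _; congr (_%:E).
      rewrite ger0_norm ?pospow_ge0// /u /U pospowM ?gt_eqF//.
      case: (ltP T (r x)) => Tx; first by rewrite vol_omega.
      rewrite pospow0 ?mul0r//; last by apply: small; lra.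
      by rewrite gt_eqF// mulr_gt0// (lt_trans ltr01).
    apply: continuous_integral_compact cK => x.
    apply: (@continuousM _ _ (fun x => pospow ((a + 1) * p) (v (r x) - c)) omega); last exact: comega.
    apply: (continuous_comp (f := r) (g := fun s => pospow ((a + 1) * p) (v s - c))).
      exact: continuous_radius.
    by apply: cpos; rewrite mulr_gt0// (lt_trans ltr01).
  rewrite /int_vol.
  have -> : (\int[lebesgue_rV R m]_(x in K)
      (riem_norm sigma x (sharp sigma x (dfun u x)) `^ p * vol_density sigma x)%:E =
    \int[lebesgue_rV R m]_(x in K) (pospow p (dU (r x)) * omega x)%:E)%E.
    apply: eq_integral => x _; congr (_%:E).
    case: (ltP T (r x)) => Tx.
      have rx : 0 < r x by exact: lt_trans Tx.
      have x0 : x != 0 by rewrite -radius_neq0.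
      have s0 : 0 < sigma (r x) by exact: warping_gt0.
      rewrite vol_omega// dfu// riem_norm_sharp// -/(dual_norm sigma x _) dual_norm_radial//.
      rewrite normrM normfV [`|r x|]ger0_norm ?(ltW rx)// divfK ?gt_eqF//.
      by rewrite ger0_norm// pospowE.
    rewrite dfu0// dU0; last lra.
    rewrite pospow0 ?gt_eqF// mul0r /sharp mul0mx /riem_norm /inner !mul0mx mxE sqrtr0.
    by rewrite powR0 ?mul0r// gt_eqF.
  apply: continuous_integral_compact cK => x.
  apply: (@continuousM _ _ (fun x => pospow p (dU (r x))) omega); last exact: comega.
  apply: (continuous_comp (f := fun x => dU (r x)) (g := pospow p)); last exact: continuous_pospow.
  apply: (continuous_comp (f := r) (g := dU)); first exact: continuous_radius.
  exact: cdU.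
Qed.

(** [radial_divergence] rewrites the pairing as the integral of [radial_source], after which the
    inequality holds pointwise by [source]. *)
Let plap : plap_ge sigma p setT (dfun u) (fun x => lambda * u x `^ (p - 1)).
Proof.
move=> phi tphi phi0.
have Hphi := test_function_has_grad tphi.
have [L HL] := test_function_support tphi.
have near_pole x : r x < T ->
    (phi x = 0 /\ forall i, partial i phi x = 0) \/ (Y (r x) = 0 /\ dY (r x) = 0).
  by move=> xT; right; rewrite Y0 ?dY0//; lra.
have HY (rho : R) : 0 < rho -> is_derive rho 1 Y (dY rho) /\ {for rho, continuous dY}.
  by move=> _; split; [exact: DY|exact: cdY].
have [iP iS E] := radial_divergence T0 HY Hphi HL near_pole.
have pairE x : (let X := sharp sigma x (dfun u x) in
   inner sigma x (riem_norm sigma x X `^ (p - 2) *: X) (sharp sigma x (dfun phi x))) *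
   vol_density sigma x = radial_pairing Y (fun i => partial i phi) x.
  case: (ltP T (r x)) => Tx; last first.
    rewrite dfu0// plap_integrand0 /radial_pairing big1// => i _.
    by rewrite Y0 ?mul0r ?mulr0//; lra.
  have rx : 0 < r x by exact: lt_trans Tx.
  have x0 : x != 0 by rewrite -radius_neq0.
  rewrite plap_integrand// dfu// radial_plap_integrand// flux//.
  by apply: eq_bigr => i _; rewrite mxE.
rewrite /plap_pairing /int_vol; under [X in (_ <= - X)%E]eq_integral do rewrite pairE.
rewrite -E.
have F0E x : lambda * u x `^ (p - 1) * phi x * vol_density sigma x =
    lambda * pospow ((a + 1) * (p - 1)) (v (r x) - c) * phi x * omega x.
  rewrite /u /U pospowM ?gt_eqF//.
  case: (ltP T (r x)) => Tx; first by rewrite vol_omega.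
  rewrite pospow0 ?mulr0 ?mul0r//; last by apply: small; lra.
  by rewrite gt_eqF// mulr_gt0// (lt_trans ltr01).
apply: ge0_le_integral => //.
- move=> x _; rewrite lee_fin !mulr_ge0 ?powR_ge0 ?phi0 ?(ltW l0)//; exact: sqrtr_ge0.
- apply/measurable_EFinP.
  under eq_fun do rewrite F0E.
  apply: continuous_measurableT => x.
  apply: (@continuousM _ _ (fun x => lambda * pospow ((a + 1) * (p - 1)) (v (r x) - c) * phi x) omega);
    last exact: comega.
  apply: (@continuousM _ _ (fun x => lambda * pospow ((a + 1) * (p - 1)) (v (r x) - c)) phi);
    last by case: (Hphi x I).
  apply: (@continuousM _ _ (cst lambda) (fun x => pospow ((a + 1) * (p - 1)) (v (r x) - c))).
    exact: cst_continuous.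
  apply: (continuous_comp (f := r) (g := fun s => pospow ((a + 1) * (p - 1)) (v s - c))).
    exact: continuous_radius.
  by apply: cpos; rewrite mulr_gt0// (lt_trans ltr01).
- exact: (measurable_int _ iS).
- move=> x _; rewrite lee_fin.
  case: (ltP T (r x)) => Tx; last first.
    have xT : r x <= T + 1 by lra.
    rewrite /u U0// /radial_source dY0// powR0 ?gt_eqF//.
    by rewrite mulr0 !mul0r mulr0.
  have rx : 0 < r x by exact: lt_trans Tx.
  rewrite vol_omega// /omega max_l ?(ltW Tx)// /radial_source.
  have rn : r x != 0 by rewrite gt_eqF.
  have -> : lambda * u x `^ (p - 1) * phi x * (tau (r x) / r x) ^+ m.-1 =
     lambda * U (r x) `^ (p - 1) * S (r x) * (phi x / r x ^+ m.-1).
    by rewrite expr_div_n /u /S; ring.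
  have -> : phi x * (dY (r x) * r x / r x ^+ m) = dY (r x) * (phi x / r x ^+ m.-1).
    have -> : r x ^+ m = r x ^+ m.-1 * r x by rewrite -exprSr prednK.
    by field; rewrite rn expf_neq0.
  by rewrite ler_wpM2r ?source// divr_ge0// exprn_ge0// ltW.
Qed.

Lemma truncation_le (M : R) : (forall s, v s <= M) ->
  (forall (f : 'rV[R]_m -> R) w, continuous f -> W1p_loc sigma p f w ->
    (forall x, 0 <= f x) -> has_ubound (range f) ->
    plap_ge sigma p setT w (fun x => lambda * f x `^ (p - 1)) -> forall x, f x = 0) ->
  forall s, 0 <= s -> v s <= c.
Proof.
move=> vM H s s0.
(* A point at distance s from the pole, on the first axis; it exists because m > 0. *)
pose x : 'rV[R]_m := s *: delta_mx ord0 (Ordinal m0).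
have rs : r x = s.
  rewrite /polar_radius (bigD1 (Ordinal m0))//= big1 => [|i /negbTE i0].
    by rewrite !mxE eqxx mulr1 addr0 sqrtr_sqr ger0_norm.
  by rewrite !mxE i0 mulr0 expr0n.
have : u x = 0.
  apply: (H u (dfun u)) => //.
  - by move=> y; case: (Hu (I : setT y)).
  - by move=> y; exact: pospow_ge0.
  - exists (pospow (a + 1) (M - c)) => _ [y _ <-].
    apply: pospow_le; first by rewrite ltW// (lt_trans ltr01).
    by rewrite lerD2r.
move=> ux; rewrite leNgt; apply/negP => cs.
have : 0 < u x by rewrite /u rs pospow_gt0// subr_gt0.
by rewrite ux ltxx.
Qed.

End truncation.

Lemma khasminskii_unbounded : p_stochastically_complete m sigma p ->
  forall M, exists2 s, T <= s & M < v s.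
Proof.
move=> [lambda l0 H] M.
apply: contrapT => nM.
have vM s : v s <= M.
  apply: (@le_trans _ _ (v (Num.max s T))); first by rewrite v_le// le_max lexx.
  by rewrite leNgt; apply/negP => H'; apply: nM; exists (Num.max s T) => //;
    rewrite le_max lexx orbT.
pose E := range v.
have supE : has_sup E by split; [exists (v 0); exists 0|exists M => _ [s _ <-]].
have v_sup s : v s <= sup E by apply: sup_upper_bound => //; exists s.
(* The largest gap with lambda delta^(p-1) <= 1. Then c is within delta of the supremum, and still
   strictly below it since v keeps increasing after T + 1; a bound v <= c is therefore absurd. *)
pose delta := lambda^-1 `^ (p - 1)^-1.
have li0 : 0 < lambda^-1 by rewrite invr_gt0.
have d0 : 0 < delta by rewrite powR_gt0.
pose c := Num.max (v (T + 1)) (sup E - delta).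
have cl s : lambda * pospow (p - 1) (v s - c) <= 1.
  apply: (@le_trans _ _ (lambda * pospow (p - 1) delta)); last first.
    rewrite pospowE ?(ltW d0)// /delta -powRrM mulVf ?gt_eqF// powRr1 ?(ltW li0)//.
    by rewrite mulfV// gt_eqF.
  rewrite ler_wpM2l ?(ltW l0)//; apply: pospow_le; first exact: ltW.
  have : sup E - delta <= c by rewrite le_max lexx orbT.
  by have := v_sup s; lra.
have cT : v (T + 1) <= c by rewrite le_max lexx.
have vc := truncation_le l0 cT cl vM H.
have v_lt : v (T + 1) < v (T + 2).
  apply: (is_derive_gt0_lt _ Dv) => [|x /andP[Tx _]]; first by rewrite ltrD2l ltr1n.
  have Tx' : T < x by rewrite (lt_trans _ Tx)// ltrDl.
  by have [_ _ ->] := high (ltW Tx').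
have supc : sup E <= c.
  apply: ge_sup; first by case: supE.
  move=> _ [s _ <-]; apply: (@le_trans _ _ (v (Num.max s 0))).
    by rewrite v_le// le_max lexx.
  by rewrite vc// le_max lexx orbT.
have : c < sup E.
  rewrite gt_max; apply/andP; split; first exact: lt_le_trans v_lt (v_sup _).
  by rewrite ltrBlDr ltrDl.
by rewrite ltNge supc.
Qed.

End model.

(** * Test functions of class C^1 *)

Section annulus_density.
Context (R : realType) (m : nat) (r0 : R).
Hypothesis r00 : 0 < r0.
Local Notation r := (@polar_radius R m).
Local Notation mu := (lebesgue_rV R m).
Let E := [set x : 'rV[R]_m | r0 < r x].

Lemma exterior_measurable : measurable E.
Proof. by apply: open_measurable_rV; exact: open_radius_gt. Qed.

Lemma annulus_exterior a b (x : 'rV[R]_m) : r0 ^+ 2 < a -> a <= sqnorm x <= b -> E x.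
Proof.
move=> r0a /andP[ax _]; rewrite /E /= -(@ltr_pXn2r _ 2)// ?nnegrE ?radius_ge0 ?(ltW r00)//.
by rewrite sqr_radius (lt_le_trans r0a).
Qed.

Lemma annulus_closed (a b : R) : closed [set x : 'rV[R]_m | a <= sqnorm x <= b].
Proof.
rewrite (_ : [set x | _] = (@sqnorm R m) @^-1` `[a, b]%classic); last first.
  by apply/seteqP; split => x /=; rewrite in_itv.
by apply: closed_comp => [x _|]; [exact: continuous_sqnorm|exact: interval_closed].
Qed.

Lemma annulus_bounded (a b : R) (x : 'rV[R]_m) : sqnorm x <= b -> `|x| <= Num.sqrt `|b|.
Proof.
move=> xb; rewrite -[leLHS]ger0_norm// -sqrtr_sqr ler_sqrt// (le_trans (norm_sqnorm x))//.
by rewrite (le_trans xb)// ler_norm.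
Qed.

Lemma annulus_compact (a b : R) : compact [set x : 'rV[R]_m | a <= sqnorm x <= b].
Proof.
apply: (@subclosed_compact _ _ [set x | `|x| <= Num.sqrt `|b|]).
- exact: annulus_closed.
- exact: closed_ball_compact.
- by move=> x /= /andP[_]; exact: annulus_bounded.
Qed.

Variables (A : 'rV[R]_m -> R) (b : 'I_m -> 'rV[R]_m -> R).
Hypotheses (mA : measurable_fun E (A : 'rV[R]_m -> measurableTypeR R))
  (mb : forall i, measurable_fun E (b i : 'rV[R]_m -> measurableTypeR R))
  (Ab_bounded : forall a1 b1, r0 ^+ 2 < a1 -> exists C : R, forall x : 'rV[R]_m,
     a1 <= sqnorm x <= b1 -> `|A x| <= C /\ forall i, `|b i x| <= C).

(** The inequality for u is linear in the test function, so density is a statement about fixed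
    coefficients: A stands for the reaction term and b for the flux. They are bounded only on annuli
    that stay away from the sphere r = r0. *)
Definition weak_form (f : 'rV[R]_m -> R) (g : 'I_m -> 'rV[R]_m -> R) x : R :=
  A x * f x + \sum_i b i x * g i x.

Lemma support_gradient f (g : 'I_m -> 'rV[R]_m -> R) (a1 b1 : R) : has_grad setT f g ->
  (forall x, f x != 0 -> a1 <= sqnorm x <= b1) ->
  forall x, ~~ (a1 <= sqnorm x <= b1) -> f x = 0 /\ forall i, g i x = 0.
Proof.
move=> Hf supp.
have f0 x : ~~ (a1 <= sqnorm x <= b1) -> f x = 0.
  by move=> H; apply/eqP; apply: contraNT H; exact: supp.
move=> x xn; split => [|i]; first exact: f0.
apply: is_derive_unique ((Hf x I).2 i).1 _.
have := is_derive_cst (0 : R) x (delta_mx ord0 i : 'rV[R]_m); apply: near_eq_is_derive.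
have : \forall y \near x, ~~ (a1 <= sqnorm y <= b1).
  have := @annulus_closed a1 b1; rewrite -openC => oK.
  have : \forall y \near x, (~` [set y : 'rV[R]_m | a1 <= sqnorm y <= b1]) y.
    by apply: open_nbhs_nbhs; split => //; exact/negP.
  by apply: filterS => y /= /negP.
by apply: filterS => y /f0 ->.
Qed.

Lemma weak_form_integrable f (g : 'I_m -> 'rV[R]_m -> R) (a1 b1 : R) :
  r0 ^+ 2 < a1 -> has_grad setT f g -> (forall x, f x != 0 -> a1 <= sqnorm x <= b1) ->
  mu.-integrable E (EFin \o weak_form f g).
Proof.
move=> ra Hf supp.
have zero := support_gradient Hf supp.
have [C HC] := Ab_bounded b1 ra.
have cK := @annulus_compact a1 b1.
have cf : continuous f by move=> x; case: (Hf x I).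
have cg i : continuous (g i) by move=> x; case: (Hf x I) => _ /(_ i)[].
have [F HF] := continuous_bounded_compact cK (continuous_subspaceT cf).
have [G HG] : exists G : 'I_m -> R, forall i x, a1 <= sqnorm x <= b1 -> `|g i x| <= G i.
  have /choice[G HG] : forall i, exists G : R, forall x : 'rV[R]_m, a1 <= sqnorm x <= b1 -> `|g i x| <= G.
    by move=> i; exact: (continuous_bounded_compact cK (continuous_subspaceT (cg i))).
  by exists G.
have mf (h : 'rV[R]_m -> R) : continuous h -> measurable_fun E (h : 'rV[R]_m -> measurableTypeR R).
  by move=> ch; exact: (measurable_funS measurableT (@subsetT _ E) (continuous_measurableT ch)).
apply: (@integrable_rV _ _ _ _ (`|C| * `|F| + \sum_i `|C| * `|G i|) (Num.sqrt `|b1|)).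
- exact: exterior_measurable.
- apply: measurable_funD; first by apply: measurable_funM => //; exact: mf.
  by apply: measurable_sum => i; apply: measurable_funM; [exact: mb|exact: (mf _ (cg i))].
- move=> x Ex; case: (boolP (a1 <= sqnorm x <= b1)) => xK; last first.
    have [f0 g0] := zero x xK; rewrite /weak_form f0 mulr0 add0r big1 => [|i _].
      by rewrite normr0 addr_ge0 ?mulr_ge0// sumr_ge0// => i _; rewrite mulr_ge0.
    by rewrite g0 mulr0.
  have [HA Hb] := HC x xK.
  apply: (le_trans (ler_normD _ _)); apply: lerD.
    by rewrite normrM ler_pM// (le_trans _ (ler_norm _))//; exact: HF.
  apply: (le_trans (ler_norm_sum _ _ _)); apply: ler_sum => i _.
  rewrite normrM; apply: ler_pM => //.
    by apply: le_trans (ler_norm _); exact: Hb.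
  by apply: le_trans (ler_norm _); exact: HG.
- move=> x _ xb; have [f0 g0] : f x = 0 /\ forall i, g i x = 0.
    apply: zero; apply: contraL xb => /andP[_ xb]; rewrite -leNgt; exact: annulus_bounded.
  by rewrite /weak_form f0 mulr0 add0r big1// => i _; rewrite g0 mulr0.
Qed.

(** A C^1 function f is within e of a smooth phi, gradients included, on one fixed annulus K. The
    two integrals then differ by at most e |C| (1 + m) times the volume of K, and e is arbitrary. *)
Lemma weak_form_density :
  (forall phi a b0, r0 ^+ 2 < a -> (forall x, phi x != 0 -> a <= sqnorm x <= b0) ->
     test_function E phi -> (forall x, 0 <= phi x) ->
     (\int[mu]_(x in E) (weak_form phi (fun i => partial i phi) x)%:E <= 0)%E) ->
  forall f (g : 'I_m -> 'rV[R]_m -> R) (a1 b1 : R), r0 ^+ 2 < a1 ->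
    has_grad setT f g -> (forall x, f x != 0 -> a1 <= sqnorm x <= b1) ->
    (forall x, 0 <= f x) ->
    (\int[mu]_(x in E) (weak_form f g x)%:E <= 0)%E.
Proof.
move=> Htest f g a1 b1 ra Hf supp f_ge0.
(* Halfway: the approximations need room around the support of f, yet must stay away from r = r0,
   where the coefficients need not be bounded. *)
pose a := (r0 ^+ 2 + a1) / 2.
have r0a : r0 ^+ 2 < a by rewrite /a; lra.
have aa1 : a < a1 by rewrite /a; lra.
have b1b : b1 < b1 + 1 by lra.
have [C HC] := Ab_bounded (b1 + 1) r0a.
pose K := [set x : 'rV[R]_m | a <= sqnorm x <= b1 + 1].
have mE := exterior_measurable.
have mK : measurable K by apply: closed_measurable_rV; exact: annulus_closed.
have muK : (mu K < +oo)%E.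
  apply: le_lt_trans (lebesgue_rV_ball m (Num.sqrt `|b1 + 1|)).
  apply: le_measure; rewrite ?inE//; first exact: ball_measurable.
  by move=> x /= /andP[_]; exact: annulus_bounded.
have fmuK : mu K \is a fin_num by rewrite ge0_fin_numE.
pose Q := `|C| * (1 + m%:R) * fine (mu K).
have Q0 : 0 <= Q by rewrite !mulr_ge0// ?addr_ge0// fine_ge0.
have If := weak_form_integrable ra Hf supp.
have fIf := integrable_fin_num mE If.
suff H e : 0 < e -> (\int[mu]_(x in E) (weak_form f g x)%:E <= (e * Q)%:E)%E.
  rewrite leNgt; apply/negP; move: (fIf) => /fineK <-; rewrite lte_fin => v0.
  set v := fine _ in v0 *.
  have e0 : 0 < v / (2 * (Q + 1)) by rewrite divr_gt0// mulr_gt0// ltr_wpDl.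
  have Hv := H _ e0; rewrite -(fineK fIf) -/v lee_fin in Hv.
  have Q1 : 0 < Q + 1 by rewrite ltr_wpDl.
  have E1 : v / (2 * (Q + 1)) * Q = v - (v * (Q + 2)) / (2 * (Q + 1)).
    by field; rewrite gt_eqF.
  have : 0 < v * (Q + 2) / (2 * (Q + 1)).
    by rewrite divr_gt0 ?mulr_gt0// ltr_wpDl.
  by rewrite E1 in Hv; lra.
move=> e0.
have [phi [sphi phi_ge0 sup_phi Hphi Hdphi]] := annulus_test_density aa1 b1b Hf f_ge0 supp e0.
have tphi : test_function E phi.
  by apply: smooth_test_function sphi sup_phi _ => x; exact: annulus_exterior.
have Gphi := smooth_expr_has_grad sphi.
have Iphi := weak_form_integrable r0a Gphi sup_phi.
have zf := support_gradient Hf supp.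
have zp := support_gradient Gphi sup_phi.
have k0 : 0 <= e * (`|C| * (1 + m%:R)).
  by apply: mulr_ge0; [exact: ltW|apply: mulr_ge0 => //; exact: addr_ge0].
pose h x : R := e * (`|C| * (1 + m%:R)) * \1_K x.
have Ih : mu.-integrable E (EFin \o h).
  apply: (@bounded_support_integrable _ _ _ _ E K h (e * (`|C| * (1 + m%:R)))) => //.
  - by apply: measurable_funM => //.
  - move=> x _; rewrite /h indicE; case: (_ \in _); first by rewrite mulr1 ger0_norm.
    by rewrite mulr0 normr0.
  - by move=> x _ nK; rewrite /h indicE memNset// mulr0.
apply: (@le_trans _ _ (\int[mu]_(x in E) (weak_form phi (fun i => partial i phi) x)%:E
   + \int[mu]_(x in E) (h x)%:E)%E).
  rewrite -integralD//; apply: le_integral => //; first exact: integrableD.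
  move=> x Ex; rewrite -EFinD lee_fin -lerBlDl.
  case: (boolP (a <= sqnorm x <= b1 + 1)) => xK; last first.
    have [p0 dp0] := zp x xK.
    have [f0 g0] : f x = 0 /\ forall i, g i x = 0.
      apply: zf; apply: contra xK => /andP[x1 x2].
      by rewrite (le_trans (ltW aa1))//= (le_trans x2)// ltW.
    rewrite /weak_form f0 p0 !big1 => [|i _|i _]; rewrite ?dp0 ?g0 ?mulr0//.
    by rewrite !addr0 subrr /h mulr_ge0.
  have [HA Hb] := HC x xK.
  have -> : weak_form f g x - weak_form phi (fun i => partial i phi) x =
     A x * (f x - phi x) + \sum_i b i x * (g i x - partial i phi x).
    rewrite /weak_form opprD addrACA -mulrBr -sumrB; congr (_ + _).
    by apply: eq_bigr => i _; rewrite mulrBr.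
  rewrite /h indicE mem_set// mulr1.
  have -> : e * (`|C| * (1 + m%:R)) = e * `|C| + e * (`|C| * m%:R) by ring.
  apply: lerD.
    apply: (le_trans (ler_norm _)); rewrite normrM mulrC ler_pM//.
      by rewrite distrC.
    by apply: (le_trans HA); exact: ler_norm.
  have -> : e * (`|C| * m%:R) = \sum_(i < m) `|C| * e.
    by rewrite sumr_const card_ord -[RHS]mulr_natl; ring.
  apply: ler_sum => i _; apply: (le_trans (ler_norm _)); rewrite normrM ler_pM//.
    by apply: (le_trans (Hb i)); exact: ler_norm.
  by rewrite distrC.
have H1 := Htest phi _ _ r0a sup_phi tphi phi_ge0.
have H2 : (\int[mu]_(x in E) (h x)%:E <= (e * Q)%:E)%E.
  rewrite /h; under eq_integral do rewrite EFinM.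
  rewrite ge0_integralZl_EFin//; last first.
  - by apply/measurable_EFinP; apply: measurable_funTS.
  rewrite integral_indic//.
  have -> : (e * Q)%:E = ((e * (`|C| * (1 + m%:R)))%:E * mu K)%E.
    by rewrite -[in RHS](fineK fmuK) -EFinM /Q mulrA.
  rewrite lee_wpmul2l//.
  by rewrite le_measure// ?inE//; exact: measurableI.
by apply: le_trans (leeD H1 H2) _; rewrite add0e.
Qed.

End annulus_density.

(** * The weak inequality of the subsolution *)

Section subsolution.
Context (R : realType) (m : nat) (sigma : R -> R) (p r0 : R).
Hypotheses (m0 : (0 < m)%N) (p1 : 1 < p) (Hsigma : warping_function sigma) (r00 : 0 < r0).
Local Notation r := (@polar_radius R m).
Local Notation mu := (lebesgue_rV R m).
Let E := [set x : 'rV[R]_m | r0 < r x].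

Let Epos x : E x -> 0 < r x. Proof. exact: lt_trans. Qed.
Let Eneq0 x : E x -> x != 0. Proof. by rewrite -radius_neq0; exact: Epos. Qed.
Let Esig x : E x -> 0 < sigma (r x).
Proof. by move=> Ex; apply: (warping_gt0 Hsigma); exact: Epos. Qed.

Definition density x : R := (sigma (r x) / r x) ^+ m.-1.

Lemma density_ge0 x : E x -> 0 <= density x.
Proof. by move=> Ex; rewrite exprn_ge0// divr_ge0 ?radius_ge0// ltW// Esig. Qed.

Let cratio : exists2 tau : R -> R, continuous tau & forall x, sigma (r x) = tau (r x).
Proof.
have [tau [_ [_ ctau _ tauE _]]] := warping_smooth Hsigma.
by exists tau => // x; rewrite tauE ?radius_ge0.
Qed.

Let csigma x : {for x, continuous (fun x => sigma (r x))}.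
Proof.
have [tau ctau tauE] := cratio.
apply: (eq_continuous (f := fun x => tau (r x))) => [y|]; first by rewrite tauE.
by apply: (continuous_comp (f := r)); [exact: continuous_radius|exact: ctau].
Qed.

Let crad x : {for x, continuous r}. Proof. exact: continuous_radius. Qed.

Lemma continuous_density x : E x -> {for x, continuous density}.
Proof.
move=> Ex; apply: (continuous_comp (f := fun x => sigma (r x) / r x) (g := fun s : R => s ^+ m.-1));
  last exact: exprn_continuous.
apply: continuousM; first exact: csigma.
apply: continuousV; last exact: crad.
by rewrite gt_eqF// Epos.
Qed.

Lemma continuous_dot (xi eta : 'rV[R]_m -> 'rV[R]_m) x :
  (forall i, {for x, continuous (fun y => xi y ord0 i)}) ->
  (forall i, {for x, continuous (fun y => eta y ord0 i)}) ->
  {for x, continuous (fun y => dot (xi y) (eta y))}.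
Proof.
move=> cxi ceta; apply: continuous_sum_at => i.
by apply: (@continuousM _ _ (fun y => xi y ord0 i) (fun y => eta y ord0 i)); [exact: cxi|exact: ceta].
Qed.

Lemma continuous_dual (xi eta : 'rV[R]_m -> 'rV[R]_m) x : E x ->
  (forall i, {for x, continuous (fun y => xi y ord0 i)}) ->
  (forall i, {for x, continuous (fun y => eta y ord0 i)}) ->
  {for x, continuous (fun y => dual sigma y (xi y) (eta y))}.
Proof.
move=> Ex cxi ceta.
have cid i : {for x, continuous (fun y : 'rV[R]_m => y ord0 i)} by exact: coord_continuous.
have cd1 := continuous_dot cxi cid.
have cd2 := continuous_dot ceta cid.
have cd3 := continuous_dot cxi ceta.
have rn : r x != 0 by rewrite gt_eqF// Epos.
have cr2 : {for x, continuous (fun y => (r y ^+ 2)^-1)}.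
  apply: continuousV; first by rewrite expf_neq0.
  by apply: (continuous_comp (f := r) (g := fun s : R => s ^+ 2)); [exact: crad|exact: exprn_continuous].
have cP : {for x, continuous (fun y => dot (xi y) y * dot (eta y) y / r y ^+ 2)}.
  apply: (@continuousM _ _ (fun y => dot (xi y) y * dot (eta y) y) (fun y => (r y ^+ 2)^-1)) => //.
  exact: (@continuousM _ _ (fun y => dot (xi y) y) (fun y => dot (eta y) y)).
apply: (@continuousD _ _ _ (fun y => dot (xi y) y * dot (eta y) y / r y ^+ 2)) => //.
apply: (@continuousM _ _ (fun y => (r y / sigma (r y)) ^+ 2)
  (fun y => dot (xi y) (eta y) - dot (xi y) y * dot (eta y) y / r y ^+ 2)); last first.
  exact: (@continuousB _ _ _ (fun y => dot (xi y) (eta y))).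
apply: (continuous_comp (f := fun x => r x / sigma (r x)) (g := fun s : R => s ^+ 2));
  last exact: exprn_continuous.
apply: continuousM; first exact: crad.
apply: continuousV; last exact: csigma.
by rewrite gt_eqF// Esig.
Qed.

Variables (D : set 'rV[R]_m) (Lambda : R -> R) (u : 'rV[R]_m -> R) (B : R).
Hypotheses (ED : E `<=` D) (uC1 : Cn 1 D u)
  (Lambda_ge0 : forall t, 0 <= t -> 0 <= Lambda t)
  (Lambda_mono : forall s t, 0 <= s -> s <= t -> Lambda s <= Lambda t)
  (u_ge0 : forall x, E x -> 0 <= u x) (uB : forall x, E x -> u x <= B)
  (Hu : plap_ge sigma p D (dfun u) (fun x => Lambda (u x))).

Definition sub_density x : R := Lambda (u x) * density x.
Definition sub_flux (i : 'I_m) x : R :=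
  dual_norm sigma x (dfun u x) `^ (p - 2) * dual sigma x (dfun u x) (delta_mx ord0 i) * density x.

Let Gu : has_grad E u (fun i => partial i u).
Proof. exact: has_grad_sub ED (Cn_has_grad uC1). Qed.

Let cdu x i : E x -> {for x, continuous (fun y => dfun u y ord0 i)}.
Proof.
move=> /Gu[_ /(_ i)[_ c]]; apply: eq_continuous c => y; by rewrite mxE.
Qed.

Let cdelta i x (j : 'I_m) : {for x, continuous (fun _ : 'rV[R]_m => (delta_mx ord0 i : 'rV[R]_m) ord0 j)}.
Proof. exact: cst_continuous. Qed.

Let oE : open E. Proof. exact: open_radius_gt. Qed.
Let mE : measurable E. Proof. exact: exterior_measurable. Qed.

Let cnorm x (xi : 'rV[R]_m -> 'rV[R]_m) : E x ->
  (forall i, {for x, continuous (fun y => xi y ord0 i)}) ->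
  {for x, continuous (fun y => dual_norm sigma y (xi y))}.
Proof.
move=> Ex cxi; apply: (continuous_comp (f := fun y => dual sigma y (xi y) (xi y)) (g := Num.sqrt)).
  exact: continuous_dual.
exact: sqrt_continuous.
Qed.

(** Lambda may jump, so measurability comes from monotonicity. As it is monotone only on [0, +oo[,
    it is precomposed with the positive part. *)
Lemma sub_density_measurable :
  measurable_fun E (sub_density : 'rV[R]_m -> measurableTypeR R).
Proof.
apply: measurable_funM; last first.
  by apply: continuous_measurable_rV oE _ => x; exact: continuous_density.
have mL : measurable_fun setT (fun t : R => Lambda (Num.max t 0)).
  apply: nondecreasing_measurable => // s t st.
  apply: Lambda_mono; first by rewrite le_max lexx orbT.
  by rewrite ge_max !le_max st lexx orbT.
apply: (@eq_measurable_fun _ _ _ _ _ (fun x => Lambda (Num.max (u x) 0))).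
  by move=> x; rewrite inE => Ex; rewrite max_l// u_ge0.
apply: (measurableT_comp mL); apply: continuous_measurable_rV oE _ => x /Gu[]//.
Qed.

Lemma sub_flux_measurable i :
  measurable_fun E (sub_flux i : 'rV[R]_m -> measurableTypeR R).
Proof.
apply: measurable_funM; last first.
  by apply: continuous_measurable_rV oE _ => x; exact: continuous_density.
apply: measurable_funM; last first.
  apply: continuous_measurable_rV oE _ => x Ex; apply: (@continuous_dual (dfun u) (fun=> delta_mx ord0 i) x Ex).
    by move=> j; exact: (cdu Ex).
  by move=> j; exact: cdelta.
apply: (measurableT_comp (measurable_powR (p - 2))).
by apply: continuous_measurable_rV oE _ => x Ex; apply: (@cnorm x (dfun u) Ex) => j; exact: (cdu Ex).
Qed.

Lemma sub_bounded a1 b1 : r0 ^+ 2 < a1 -> exists C : R, forall x : 'rV[R]_m,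
  a1 <= sqnorm x <= b1 -> `|sub_density x| <= C /\ forall i, `|sub_flux i x| <= C.
Proof.
move=> ra.
have KE x : a1 <= sqnorm x <= b1 -> E x by exact: annulus_exterior.
have bound (f : 'rV[R]_m -> R) : (forall x, E x -> {for x, continuous f}) ->
    exists C : R, forall x : 'rV[R]_m, a1 <= sqnorm x <= b1 -> `|f x| <= C.
  move=> cf; apply: (continuous_bounded_compact (@annulus_compact R m a1 b1)).
  by apply: continuous_in_subspaceT => x /set_mem /KE; exact: cf.
have [C1 HC1] := bound _ continuous_density.
(* A continuous majorant of the flux, by Cauchy-Schwarz: for p < 2 the factor |du|^(p-2) alone is
   not continuous at critical points of u, whereas |du|^(p-1) is. *)
pose h i x := pospow (p - 1) (dual_norm sigma x (dfun u x))
  * dual_norm sigma x (delta_mx ord0 i) * density x.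
have [C2 HC2] : exists C : 'I_m -> R, forall i (x : 'rV[R]_m), a1 <= sqnorm x <= b1 -> `|h i x| <= C i.
  have /choice[C HC] : forall i, exists C : R, forall x : 'rV[R]_m, a1 <= sqnorm x <= b1 -> `|h i x| <= C.
    move=> i; apply: bound => x Ex.
    apply: (@continuousM _ _ (fun x => pospow (p - 1) (dual_norm sigma x (dfun u x))
      * dual_norm sigma x (delta_mx ord0 i)) density); last exact: continuous_density.
    apply: (@continuousM _ _ (fun x => pospow (p - 1) (dual_norm sigma x (dfun u x)))
      (fun x => dual_norm sigma x (delta_mx ord0 i))); last first.
      by apply: (@cnorm x (fun=> delta_mx ord0 i) Ex) => j; exact: cdelta.
    apply: (continuous_comp (f := fun x => dual_norm sigma x (dfun u x)) (g := pospow (p - 1))).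
      by apply: (@cnorm x (dfun u) Ex) => j; exact: (cdu Ex).
    by apply: continuous_pospow; rewrite subr_gt0.
  by exists C.
exists (`|Lambda B| * `|C1| + \sum_i `|C2 i|) => x xK.
have Ex := KE x xK; split.
  rewrite ler_wpDr ?sumr_ge0// normrM; apply: ler_pM => //.
    rewrite !ger0_norm ?Lambda_ge0 ?u_ge0//; last exact: le_trans (u_ge0 Ex) (uB Ex).
    by apply: Lambda_mono; [exact: u_ge0|exact: uB].
  by apply: le_trans (ler_norm _); exact: HC1.
move=> i; apply: (@le_trans _ _ `|h i x|).
  rewrite /sub_flux /h !normrM ler_wpM2r// [X in X * _ <= _]ger0_norm ?powR_ge0//.
  rewrite [X in _ <= X * _]ger0_norm ?pospow_ge0// pospowE ?dual_norm_ge0//.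
  rewrite -powR_sub2 ?dual_norm_ge0// -mulrA ler_wpM2l ?powR_ge0//.
  rewrite [X in _ <= _ * X]ger0_norm ?dual_norm_ge0//.
  by apply: dual_le; exact: Eneq0.
rewrite (le_trans (HC2 i x xK))// (le_trans (ler_norm _))//.
rewrite (bigD1 i)//= ler_wpDl ?mulr_ge0// lerDl sumr_ge0//.
Qed.

Lemma weak_form_dual f (g : 'I_m -> 'rV[R]_m -> R) x :
  weak_form sub_density sub_flux f g x =
  Lambda (u x) * f x * density x
  + dual_norm sigma x (dfun u x) `^ (p - 2) * dual sigma x (dfun u x) (\row_i g i x) * density x.
Proof.
rewrite /weak_form /sub_density mulrAC; congr (_ + _).
rewrite dual_sum mulr_sumr mulr_suml; apply: eq_bigr => i _.
by rewrite /sub_flux mxE; ring.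
Qed.

Lemma integral_sub_support (f : 'rV[R]_m -> \bar R) : (forall x, ~ E x -> f x = 0%E) ->
  (\int[mu]_(x in D) f x = \int[mu]_(x in E) f x)%E.
Proof.
move=> f0; rewrite integral_mkcond [RHS]integral_mkcond; apply: eq_integral => x _.
rewrite !patchE; case: ifPn => xD; case: ifPn => xE //.
  by rewrite f0//; move: xE; rewrite notin_setE.
by move: xD; rewrite notin_setE => /(_ (ED (set_mem xE))).
Qed.

Lemma subsolution_test phi (a1 b1 : R) : r0 ^+ 2 < a1 ->
  (forall x, phi x != 0 -> a1 <= sqnorm x <= b1) ->
  test_function E phi -> (forall x, 0 <= phi x) ->
  (\int[mu]_(x in E) (weak_form sub_density sub_flux phi (fun i => partial i phi) x)%:E <= 0)%E.
Proof.
move=> ra supp tphi phi_ge0.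
have tphiD := test_function_sub ED tphi.
have Gphi := test_function_has_grad tphi.
have zero := support_gradient Gphi supp.
have outside x : ~ E x -> phi x = 0 /\ dfun phi x = 0.
  move=> nE; have [] := zero x.
    by apply/negP => /(annulus_exterior r00 ra).
  by move=> -> d0; split => //; apply/rowP => i; rewrite !mxE d0.
(* The hypothesis on u compares two separate extended integrals. The reaction part (b = 0) and the
   flux part (A = 0) are each shown integrable so that they can be added. *)
have bA a2 b2 : r0 ^+ 2 < a2 -> exists C : R, forall x : 'rV[R]_m,
    a2 <= sqnorm x <= b2 -> `|sub_density x| <= C /\ forall i : 'I_m, `|0 : R| <= C.
  move=> /(@sub_bounded _ b2)[C HC]; exists C => x /HC[H1 H2]; split => // i.
  by rewrite normr0; exact: le_trans (H1).
have bB a2 b2 : r0 ^+ 2 < a2 -> exists C : R, forall x : 'rV[R]_m,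
    a2 <= sqnorm x <= b2 -> `|0 : R| <= C /\ forall i : 'I_m, `|sub_flux i x| <= C.
  move=> /(@sub_bounded _ b2)[C HC]; exists C => x /HC[H1 H2]; split => //.
  by rewrite normr0; exact: le_trans (H1).
have m00 : measurable_fun E ((fun=> 0) : 'rV[R]_m -> measurableTypeR R).
  exact: measurable_cst.
have iA := weak_form_integrable sub_density_measurable
  (fun _ : 'I_m => m00) bA ra Gphi supp.
have iB := weak_form_integrable m00 sub_flux_measurable bB ra Gphi supp.
have H := Hu tphiD phi_ge0.
pose FA := weak_form sub_density (fun _ _ => 0) phi (fun i => partial i phi).
pose FB := weak_form (fun=> 0) sub_flux phi (fun i => partial i phi).
have EA : int_vol sigma D (fun x => Lambda (u x) * phi x) = (\int[mu]_(x in E) (FA x)%:E)%E.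
  rewrite /int_vol integral_sub_support => [|x /outside[-> _]]; last by rewrite mulr0 mul0r.
  apply: eq_integral => x /set_mem Ex; congr (_%:E).
  rewrite /FA /weak_form big1 => [|i _]; last by rewrite mul0r.
  rewrite addr0 vol_densityE; [|exact: Eneq0|exact: Esig].
  by rewrite /sub_density mulrAC.
have EB : plap_pairing sigma p D (dfun u) phi = (- \int[mu]_(x in E) (FB x)%:E)%E.
  rewrite /plap_pairing /int_vol integral_sub_support => [|x /outside[_ ->]]; last first.
    by rewrite /= /sharp mul0mx /inner trmx0 mulmx0 mxE mul0r.
  congr (- _)%E; apply: eq_integral => x /set_mem Ex; congr (_%:E).
  rewrite plap_integrand//; last exact: Eneq0.
  rewrite /FB /weak_form mul0r add0r dual_sum mulr_sumr mulr_suml; apply: eq_bigr => i _.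
  by rewrite /sub_flux !mxE /density; ring.
have EW x : (weak_form sub_density sub_flux phi (fun i => partial i phi) x)%:E =
    ((FA x)%:E + (FB x)%:E)%E.
  rewrite -EFinD /FA /FB /weak_form mul0r add0r; congr (_%:E).
  by rewrite [X in _ + X + _]big1 ?addr0// => i _; rewrite mul0r.
under eq_integral do rewrite EW.
have mE' : measurable E by [].
rewrite integralD//.
rewrite /plap_ge EA EB in H.
have fA := integrable_fin_num mE iA; have fB := integrable_fin_num mE iB.
move: H; rewrite /FA /FB -(fineK fA) -(fineK fB) -EFinN lee_fin -EFinD lee_fin => H.
by rewrite -lerBrDr sub0r.
Qed.

End subsolution.

(** * Comparison with radial supersolutions *)

Section comparison.
Context (R : realType) (m : nat) (sigma : R -> R) (p r0 : R).
Hypotheses (m0 : (0 < m)%N) (p1 : 1 < p) (Hsigma : warping_function sigma) (r00 : 0 < r0).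
Local Notation r := (@polar_radius R m).
Local Notation mu := (lebesgue_rV R m).
Let E := [set x : 'rV[R]_m | r0 < r x].
Variables (D : set 'rV[R]_m) (Lambda : R -> R) (u : 'rV[R]_m -> R) (B : R).
Hypotheses (ED : E `<=` D) (uC1 : Cn 1 D u)
  (Lambda_ge0 : forall t, 0 <= t -> 0 <= Lambda t)
  (Lambda_mono : forall s t, 0 <= s -> s <= t -> Lambda s <= Lambda t)
  (u_ge0 : forall x, E x -> 0 <= u x) (uB : forall x, E x -> u x <= B)
  (Hu : plap_ge sigma p D (dfun u) (fun x => Lambda (u x))).
Variables (Phi dPhi Y dY : R -> R) (r1 r2 : R).
Hypotheses
  (HPhi : forall rho : R, r0 < rho -> is_derive rho 1 Phi (dPhi rho) /\ {for rho, continuous dPhi})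
  (HY : forall rho : R, 0 < rho -> is_derive rho 1 Y (dY rho) /\ {for rho, continuous dY})
  (flux : forall rho, r0 < rho -> signed_power p (dPhi rho) * sigma rho ^+ m.-1 = Y rho)
  (strict : forall rho, r0 < rho -> dY rho < Lambda (Phi rho) * sigma rho ^+ m.-1)
  (Phi_ge0 : forall rho, r0 < rho -> 0 <= Phi rho)
  (r01 : r0 < r1) (inner_bound : forall x, r0 < r x -> r x < r1 -> u x <= Phi (r x))
  (outer_bound : forall x, r2 < r x -> u x <= Phi (r x)).

Let Epos x : E x -> 0 < r x. Proof. exact: lt_trans. Qed.
Let Eneq0 x : E x -> x != 0. Proof. by rewrite -radius_neq0; exact: Epos. Qed.
Let Esig x : E x -> 0 < sigma (r x).
Proof. by move=> Ex; apply: (warping_gt0 Hsigma); exact: Epos. Qed.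

Let psi x := if r0 < r x then pospow 2 (u x - Phi (r x)) else 0.
Let g (i : 'I_m) x := if r0 < r x then
  2 * pospow 1 (u x - Phi (r x)) * (partial i u x - dPhi (r x) * (x ord0 i / r x)) else 0.

Let psi_ge0 x : 0 <= psi x.
Proof. by rewrite /psi; case: ifP => // _; exact: pospow_ge0. Qed.

Let nonpos x : u x <= Phi (r x) -> psi x = 0 /\ forall i, g i x = 0.
Proof.
move=> ux; have d0 : u x - Phi (r x) <= 0 by rewrite subr_le0.
by rewrite /psi /g !pospow0//; split => [|i]; case: ifP => //; rewrite mulr0 mul0r.
Qed.

Let near_pole x : r x < r1 -> psi x = 0 /\ forall i, g i x = 0.
Proof.
move=> xr1; case: (ltP r0 (r x)) => Ex; first by apply: nonpos; exact: inner_bound.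
by rewrite /psi /g ltNge Ex.
Qed.

Let Gpsi : has_grad setT psi g.
Proof.
have H1 : has_grad [set x | r x < r1] psi g.
  apply: (@has_grad_eq _ _ _ (fun=> 0) _ (fun _ _ => 0) _ (@open_radius_lt R m r1)).
  - by move=> x /= /near_pole[->].
  - by move=> x i /= /near_pole[_ ->].
  - exact: has_grad_cst.
have GPhi : has_grad E (fun x => Phi (r x)) (fun i x => dPhi (r x) * (x ord0 i / r x)).
  by apply: (has_grad_radial (ltW r00)); exact: HPhi.
have Gu : has_grad E u (fun i => partial i u) by exact: has_grad_sub ED (Cn_has_grad uC1).
have Gm : has_grad E (fun x => (-1) * Phi (r x))
    (fun i x => 0 * Phi (r x) + (-1) * (dPhi (r x) * (x ord0 i / r x))).
  by apply: has_gradM GPhi; exact: has_grad_cst.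
have Gd := has_gradD Gu Gm.
have H2 : has_grad E psi g.
  have G2 := @has_grad_comp _ _ _ _ _ (pospow 2) (fun s => 2 * pospow (2 - 1) s) Gd _.
  apply: (has_grad_eq (@open_radius_gt R m r0) _ _ (G2 _)).
  - by move=> x /= Ex; rewrite /psi Ex mulN1r.
  - move=> x i /= Ex; rewrite /g Ex mul0r add0r !mulN1r.
    by have -> : 2 - 1 = 1 :> R by ring.
  - move=> x Ex; split; first by apply: is_derive_pospow; rewrite ltr1n.
    apply: (@continuousM _ _ (cst 2) (pospow (2 - 1))); first exact: cst_continuous.
    by apply: continuous_pospow; lra.
apply: has_grad_sub (has_gradU H1 H2) => x _ /=.
by case: (ltP (r x) r1) => [|H]; [left|right; exact: lt_le_trans r01 H].
Qed.

Let supp x : psi x != 0 -> r1 ^+ 2 <= sqnorm x <= r2 ^+ 2.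
Proof.
move=> px; rewrite -sqr_radius.
have r10 : 0 < r1 by exact: lt_trans r01.
have xr1 : r1 <= r x by rewrite leNgt; apply: contra px => /near_pole[-> _].
have xr2 : r x <= r2.
  by rewrite leNgt; apply: contra px => /outer_bound/nonpos[-> _].
have r20 : 0 <= r2 by apply: le_trans xr2; exact: radius_ge0.
by rewrite !ler_pXn2r ?xr1 ?nnegrE ?radius_ge0 ?(ltW r10).
Qed.

Let Q x := weak_form (sub_density sigma Lambda u) (sub_flux sigma p u) psi g x
  - (radial_source dY psi x + radial_pairing Y g x).

Let gap x := u x - Phi (r x).

(* Pointwise, Q is the strict inequality between the two reaction terms plus the
   monotonicity of the p-Laplacian flux. *)
Let Q_bound x : E x ->
  psi x * (r x / r x ^+ m) * (Lambda (u x) * sigma (r x) ^+ m.-1 - dY (r x)) <= Q x.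
Proof.
move=> Ex; have rx := Epos Ex; have x0 := Eneq0 Ex; have sx := Esig Ex.
have dens0 : 0 <= density sigma x by apply: (density_ge0 Hsigma r00).
pose xi := dfun u x; pose eta := (dPhi (r x) / r x) *: x.
have gE : \row_i g i x = (2 * pospow 1 (gap x)) *: (xi - eta).
  by apply/rowP => i; rewrite !mxE /g Ex; congr (_ * (_ - _)); ring.
have pairE : radial_pairing Y g x =
    dual_norm sigma x eta `^ (p - 2) * dual sigma x eta (\row_i g i x) * density sigma x.
  rewrite /density radial_plap_integrand// flux//.
  by apply: eq_bigr => i _; rewrite mxE.
have M := plap_monotone sigma x0 xi eta p1.
rewrite /Q weak_form_dual pairE gE !dualZr.
set N1 := dual_norm sigma x xi `^ (p - 2) in M *.
set N2 := dual_norm sigma x eta `^ (p - 2) in M *.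
set k := 2 * pospow 1 (gap x).
have k0 : 0 <= k by rewrite mulr_ge0// pospow_ge0.
have dE : density sigma x = sigma (r x) ^+ m.-1 * (r x / r x ^+ m).
  rewrite /density expr_div_n; congr (_ * _).
  have -> : r x ^+ m = r x ^+ m.-1 * r x by rewrite -exprSr prednK.
  by field; rewrite expf_neq0 gt_eqF.
rewrite /radial_source [X in Lambda (u x) * psi x * X]dE.
have -> : Lambda (u x) * psi x * (sigma (r x) ^+ m.-1 * (r x / r x ^+ m))
   + N1 * (k * dual sigma x xi (xi - eta)) * density sigma x
   - (psi x * (dY (r x) * r x / r x ^+ m) + N2 * (k * dual sigma x eta (xi - eta)) * density sigma x)
  = psi x * (r x / r x ^+ m) * (Lambda (u x) * sigma (r x) ^+ m.-1 - dY (r x))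
   + k * density sigma x * (N1 * dual sigma x xi (xi - eta) - N2 * dual sigma x eta (xi - eta)) by ring.
by rewrite lerDl mulr_ge0// mulr_ge0.
Qed.

Let Q_gt0 x : E x -> 0 < psi x -> 0 < Q x.
Proof.
move=> Ex px; apply: lt_le_trans (Q_bound Ex); have rx := Epos Ex.
apply: mulr_gt0; first by apply: mulr_gt0 => //; rewrite divr_gt0// exprn_gt0.
rewrite subr_gt0.
have ux : Phi (r x) <= u x.
  rewrite leNgt; apply/negP => /ltW/nonpos[p0 _].
  by rewrite p0 ltxx in px.
apply: lt_le_trans (strict Ex) _; rewrite ler_wpM2r ?exprn_ge0 ?(ltW (Esig Ex))//.
by apply: Lambda_mono => //; exact: Phi_ge0.
Qed.

Let Q_ge0 x : E x -> 0 <= Q x.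
Proof.
move=> Ex; have := psi_ge0 x; rewrite le_eqVlt => /orP[/eqP p0|]; last first.
  by move=> /(Q_gt0 Ex)/ltW.
by apply: le_trans (Q_bound Ex); rewrite -p0 !mul0r.
Qed.

(** Q is nonnegative with integral at most 0, so it vanishes almost everywhere; but Q > 0 on the
    open set where psi > 0, and a nonempty open set has positive measure. *)
Lemma comparison x : r0 < r x -> u x <= Phi (r x).
Proof.
have mE : measurable E by exact: exterior_measurable.
have r10 : 0 < r1 by exact: lt_trans r01.
have ra : r0 ^+ 2 < r1 ^+ 2 by rewrite ltr_pXn2r ?nnegrE ?ltW.
have mA := sub_density_measurable Hsigma r00 ED uC1 Lambda_mono u_ge0.
have mb := sub_flux_measurable p Hsigma r00 ED uC1.
have Abb := sub_bounded p1 Hsigma r00 ED uC1 Lambda_ge0 Lambda_mono u_ge0 uB.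
have Htest := subsolution_test p1 Hsigma r00 ED uC1 Lambda_ge0 Lambda_mono u_ge0 uB Hu.
have I1 := weak_form_density r00 mA mb (fun a1 b1 => Abb a1 b1) Htest ra Gpsi supp psi_ge0.
have J1 := weak_form_integrable mA mb Abb ra Gpsi supp.
have psiL (y : 'rV[R]_m) : `|r2| < `|y| -> psi y = 0.
  move=> yr; apply: (nonpos _).1; apply: outer_bound.
  by rewrite (le_lt_trans (ler_norm _))// (lt_le_trans yr)// norm_le_radius.
have [iP iS I2] := radial_divergence r10 HY Gpsi psiL (fun y yr => or_introl (near_pole yr)).
have iPE := integrableS measurableT mE (@subsetT _ E) iP.
have iSE := integrableS measurableT mE (@subsetT _ E) iS.
have outside (y : 'rV[R]_m) : ~ E y -> psi y = 0 /\ forall i, g i y = 0.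
  by move=> /negP nE; rewrite /psi /g (negbTE nE).
have toE (f : 'rV[R]_m -> \bar R) : (forall y, ~ E y -> f y = 0%E) ->
    (\int[mu]_y f y = \int[mu]_(y in E) f y)%E.
  by move=> f0; apply: (@integral_sub_support _ _ _ setT).
have I3 : (\int[mu]_(y in E) (radial_source dY psi y)%:E =
    - \int[mu]_(y in E) (radial_pairing Y g y)%:E)%E.
  rewrite -!toE//.
  - by move=> y /outside[_ g0]; rewrite /radial_pairing big1// => i _; rewrite g0 mul0r.
  - by move=> y /outside[p0 _]; rewrite /radial_source p0 mul0r.
have iSP := integrableD mE iSE iPE.
have iQ : mu.-integrable E (EFin \o Q).
  have -> : EFin \o Q = ((EFin \o weak_form (sub_density sigma Lambda u) (sub_flux sigma p u) psi g)
     \- ((EFin \o radial_source dY psi) \+ (EFin \o radial_pairing Y g)))%E.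
    by apply/funext => y; rewrite /= /Q EFinB EFinD.
  exact: integrableB.
have IQ : (\int[mu]_(y in E) (Q y)%:E <= 0)%E.
  have I4 : (\int[mu]_(y in E) ((EFin \o radial_source dY psi) \+
      (EFin \o radial_pairing Y g)) y = 0)%E.
    by rewrite (integralD mE iSE iPE) [X in (X + _)%E]I3 addeC subee// integrable_fin_num.
  have -> : (\int[mu]_(y in E) (Q y)%:E = \int[mu]_(y in E)
     (weak_form (sub_density sigma Lambda u) (sub_flux sigma p u) psi g y)%:E)%E; last exact: I1.
  by rewrite (integralB mE J1 iSP) I4 sube0.
have IQ0 : (\int[mu]_(y in E) `|(Q y)%:E|)%E = 0%E.
  apply/eqP; rewrite eq_le integral_ge0// andbT.
  apply: le_trans IQ; rewrite le_eqVlt; apply/orP; left; apply/eqP.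
  by apply: eq_integral => y /set_mem Ey; rewrite gee0_abs// lee_fin Q_ge0.
have /(ae_eq_integral_abs mu mE (measurable_int _ iQ)) [N [mN N0 sN]] := IQ0.
move=> rx; rewrite leNgt; apply/negP => ux.
pose V := [set y | 0 < psi y].
have oV : open V.
  rewrite /V (_ : [set y | _] = psi @^-1` `]0, +oo[%classic); last first.
    by apply/seteqP; split => y /=; rewrite in_itv /= andbT.
  apply: open_comp => [y _|]; last exact: interval_open.
  by case: (Gpsi (I : setT y)).
have Vx : V x by rewrite /V /= /psi rx pospow_gt0// subr_gt0.
have VN : V `<=` N.
  move=> y Vy; apply: sN => /= H.
  have Ey : E y.
    apply: contrapT => /outside[p0 _]; move: Vy; rewrite /V /= p0 ltxx//.
  by have := Q_gt0 Ey Vy; have [->] := H Ey; rewrite ltxx.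
have := lebesgue_rV_open_gt0 oV (ex_intro _ x Vx).
rewrite ltNge => /negP; apply; rewrite -N0; apply: le_measure; rewrite ?inE//.
exact: open_measurable_rV.
Qed.

End comparison.

(** * The barrier *)

Section power_bound.
Context (R : realType) (Lambda : R -> R) (p xi : R).
Hypotheses (xi_ge0 : 0 <= xi) (xi_lt : xi < p - 1)
  (Lambda_mono : forall s t : R, 0 <= s -> s <= t -> Lambda s <= Lambda t)
  (Lambda_gt0 : forall t : R, 0 < t -> 0 < Lambda t)
  (Lambda_liminf : (0 < limf_einf (fun t : R => (Lambda t / t `^ xi)%:E) 0^'+)%E).

Lemma liminf_minorant : exists c d : R,
  [/\ 0 < c, 0 < d & forall t : R, 0 < t -> t < d -> c * t `^ xi <= Lambda t].
Proof.
move: Lambda_liminf; rewrite limf_einfE => /ereal_sup_gt[_ [V V0 <-] V_gt].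
have [e V_e e0] : exists2 e : \bar R, (forall t, V t -> (e <= (Lambda t / t `^ xi)%:E)%E) & (0 < e)%E.
  by exists (ereal_inf [set (Lambda t / t `^ xi)%:E | t in V]) => // t Vt; apply: ereal_inf_lbound; exists t.
(* The infimum e may be infinite, in which case any positive real will do. *)
have [c c0 ce] : exists2 c : R, 0 < c & (c%:E <= e)%E.
  case: e e0 {V_e} => [c|_|//]; first by rewrite lte_fin => c0; exists c.
  by exists 1; rewrite ?leey.
move: V0 => [d /= d0 dV]; exists c, d; split=> // t t0 td.
rewrite -ler_pdivlMr ?powR_gt0// -lee_fin; apply: le_trans ce _; apply: V_e.
by apply: dV => //; rewrite /= sub0r normrN gtr0_norm.
Qed.

(* The barrier needs a positive exponent for its flux to be C^1; increasing xi is
   harmless because t ^ zeta <= t ^ xi for t <= 1. *)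
Lemma power_minorant : exists2 zeta : R, 0 < zeta < p - 1 &
  forall M : R, 0 < M -> exists2 c : R, 0 < c &
    forall t : R, 0 < t -> t <= M -> c * t `^ zeta <= Lambda t.
Proof.
have [c [d [c0 d0 Hc]]] := liminf_minorant.
move: xi_ge0 xi_lt => x0 x1; exists ((xi + (p - 1)) / 2).
  by apply/andP; split; lra.
set zeta := (_ / 2); have zeta0 : 0 < zeta by rewrite /zeta; lra.
move=> M M0.
(* Below t0 <= 1 one has t^zeta <= t^xi, and t0 < d makes the asymptotic bound valid there. Between
   t0 and M, monotonicity gives Lambda t >= Lambda t0, while t^zeta <= M^zeta. *)
have [t0 [t00 t0d t01]] : exists t0, [/\ 0 < t0, t0 < d & t0 <= 1].
  case: (leP d 1) => d1; first by exists (d / 2); split; lra.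
  by exists 1; split.
have Mz : 0 < M `^ zeta by rewrite powR_gt0.
exists (Num.min c (Lambda t0 / M `^ zeta)).
  by rewrite lt_min c0 divr_gt0// Lambda_gt0.
move=> t tp tM; case: (leP t t0) => tt0.
  apply: le_trans (Hc t tp (le_lt_trans tt0 t0d)).
  apply: ler_pM; rewrite ?powR_ge0 ?ge_min ?lexx//.
    by rewrite le_min (ltW c0) divr_ge0// ltW// Lambda_gt0.
  by apply: ger_powR; rewrite ?tp ?(le_trans tt0)// /zeta; lra.
apply: (@le_trans _ _ (Lambda t0)); last by apply: Lambda_mono; exact: ltW.
apply: (@le_trans _ _ (Lambda t0 / M `^ zeta * M `^ zeta)); last by rewrite divfK// gt_eqF.
apply: ler_pM; rewrite ?powR_ge0 ?ge_min ?lexx ?orbT//.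
  by rewrite le_min (ltW c0) divr_ge0// ltW// Lambda_gt0.
by apply: ge0_ler_powR => //; rewrite ?nnegrE ltW.
Qed.

End power_bound.

Section barrier.
Context (R : realType) (p zeta : R) (S dS Lambda W v z : R -> R) (T L A K c eps kap : R).
Hypotheses (p1 : 1 < p) (zeta0 : 0 < zeta) (zeta1 : zeta < p - 1).
(* Chosen so that (q - 1) (p - 1) = q zeta + 1. *)
Let q := p / (p - 1 - zeta).
Hypotheses (L0 : 0 < L) (A0 : 0 < A) (K0 : 0 <= K) (eps0 : 0 < eps) (kap0 : 0 < kap)
  (DS : forall s : R, is_derive s 1 S (dS s)) (cdS : continuous dS)
  (S0 : forall s, T - L < s -> 0 < S s) (dSK : forall s, T - L < s -> - (K * S s) <= dS s)
  (DW : forall s : R, is_derive s 1 W (S s * ramp T s))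
  (Dv : forall s : R, is_derive s 1 v (z s)) (cz : continuous z)
  (low : forall s, s <= T -> [/\ W s = 0, v s = 0 & z s = 0])
  (high : forall s, T <= s -> [/\ 0 <= z s, z s `^ (p - 1) * S s = W s & (T < s -> 0 < z s)])
  (Lambda_mono : forall s t : R, 0 <= s -> s <= t -> Lambda s <= Lambda t)
  (Lambda_low : forall t, 0 < t -> t <= A * L `^ q -> c * t `^ zeta <= Lambda t)
  (small : A `^ (p - 1 - zeta) * (q `^ (p - 1) * (q * zeta + 1 + K * L)) < c)
  (kap_lt : kap < Lambda eps).

Definition barrier (s : R) : R :=
  eps + A * pospow q (T - s) + kap `^ (p - 1)^-1 * v s.

Definition barrier_slope (s : R) : R :=
  - (A * (q * pospow (q - 1) (T - s))) + kap `^ (p - 1)^-1 * z s.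

Let alpha := q * zeta + 1.

Definition barrier_flux (s : R) : R :=
  - ((A * q) `^ (p - 1) * (pospow alpha (T - s) * S s)) + kap * W s.

Definition barrier_flux' (s : R) : R :=
  (A * q) `^ (p - 1) * (alpha * pospow (q * zeta) (T - s) * S s
    - pospow alpha (T - s) * dS s) + kap * (S s * ramp T s).

Let d0 : 0 < p - 1 - zeta. Proof. by rewrite subr_gt0. Qed.
Let p10 : 0 < p - 1. Proof. by rewrite subr_gt0. Qed.
Let p0 : 0 < p. Proof. exact: lt_trans p1. Qed.
Let q1 : 1 < q.
Proof. by rewrite /q ltr_pdivlMr// mul1r; move: zeta0; lra. Qed.
Let q0 : 0 < q. Proof. exact: lt_trans q1. Qed.
Let q10 : 0 < q - 1. Proof. by rewrite subr_gt0. Qed.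
Let alphaE : (q - 1) * (p - 1) = alpha.
Proof. by rewrite /alpha /q; field; rewrite gt_eqF. Qed.
Let qz0 : 0 < q * zeta. Proof. exact: mulr_gt0. Qed.
Let alpha1 : 1 < alpha. Proof. by rewrite ltrDr. Qed.
Let alpha0 : 0 < alpha. Proof. exact: lt_trans alpha1. Qed.
Let k0 : 0 < kap `^ (p - 1)^-1. Proof. exact: powR_gt0. Qed.

Let Dpos b (s : R) : 1 < b ->
  is_derive s 1 (fun s => pospow b (T - s)) (- (b * pospow (b - 1) (T - s))).
Proof.
move=> b1; have D : is_derive s (1 : R) (fun s : R => T - s) (-1).
  by apply: (is_derive_rw (is_deriveB (is_derive_cst T s (1 : R)) (is_derive_id s (1 : R)))); rewrite sub0r.
apply: (is_derive_rw (is_derive1_comp (f := pospow b) (is_derive_pospow _ b1) D)).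
by rewrite mulrN1.
Qed.

Let cpos b : 0 < b -> continuous (fun s : R => pospow b (T - s)).
Proof.
move=> b0 s; apply: (continuous_comp (f := fun s : R => T - s) (g := pospow b)).
  by apply: continuousB; [exact: cst_continuous|exact: cvg_id].
exact: continuous_pospow.
Qed.

Let cM (a : R) (f : R -> R) : continuous f -> continuous (fun s => a * f s).
Proof. by move=> cf s; apply: continuousM; [exact: cst_continuous|exact: cf]. Qed.

Let DM (a : R) (f : R -> R) (s d : R) : is_derive s 1 f d -> is_derive s 1 (fun s => a * f s) (a * d).
Proof.
move=> D; apply: (is_derive_rw (is_deriveM (is_derive_cst a s (1 : R)) D)).
by rewrite /= scaler0 addr0.
Qed.

Let cS : continuous S. Proof. by move=> s; exact: is_derive_cont (DS s). Qed.

Lemma barrierP (s : R) : is_derive s 1 barrier (barrier_slope s) /\ {for s, continuous barrier_slope}.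
Proof.
split.
  have := is_deriveD (is_deriveD (is_derive_cst eps s (1 : R)) (DM A (Dpos s q1))) (DM (kap `^ (p - 1)^-1) (Dv s)).
  by move=> D; apply: (is_derive_rw D); rewrite add0r mulrN.
apply: continuousD; last by apply: cM; exact: cz.
apply: continuousN; apply: cM => {}s; apply: cM; exact: cpos.
Qed.

Lemma barrier_fluxP (s : R) :
  is_derive s 1 barrier_flux (barrier_flux' s) /\ {for s, continuous barrier_flux'}.
Proof.
split.
  have := is_deriveD (is_deriveN (DM ((A * q) `^ (p - 1)) (is_deriveM (Dpos s alpha1) (DS s))))
    (DM kap (DW s)).
  move=> D; apply: (is_derive_rw D).
  by rewrite /barrier_flux' /GRing.scale /= addrK; ring.
have c1 : continuous (fun s => alpha * pospow (q * zeta) (T - s) * S s).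
  move=> t; apply: (@continuousM _ _ (fun s => alpha * pospow (q * zeta) (T - s)) S); last exact: cS.
  by apply: cM; exact: cpos.
have c2 : continuous (fun s => pospow alpha (T - s) * dS s).
  by move=> t; apply: (@continuousM _ _ (fun s => pospow alpha (T - s)) dS); [exact: cpos|exact: cdS].
have c3 : continuous (fun s => S s * ramp T s).
  by move=> t; apply: (@continuousM _ _ S); [exact: cS|exact: continuous_ramp].
apply: continuousD; last by apply: cM; exact: c3.
apply: cM => t.
by apply: (@continuousB _ _ _ (fun s => alpha * pospow (q * zeta) (T - s) * S s)); [exact: c1|exact: c2].
Qed.

(** Only one of the two slopes is nonzero on each side of T. To the left the exponent is (q - 1) (p
    - 1) = alpha; to the right the power p - 1 turns kap^(1/(p-1)) into kap. *)
Lemma barrier_slope_flux s : signed_power p (barrier_slope s) * S s = barrier_flux s.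
Proof.
rewrite /barrier_slope /barrier_flux.
case: (leP s T) => sT.
  have [-> _ ->] := low sT; rewrite !mulr0 !addr0 signed_power_le0//; last first.
    by rewrite oppr_le0 (mulr_ge0 (ltW A0))// (mulr_ge0 (ltW q0))// pospow_ge0.
  have Aq0 : 0 <= A * q by apply: mulr_ge0; exact: ltW.
  rewrite opprK mulrA powRM ?Aq0 ?pospow_ge0//.
  by rewrite pospowM ?gt_eqF// alphaE mulNr mulrA.
have [z_ge0 <- _] := high (ltW sT); have Ts : T - s <= 0 by rewrite subr_le0 ltW.
rewrite !pospow0 ?gt_eqF// !(mulr0, mul0r) oppr0 !add0r signed_power_ge0//; last first.
  by rewrite mulr_ge0// ltW.
by rewrite powRM ?(ltW k0)// -powRrM mulVf ?gt_eqF// powRr1 ?(ltW kap0)// mulrA.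
Qed.

Let v_ge0 s : 0 <= v s.
Proof.
case: (leP s T) => [/low[_ -> _]//|Ts].
have [_ <- _] := low (lexx T); apply: (is_derive_ge0_le (ltW Ts) Dv) => x /andP[Tx _].
by case: (high Tx).
Qed.

Lemma barrier_ge s : eps <= barrier s.
Proof.
by rewrite /barrier -addrA lerDl addr_ge0// mulr_ge0 ?pospow_ge0 ?v_ge0// ltW.
Qed.

(** Beyond T the source is at most kap S, below Lambda(eps) S. Before T, with t = T - s, the bound
    on dS and t <= L give at most (A q)^(p-1) t^(q zeta) (alpha + K L) S, whereas Lambda is at least
    c A^zeta t^(q zeta); the powers of t cancel and [small] remains. *)
Lemma barrier_supersolution s : T - L < s -> barrier_flux' s < Lambda (barrier s) * S s.
Proof.
move=> Ls; have Ss := S0 Ls; rewrite /barrier_flux'.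
case: (leP T s) => sT.
  have Ts : T - s <= 0 by rewrite subr_le0.
  rewrite !pospow0 ?gt_eqF// !(mulr0, mul0r) subrr mulr0 add0r.
  apply: (@le_lt_trans _ _ (kap * S s)).
    by rewrite ler_pM2l// ler_piMr ?ramp_le1// ltW.
  rewrite ltr_pM2r//; apply: lt_le_trans kap_lt _; apply: Lambda_mono; [exact: ltW|exact: barrier_ge].
rewrite ramp0 ?(ltW sT)// !mulr0 addr0.
set t := T - s; have t0 : 0 < t by rewrite subr_gt0.
have tL : t <= L by rewrite /t; move: Ls; lra.
have phi0 : 0 < A * t `^ q by rewrite mulr_gt0// powR_gt0.
have phiM : A * t `^ q <= A * L `^ q.
  by rewrite ler_pM2l//; apply: ge0_ler_powR; rewrite ?nnegrE// ltW.
apply: (@lt_le_trans _ _ (c * (A * t `^ q) `^ zeta * S s)); last first.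
  rewrite ler_pM2r//; apply: le_trans (Lambda_low phi0 phiM) _; apply: Lambda_mono; first exact: ltW.
  rewrite /barrier -/t pospowE ?(ltW t0)// addrAC lerDr addr_ge0 ?(ltW eps0)//.
  by rewrite mulr_ge0 ?v_ge0// ltW.
have tz : 0 < t `^ (q * zeta) by rewrite powR_gt0.
rewrite !pospowE ?(ltW t0)//.
have -> : t `^ alpha = t `^ (q * zeta) * t.
  by rewrite /alpha powRD ?(gt_eqF t0) ?implybT// powRr1// ltW.
rewrite (powRM zeta (ltW A0) (powR_ge0 t q)) -powRrM.
have AE : (A * q) `^ (p - 1) = A `^ (p - 1 - zeta) * A `^ zeta * q `^ (p - 1).
  rewrite powRM ?(ltW A0) ?(ltW q0)// -powRD ?(gt_eqF A0) ?implybT//.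
  by congr (_ `^ _ * _); ring.
apply: (@le_lt_trans _ _ (A `^ (p - 1 - zeta) * (q `^ (p - 1) * (alpha + K * L)) *
    (A `^ zeta * t `^ (q * zeta)) * S s)); last first.
  by rewrite ltr_pM2r// ltr_pM2r// mulr_gt0// powR_gt0.
rewrite AE.
have -> : A `^ (p - 1 - zeta) * (q `^ (p - 1) * (alpha + K * L)) *
    (A `^ zeta * t `^ (q * zeta)) * S s = A `^ (p - 1 - zeta) * A `^ zeta * q `^ (p - 1) *
    (t `^ (q * zeta) * ((alpha + K * L) * S s)) by ring.
apply: ler_wpM2l; first by rewrite !mulr_ge0 ?powR_ge0.
have -> : alpha * t `^ (q * zeta) * S s - t `^ (q * zeta) * t * dS s =
  t `^ (q * zeta) * (alpha * S s - t * dS s) by ring.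
apply: ler_wpM2l; first exact: ltW.
rewrite [leRHS]mulrDl lerD2l -mulrN.
apply: (@le_trans _ _ (t * (K * S s))).
  by rewrite ler_pM2l// lerNl dSK.
by rewrite mulrCA mulrA ler_pM2r// ler_wpM2l.
Qed.

End barrier.

(** Prescribing the height A L^q = M forces A^(p-1-zeta) = M^(p-1-zeta) / L^p, because q (p - 1 -
    zeta) = p. Against the linear growth K L this leaves a decay of order L^(1-p), so a long barrier
    suffices; L >= 1 lets the constant term be treated like the linear one. *)
Lemma barrier_length (R : realType) (p zeta K M c : R) : 1 < p -> 0 < zeta -> zeta < p - 1 ->
  0 <= K -> 0 < M -> 0 < c -> let q := p / (p - 1 - zeta) in
  exists L A : R, [/\ 0 < L, 0 < A, A * L `^ q = M &
    A `^ (p - 1 - zeta) * (q `^ (p - 1) * (q * zeta + 1 + K * L)) < c].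
Proof.
move=> p1 z0 z1 K0 M0 c0 q.
have p0 : 0 < p by exact: lt_trans p1.
have p10 : 0 < p - 1 by rewrite subr_gt0.
have d0 : 0 < p - 1 - zeta by rewrite subr_gt0.
have q0 : 0 < q by rewrite divr_gt0.
pose b := M `^ (p - 1 - zeta) * q `^ (p - 1).
have b0 : 0 < b by rewrite mulr_gt0// powR_gt0.
have a0 : 0 < q * zeta + 1 by rewrite addr_gt0// mulr_gt0.
pose C := b * (q * zeta + 1 + K).
have C0 : 0 < C by rewrite mulr_gt0// ltr_wpDr.
have G0 : 0 < C / c by rewrite divr_gt0.
pose L := 1 + (C / c) `^ (p - 1)^-1.
have L1 : 1 <= L by rewrite lerDl powR_ge0.
have L0 : 0 < L by exact: lt_le_trans L1.
have Lq : 0 < L `^ q by rewrite powR_gt0.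
exists L, (M / L `^ q); split => //; [by rewrite divr_gt0|by rewrite divfK// gt_eqF|].
set A := M / _; have A0 : 0 < A by rewrite divr_gt0.
have AE : A `^ (p - 1 - zeta) = M `^ (p - 1 - zeta) / (L * L `^ (p - 1)).
  rewrite mulr_powRB1 ?(ltW L0)//; apply: (canRL (mulfK _)); first by rewrite gt_eqF// powR_gt0.
  have -> : L `^ p = (L `^ q) `^ (p - 1 - zeta) by rewrite -powRrM divfK// gt_eqF.
  by rewrite -powRM ?(ltW A0) ?(ltW Lq)// divfK// gt_eqF.
have Lp : 0 < L `^ (p - 1) by rewrite powR_gt0.
have GL : C / c < L `^ (p - 1).
  have -> : C / c = ((C / c) `^ (p - 1)^-1) `^ (p - 1).
    by rewrite -powRrM mulVf ?gt_eqF// powRr1// ltW.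
  apply: gt0_ltr_powR; rewrite ?nnegrE ?powR_ge0 ?(ltW L0)//.
  by rewrite ltrDr.
apply: (@le_lt_trans _ _ (C / L `^ (p - 1))); last first.
  by rewrite ltr_pdivrMr// mulrC -ltr_pdivrMr.
rewrite AE /C /b.
have -> : M `^ (p - 1 - zeta) / (L * L `^ (p - 1)) * (q `^ (p - 1) * (q * zeta + 1 + K * L)) =
    M `^ (p - 1 - zeta) * q `^ (p - 1) / L `^ (p - 1) * ((q * zeta + 1 + K * L) / L).
  by field; rewrite !gt_eqF.
rewrite [leRHS]mulrAC ler_pM2l; last by rewrite divr_gt0.
rewrite ler_pdivrMr// mulrDl lerD2r ler_peMr//; exact: ltW.
Qed.

Lemma log_derivative_lower (R : realType) (sigma : R -> R) :
  (forall t : R, 0 < t -> 0 < sigma t) ->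
  (-oo < ereal_inf [set (derive1 sigma t / sigma t)%:E | t in `]0%R, +oo[])%E ->
  exists2 a : R, 0 <= a & forall t : R, 0 < t -> - (a * sigma t) <= derive1 sigma t.
Proof.
move=> sigma0; set e := ereal_inf _ => e_gt.
have [y ye] : exists y : R, (y%:E <= e)%E.
  by move: e_gt; case: e => [y _|_|//]; [exists y|exists 0; rewrite leey].
exists `|y|; first exact: normr_ge0.
move=> t t0; rewrite -mulNr -ler_pdivlMr ?sigma0//.
apply: (@le_trans _ _ y); first by rewrite lerNl -normrN ler_norm.
rewrite -lee_fin; apply: le_trans ye _; apply: ereal_inf_lbound; exists t => //=.
by rewrite in_itv /= t0.
Qed.

Lemma is_derive_warping_power (R : realType) (tau dtau : R -> R) (k : nat) (a : R) :
  (forall t : R, is_derive t 1 tau (dtau t)) -> continuous tau -> continuous dtau -> 0 <= a ->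
  let dS (t : R) := k%:R * tau t ^+ k.-1 * dtau t in
  [/\ forall t : R, is_derive t 1 (fun s => tau s ^+ k) (dS t), continuous dS &
    forall t, 0 < tau t -> - (a * tau t) <= dtau t -> - (k%:R * a * tau t ^+ k) <= dS t].
Proof.
move=> Dtau ctau cdtau a0 dS.
have cX n : continuous (fun t => tau t ^+ n).
  move=> t; apply: (continuous_comp (f := tau) (g := fun s : R => s ^+ n)); first exact: ctau.
  exact: exprn_continuous.
split=> [t|t|t t0 H].
- exact: (is_derive1_comp (f := fun s : R => s ^+ k) (is_derive_exprn _ _) (Dtau t)).
- apply: (@continuousM _ _ (fun t => k%:R * tau t ^+ k.-1)); last exact: cdtau.
  by apply: (@continuousM _ _ (cst k%:R)); [exact: cst_continuous|exact: cX].
- rewrite {}/dS; case: k => [|k] /=; first by rewrite !mul0r oppr0.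
  rewrite exprS.
  have -> : - (k.+1%:R * a * (tau t * tau t ^+ k)) = k.+1%:R * tau t ^+ k * - (a * tau t) by ring.
  by rewrite ler_pM2l// mulr_gt0// exprn_gt0.
Qed.

(** * Choice of the constants and conclusion *)

Unset Implicit Arguments.
Set Strict Implicit.
Set Printing Implicit Defensive.

Theorem theorem5p1 (R : realType) (m : nat) (hm : (0 < m)%N) (p : R) (hp : 1 < p)
    (sigma : R -> R) (hsigma : warping_function sigma)
    (hSC : p_stochastically_complete m sigma p)
    (hF : p_feller m sigma p)
    (hinf : (-oo < ereal_inf [set (derive1 sigma t / sigma t)%:E | t in `]0%R, +oo[])%E)
    (Omega : set 'rV[R]_m) (hOmega : precompact_domain Omega)
    (Lambda : R -> R)
    (hLambda_ge0 : forall t : R, 0 <= t -> 0 <= Lambda t)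
    (hLambda_mono : forall s t : R, 0 <= s -> s <= t -> Lambda s <= Lambda t)
    (hLambda0 : Lambda 0 = 0)
    (hLambda_gt0 : forall t : R, 0 < t -> 0 < Lambda t)
    (xi : R) (hxi0 : 0 <= xi) (hxi : xi < p - 1)
    (hliminf : (0 < limf_einf (fun t : R => (Lambda t / t `^ xi)%:E) 0^'+)%E)
    (u : 'rV[R]_m -> R)
    (hC1 : Cn 1 (~` closure Omega) u)
    (hu_ge0 : forall x : 'rV[R]_m, ~ closure Omega x -> 0 <= u x)
    (hu_bnd : exists B : R, forall x : 'rV[R]_m, ~ closure Omega x -> u x <= B)
    (hu : plap_ge sigma p (~` closure Omega) (dfun u) (fun x => Lambda (u x))) :
  exists2 K : set 'rV[R]_m, compact K &
    forall x : 'rV[R]_m, ~ closure Omega x -> ~ K x -> u x = 0.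
Proof.
pose r := @polar_radius R m.
have [tau [dtau [Dtau ctau cdtau tauE dE]]] := warping_smooth hsigma.
have sigma0 := warping_gt0 hsigma.
have [a a0 Ha] := log_derivative_lower sigma0 hinf.
have [zeta /andP[z0 z1] Hz] := power_minorant hxi0 hxi hLambda_mono hLambda_gt0 hliminf.
have [B HB] := hu_bnd.
(* The height of the barrier at its inner end r0: positive, and strictly larger than the bound B of
   u. *)
have M0 : 0 < `|B| + 1 by rewrite ltr_wpDl.
have [c c0 Hc] := Hz _ M0.
(* If sigma' >= - a sigma, then S = sigma^(m-1) satisfies S' >= - (m - 1) a S. *)
pose K := m.-1%:R * a.
have K0 : 0 <= K by rewrite mulr_ge0.
have [L [A [L0 A0 AL small]]] := barrier_length hp z0 z1 K0 M0 c0.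
have [C HC] : exists C : R, forall x, closure Omega x -> `|r x| <= C.
  have [_ _ _ cO] := hOmega.
  by apply: (continuous_bounded_compact cO); apply: continuous_subspaceT; exact: continuous_radius.
(* The sphere of radius r0 encloses the closure of Omega, so u is defined and C^1 on r > r0; the
   dead core will start at T = r0 + L. *)
pose r0 := `|C| + 1.
have r00 : 0 < r0 by rewrite ltr_wpDl.
have ED : [set x | r0 < r x] `<=` ~` closure Omega.
  move=> x /= xr /HC xC; have := le_trans xC (ler_norm _).
  by rewrite ger0_norm ?radius_ge0// leNgt (lt_trans _ xr)// ltrDl.
pose T := r0 + L.
have T0 : 0 < T by rewrite addr_gt0.
have TL : T - L = r0 by rewrite /T addrK.
pose S (s : R) := tau s ^+ m.-1.
have [DS cdS dSK] := is_derive_warping_power m.-1 Dtau ctau cdtau a0.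
set dS := (fun t => _ * dtau t) in DS cdS dSK.
have tau0 s : 0 < s -> 0 < tau s by move=> s0; rewrite -tauE ?sigma0// ltW.
have S0 s : 0 < s -> 0 < S s by move=> s0; rewrite exprn_gt0// tau0.
have cS : continuous S by move=> s; exact: is_derive_cont (DS s).
have [W [v [z [DW Dv cz low high]]]] :=
  khasminskii_function hp cS (fun s Ts => S0 s (lt_le_trans T0 Ts)).
have v_unbounded := khasminskii_unbounded hm hp hsigma T0 ctau tauE DW Dv cz low high hSC.
have z_ge0 s : 0 <= z s.
  by case: (leP s T) => [/low[_ _ ->]//|/ltW/high[]].
have v_le s t : s <= t -> v s <= v t.
  by move=> st; apply: (is_derive_ge0_le st Dv) => y _; exact: z_ge0.
exists [set x | `|x| <= T]; first exact: closed_ball_compact.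
move=> x nO /= /negP; rewrite -ltNge => Tx.
have Trx : T < r x by apply: lt_le_trans Tx (norm_le_radius _).
have vx : 0 <= v (r x) by have [_ <- _] := low _ (lexx T); apply: v_le; exact: ltW.
apply/eqP; rewrite eq_le hu_ge0// andbT; apply/ler_addgt0Pr => e e0; rewrite add0r.
have eps0 : 0 < e / 2 by rewrite divr_gt0.
have del0 : 0 < e / 2 / (v (r x) + 1) by rewrite divr_gt0// ltr_wpDl.
have p10 : 0 < p - 1 by rewrite subr_gt0.
(* The point x is fixed, so kap may depend on it: letting kap and e tend to 0 pointwise replaces any
   uniform control of the unbounded v. *)
have [kap [kap0 kapL kapv]] : exists kap : R, [/\ 0 < kap, kap < Lambda (e / 2) &
    kap `^ (p - 1)^-1 * v (r x) <= e / 2].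
  have L20 := hLambda_gt0 _ eps0.
  (* For kap <= b, kap^(1/(p-1)) v(r x) is at most (e / 2) v(r x) / (v(r x) + 1); the 1 keeps the
     denominator positive. *)
  pose b := (e / 2 / (v (r x) + 1)) `^ (p - 1).
  have b0 : 0 < b by rewrite powR_gt0.
  exists (Num.min (Lambda (e / 2) / 2) b); split.
  - by rewrite lt_min b0 divr_gt0.
  - by rewrite gt_min ltr_pdivrMr// ltr_pMr// ltr1n.
  - apply: (@le_trans _ _ (e / 2 / (v (r x) + 1) * (v (r x) + 1))); last first.
      by rewrite divfK// gt_eqF// ltr_wpDl.
    apply: ler_pM => //; [exact: powR_ge0| |by rewrite lerDl].
    have -> : e / 2 / (v (r x) + 1) = b `^ (p - 1)^-1.
      by rewrite /b -powRrM divff ?gt_eqF// powRr1// ltW.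
    apply: ge0_ler_powR; rewrite ?nnegrE ?invr_ge0 ?(ltW p10) ?(ltW b0)//.
      by rewrite le_min (ltW b0) divr_ge0// ltW.
    by rewrite ge_min lexx orbT.
pose Phi := barrier p zeta v T A (e / 2) kap.
have HPhi (s : R) := barrierP T A (e / 2) kap z0 z1 Dv cz s.
have HY (s : R) := barrier_fluxP A kap z0 z1 DS cdS DW s.
(* At r0, where v is zero, the barrier equals e / 2 + |B| + 1; by continuity it stays above B on a
   shell. *)
have [r1 r01 Br1] : exists2 r1, r0 < r1 & forall s, r0 < s -> s < r1 -> B <= Phi s.
  have B_lt : B < Phi r0.
    have [_ v0 _] := low r0 ltac:(by rewrite lerDl ltW).
    rewrite /Phi /barrier v0 mulr0 addr0.
    have -> : T - r0 = L by rewrite /T addrC addKr.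
    rewrite pospowE ?(ltW L0)// AL; have := ler_norm B; move: eps0; lra.
  have /= [d /= d0 Hd] := cvgr_gt _ (is_derive_cont (HPhi r0).1) _ B_lt.
  exists (r0 + d) => [|s r0s sd]; first by rewrite ltrDl.
  by apply: ltW; apply: Hd; rewrite /= ltr_distlC; apply/andP; split; lra.
(* From r2 on, the summand kap^(1/(p-1)) v alone exceeds |B|. *)
have [r2 Tr2 Br2] := v_unbounded (`|B| / kap `^ (p - 1)^-1).
have k0 : 0 < kap `^ (p - 1)^-1 by rewrite powR_gt0.
have outer y : r2 < r y -> B <= Phi (r y).
  move=> ry; apply: le_trans (ler_norm _) _.
  rewrite ltr_pdivrMr// in Br2; apply: le_trans (ltW Br2) _.
  rewrite mulrC; apply: (@le_trans _ _ (kap `^ (p - 1)^-1 * v (r y))).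
    by rewrite ler_pM2l//; apply: v_le; exact: ltW.
  by rewrite /Phi /barrier lerDr addr_ge0 ?(ltW eps0)// mulr_ge0 ?(ltW A0)// pospow_ge0.
have SE s : r0 < s -> sigma s ^+ m.-1 = S s.
  by move=> rs; rewrite /S tauE// ltW// (lt_trans r00).
have Ctrl : u x <= Phi (r x).
  apply: (comparison hm hp hsigma r00 ED hC1 hLambda_ge0 hLambda_mono
    (fun y Ey => hu_ge0 y (ED y Ey)) (fun y Ey => HB y (ED y Ey)) hu
    (r1 := r1) (r2 := r2) (fun s _ => HPhi s) (fun s _ => HY s)) => //.
  - by move=> s rs; rewrite SE//; exact: (barrier_slope_flux hp z0 z1 A0 kap0 low high).
  - move=> s rs; rewrite SE//.
    apply: (@barrier_supersolution _ p zeta S dS Lambda W v z T L A K c (e / 2) kap) => //.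
    + by rewrite TL => t rt; apply: S0; exact: lt_trans rt.
    + rewrite TL => t rt; have t0 := lt_trans r00 rt; apply: dSK; first exact: tau0.
      by rewrite -tauE ?(ltW t0)// -dE// Ha.
    + by move=> t t0; rewrite AL; exact: Hc.
    + by rewrite TL.
  - by move=> s _; apply: le_trans (ltW eps0) _; exact: barrier_ge Dv low high s.
  - by move=> y ry yr1; apply: le_trans (HB _ (ED _ ry)) _; exact: Br1.
  - move=> y ry; apply: le_trans (outer _ ry); apply: HB; apply: ED => /=.
    by apply: lt_trans ry; apply: lt_le_trans Tr2; rewrite ltrDl.
  - by apply: lt_trans Trx; rewrite ltrDl.
(* Since r x > T, the dead-core summand vanishes at x, and the other two are at most e / 2 each. *)
apply: le_trans Ctrl _; rewrite /Phi /barrier pospow0 ?mulr0 ?addr0; last 2 first.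
- by rewrite gt_eqF// divr_gt0 ?subr_gt0// (lt_trans _ hp).
- by rewrite subr_le0 ltW.
by move: kapv; lra.
Qed.
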